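(* Let $\mathcal X_N^*=\max_{z\in V_N}\mathcal X_z^N$ and $\mathcal Y_N^*=\max_{z\in V_N}\mathcal Y_z^N$ be the maxima of the Gaussian free field and of the torus Gaussian free field on $V_N$. There exists a constant $C_2$ such that, for all $N=2^n$ with $n\ge1$ an integer, $$\max(E\mathcal X_N^*,E\mathcal Y_N^* )\le 2\log 2\,\sqrt{\frac2\pi}\;n-\frac34\sqrt{\frac2\pi}\,\log n+C_2 .$$
   Context: For an integer $N\ge1$, $V_N=([0,N-1]\cap\mathbb Z)^2$, $V_N^o=((0,N-1)\cap\mathbb Z)^2$ and $\partial V_N=V_N\setminus V_N^o$. Let $\{w_m\}_{m\ge0}$ be simple random walk on $\mathbb Z^2$, with $E^x$ the expectation for the walk started at $x$. GFF: let $\tau=\min\{m\ge 0: w_m\in\partial V_N\}$ and $G_N(x,y)=E^x\big(\sum_{m=0}^{\tau-1}\mathbf 1_{\{w_m=y\}}\big)$ for $x,y\in V_N$ (so $G_N$ vanishes if $x$ or $y$ is in $\partial V_N$). The Gaussian free field $\{\mathcal X_z^N\}_{z\in V_N}$ is the zero-mean Gaussian field with covariance $G_N$. Torus GFF: write $x\sim_N y$ if $x-y\in(N\mathbb Z)^2$. Let $\tau'$ be an exponential random variable of parameter $1/N^2$ (mean $N^2$) independent of the walk, and $\bar G_N(x,y)=E^x\big(\sum_{0\le m\le\tau'}\mathbf 1_{\{w_m\sim_N y\}}\big)$ for $x,y\in V_N$. The torus Gaussian free field (TGFF) $\{\mathcal Y_z^N\}_{z\in V_N}$ is the zero-mean Gaussian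 field with covariance $\bar G_N$. $\log$ is the natural logarithm. *)

(* Defs.v *)
From HB Require Import structures.
From mathcomp Require Import all_boot all_order all_algebra.
From mathcomp Require Import all_classical all_reals all_analysis.

Set Implicit Arguments.
Unset Strict Implicit.
Unset Printing Implicit Defensive.

Import Order.TTheory GRing.Theory Num.Theory.
Import numFieldNormedType.Exports.

Local Open Scope classical_set_scope.
Local Open Scope ring_scope.

Notation Z2 := (int * int)%type.

Section Box.
Variable N : nat.

Definition box : set Z2 :=
  [set z | 0 <= z.1 <= N%:Z - 1 /\ 0 <= z.2 <= N%:Z - 1].

Definition box_interior : set Z2 :=
  [set z | 0 < z.1 < N%:Z - 1 /\ 0 < z.2 < N%:Z - 1].

Definition box_boundary : set Z2 := box `\` box_interior.

(* The finite index type of the fields; [site] is a bijection onto [box]. *)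
Definition V : finType := ('I_N * 'I_N)%type.

Definition site (z : V) : Z2 := ((z.1 : nat)%:Z, (z.2 : nat)%:Z).

Definition torus_equiv (x y : Z2) : bool :=
  (N%:Z %| x.1 - y.1)%Z && (N%:Z %| x.2 - y.2)%Z.

End Box.

Section Walk.
Context d (W : measurableType d) (R : realType).
Implicit Types (P : probability W R) (w : nat -> W -> Z2).

Definition unit_steps : seq Z2 := [:: (1, 0); (-1, 0); (0, 1); (0, -1)].

Definition increment w (m : nat) (t : W) : Z2 := w m.+1 t - w m t.

(* Z^2 carries the discrete sigma-algebra. *)
Definition simple_random_walk P (x : Z2) w : Prop :=
  [/\ forall m (A : set Z2), measurable (w m @^-1` A),
      P [set t | w 0%N t = x] = 1%E,
      forall m (e : Z2), P [set t | increment w m t = e] =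
        (if e \in unit_steps then 4^-1 else 0)%:E
    & forall (s : seq nat) (A : nat -> set Z2), uniq s ->
        P (\bigcap_(m in [set` s]) (increment w m @^-1` A m)) =
        (\prod_(m <- s) P (increment w m @^-1` A m))%E].

Definition walk_events w : set (set W) :=
  <<s [set w m @^-1` A | m in [set: nat] & A in [set: set Z2]] >>.

Definition independent_exponential_time P w (rate : R) (tau : {RV P >-> R}) :=
  (forall B : set R, measurable B ->
     distribution P tau B = exponential_prob rate B) /\
  (forall (E : set W) (B : set R), walk_events w E -> measurable B ->
     P (E `&` tau @^-1` B) = (P E * P (tau @^-1` B))%E).

(* First hitting time of a set, equal to +oo if the set is never hit. *)
Definition hitting_time (A : set Z2) w (t : W) : \bar R :=
  ereal_inf [set m%:R%:E | m in [set m : nat | A (w m t)]].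

(* In both covariances [Px x] is the law of the walk started at [x]. *)
Definition green_box (N : nat) (Px : Z2 -> probability W R) w
    (x y : V N) : \bar R :=
  (\int[Px (site x)]_t
     \sum_(0 <= m <oo | (m%:R)%:E < hitting_time (box_boundary N) w t)
       (w m t == site y)%:R%:E)%E.

Definition green_torus (N : nat) (Px : Z2 -> probability W R) w
    (tau : W -> R) (x y : V N) : \bar R :=
  (\int[Px (site x)]_t
     \sum_(0 <= m <oo | (m%:R <= tau t)%R)
       (torus_equiv N (w m t) (site y))%:R%:E)%E.

End Walk.

Section GaussianField.
Context d (T : measurableType d) (R : realType) (P : probability T R).

(* [normal_prob m 0] is the uniform law on [0, 1], so the degenerate case has
   to be treated separately. *)
Definition gaussian_law (m s : R) (B : set R) : \bar R :=
  if s == 0 then dirac m B else normal_prob m s B.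

Definition centered_gaussian_field (I : finType) (X : I -> {RV P >-> R})
    (C : I -> I -> \bar R) : Prop :=
  [/\ forall a : I -> R, exists m s : R, 0 <= s /\
        forall B : set R, measurable B ->
          P ((fun t => \sum_i a i * X i t) @^-1` B) = gaussian_law m s B,
      forall i, ('E_P[X i] = 0)%E
    & forall i j, covariance P (X i) (X j) = C i j].

(* Expectation of the maximum; taken in the extended reals only so that the
   empty maximum has a value. *)
Definition expected_max (I : finType) (X : I -> T -> R) : \bar R :=
  (\int[P]_t \big[maxe/-oo]_(i : I) (X i t)%:E)%E.

End GaussianField.

(* Main.v *)
(** Write [gamma(x, y)] for the variance of the increment of either field.  The
   covariance satisfies [G = 1_D (1 + q P G)], with [P] the transition kernel of
   the walk on the torus (for the first field [D] is the interior of the box and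
   [q = 1]), so a dual bound for the Dirichlet form of [G(., x) - G(., y)] gives
   [gamma <= 2 sum_(m < 2 d^2) p_m(0) + O(d^2 p_(2 d^2)(0))], where [p] is the
   heat kernel of the torus and [d] is the sup-distance of [x] and [y].
   Decoupling the diagonal coordinates and Wallis' product yield
   [gamma <= (4 / pi) log d + O(1)].

   Up to finitely many additional leaf levels, the right-hand side is at most the
   increment variance of a branching field on the 4-ary tree of depth
   [n], with edge variance [(2 / pi) log 2].  The Sudakov-Fernique comparison of
   the two fields is carried out for the expectation of [lse], a smooth version
   of the maximum, by a Lindeberg replacement of the Gaussian field by small
   Rademacher steps along the edges of the tree.

   The tail of the maximum of the branching field is at most the solution of the
   union-bound recursion [w := min(1, 4 heat w)], and an explicit supersolution
   places its front at [lam t - (3 / (2 lam)) log t + O(1)] with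
   [lam = sqrt (2 log 4)], with an exponential tail ahead of it. *)

Require Import Defs.
From HB Require Import structures.
From mathcomp Require Import all_boot all_order all_algebra.
From mathcomp Require Import all_classical all_reals all_analysis.
From mathcomp Require Import measurable_realfun ring lra zify.

Set Implicit Arguments.
Unset Strict Implicit.
Unset Printing Implicit Defensive.

Import Order.TTheory GRing.Theory Num.Theory.
Import numFieldNormedType.Exports.

Local Open Scope classical_set_scope.
Local Open Scope ring_scope.

(** The hypotheses say only that linear combinations of the field are Gaussian; the independent
    small pieces that a Lindeberg replacement consumes have to be produced. They come from a
    one-dimensional fact: two independent copies with weights sqrt p and sqrt q, p + q = 1, have the
    law of one. This settles the integrals of cosines of linear forms, and a trigonometric operator
    of Bernstein type, with error quadratic in the point, carries it over to Lipschitz functions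
    such as [lse]. The branching field is not a random object here: its expectations are finite
    averages [ravg] over signs. Their order is immaterial, so the steps can be regrouped edge by
    edge and the tail becomes a deterministic recursion. The number K of steps per edge is chosen
    after n, hence may beat any constant depending on n. Points at distance about 2^L are separated
    by two branches of L edges, of total variance 2 L s^2 = (4/pi) log 2^L; this fixes the edge
    variance s^2. Then s lam = 2 log 2 sqrt(2/pi) and 3 s / (2 lam) = (3/4) sqrt(2/pi) are the two
    coefficients of the theorem. *)

(** * Densities of the normal and exponential laws *)

Section densities.
Context (R : realType).
Local Notation mu := (@lebesgue_measure R).

(** The Radon-Nikodym derivative of the normal law agrees almost everywhere with [normal_pdf], both
    having the same integral over every measurable set. *)
Lemma ge0_integral_normal_prob (m s : R) (f : R -> \bar R) : s != 0 ->
  measurable_fun setT f -> (forall x, 0 <= f x)%E ->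
  (\int[normal_prob m s]_x f x = \int[mu]_x (f x * (normal_pdf m s x)%:E))%E.
Proof.
move=> s0 mf f0; have dom := normal_prob_dominates m s.
have mg : measurable_fun setT (EFin \o normal_pdf m s).
  by apply/measurable_EFinP; exact: measurable_normal_pdf.
rewrite -(Radon_Nikodym_SigmaFinite.change_of_variables dom f0 measurableT mf).
have iRN := Radon_Nikodym_SigmaFinite.f_integrable dom.
have RN0 := Radon_Nikodym_SigmaFinite.f_ge0 dom.
apply: ge0_ae_eq_integral => //.
- by apply: emeasurable_funM => //; exact: measurable_int iRN.
- exact: emeasurable_funM.
- by move=> x _; rewrite mule_ge0.
- by move=> x _; rewrite mule_ge0// lee_fin normal_pdf_ge0.
suff : ae_eq mu setT (Radon_Nikodym_SigmaFinite.f (normal_prob m s) mu) (EFin \o normal_pdf m s).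
  by apply: filterS => x h xT; rewrite /= (h xT).
apply: integral_ae_eq => // A _ mA.
by rewrite -(Radon_Nikodym_SigmaFinite.f_integral dom).
Qed.

(** At a natural number [m] this is the chance that the torus walk is not yet killed at time [m], so
    killing acts as a discount [expR (- rate)] per step. The left end is closed because the Green
    function counts the times [m <= tau]. *)
Lemma exponential_tail (rate x : R) : 0 < rate -> 0 <= x ->
  exponential_prob rate `[x, +oo[%classic = (expR (- rate * x))%:E.
Proof.
move=> rate0 x0.
pose f y := (exponential_pdf rate y)%:E.
have f0 y : (0 <= f y)%E by rewrite lee_fin exponential_pdf_ge0// ltW.
have mf : measurable_fun setT f.
  by apply/measurable_EFinP; exact: measurable_exponential_pdf.
have low : (\int[mu]_(y in `]-oo, x]) f y = 1 - (expR (- rate * x))%:E)%E.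
  transitivity (\int[mu]_(y in `[0%R, x]) f y)%E.
    rewrite integral_mkcond [RHS]integral_mkcond; apply: eq_integral => y _.
    rewrite !patchE !mem_setE !in_itv/=; have [//|y0] := leP 0 y.
    by rewrite /f lt0_exponential_pdf// if_same.
  move: x0; rewrite le_eqVlt => /predU1P[<-|x0]; last exact: exponential_prob_itv0c.
  by rewrite set_itv1 integral_set1 mulr0 expR0 subee.
have : (\int[mu]_y f y = 1)%E := integral_exponential_pdf rate0.
rewrite -(setUv [set` `]-oo, x]]) ge0_integral_setU//; last 3 first.
- exact: measurableC.
- by rewrite setUv.
- exact/disj_setPCl.
rewrite low setCitvl /exponential_prob -integral_itv_obnd_cbnd; last exact: measurable_funTS.
set I := (X in X = _ -> _); have E : I = (1 - (expR (- rate * x))%:E + \int[mu]_(y in `]x, +oo[)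
  f y)%E by [].
rewrite {}E {I} -/f; case: (integral _ _ _) => // r /= [h].
by congr EFin; move: h; lra.
Qed.

End densities.

(** * Stability of the centred Gaussian law *)

Section gaussian_law_theory.
Context (R : realType).
Implicit Types (m s : R) (f : R -> R).

Definition gaussian_mean m s (f : R -> \bar R) : \bar R :=
  if s == 0 then f m
  else (\int[lebesgue_measure]_x (f x * (normal_pdf m s x)%:E))%E.

Lemma ge0_integral_gaussian_law d (T : measurableType d) (P : probability T R)
    (U : T -> R) m s (f : R -> \bar R) :
  measurable_fun setT U ->
  (forall B, measurable B -> P (U @^-1` B) = gaussian_law m s B) ->
  measurable_fun setT f -> (forall x, 0 <= f x)%E ->
  (\int[P]_t f (U t) = gaussian_mean m s f)%E.
Proof.
move=> mU lawU mf f0.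
pose V : T -> measurableTypeR R := U.
have mV : measurable_fun setT V by exact: mU.
pose X : {RV P >-> measurableTypeR R} := mfun_Sub (mem_set mV).
transitivity (\int[distribution P X]_x f x)%E.
  by rewrite ge0_integral_distribution.
rewrite /gaussian_mean; move: lawU; rewrite /gaussian_law; case: ifPn => [s0|s0] lawU.
  rewrite (eq_measure_integral (dirac (m : measurableTypeR R)))//; last by move=> A mA _;
    exact: lawU.
  by rewrite integral_dirac// diracT mul1e.
transitivity (\int[normal_prob m s]_x f x)%E.
  by apply: eq_measure_integral => A mA _; exact: lawU.
exact: ge0_integral_normal_prob.
Qed.

(** Completing the square: the exponential tilt moves the mean to [m + t * s ^+ 2]. Every Gaussian
    moment bound below is deduced from this formula. *)
Lemma gaussian_mean_expR m s (t : R) :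
  gaussian_mean m s (fun x => (expR (t * x))%:E) =
  (expR (t * m + t ^+ 2 * s ^+ 2 / 2))%:E.
Proof.
rewrite /gaussian_mean; case: ifPn => [/eqP ->|s0].
  by rewrite expr0n/= mulr0 mul0r addr0.
have s2 : s ^+ 2 != 0 by rewrite sqrf_eq0.
transitivity (\int[lebesgue_measure]_x ((expR (t * m + t ^+ 2 * s ^+ 2 / 2))%:E *
   (normal_pdf (m + t * s ^+ 2) s x)%:E))%E.
  apply: eq_integral => x _; rewrite -EFinM; congr (_%:E).
  rewrite !normal_pdfE// /normal_fun mulrCA [RHS]mulrCA -!expRD; congr (_ * expR _).
  by field; rewrite s0.
rewrite ge0_integralZl//.
- by rewrite integral_normal_pdf mule1.
- by apply/measurable_EFinP; exact: measurable_normal_pdf.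
- by move=> x _; rewrite lee_fin normal_pdf_ge0.
Qed.

Lemma normal_pdf_affine (a b s x : R) : 0 < a -> s != 0 ->
  normal_pdf b (a * s) (a * x + b) * a = normal_pdf 0 s x.
Proof.
move=> a0 s0; have as0 : a * s != 0 by rewrite mulf_neq0// gt_eqF.
rewrite !normal_pdfE// /normal_fun /normal_peak mulrAC; congr (_ * expR _).
  rewrite exprMn -mulrA -mulrnAr sqrtrM ?sqr_ge0// sqrtr_sqr gtr0_norm// invfM.
  by rewrite mulrAC mulVf ?mul1r// gt_eqF.
by field; rewrite s0 gt_eqF.
Qed.

(** Detailed balance for the Mehler kernel: when [p + q = 1], the joint density of [u] and of
    [sqrt p * u] plus independent noise is symmetric in its two variables. *)
Lemma normal_pdf_swap (p q s u w : R) : 0 < p -> 0 < q -> p + q = 1 -> s != 0 ->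
  normal_pdf (Num.sqrt p * u) (Num.sqrt q * s) w * normal_pdf 0 s u =
  normal_pdf 0 s w * normal_pdf (Num.sqrt p * w) (Num.sqrt q * s) u.
Proof.
move=> p0 q0 pq s0.
have sq0 : Num.sqrt q != 0 by rewrite gt_eqF// sqrtr_gt0.
have qs0 : Num.sqrt q * s != 0 by rewrite mulf_neq0.
rewrite !normal_pdfE// /normal_fun.
rewrite mulrACA -expRD [RHS]mulrACA -expRD [X in X * _ = _]mulrC; congr (_ * expR _).
have hp : Num.sqrt p ^+ 2 = p by rewrite sqr_sqrtr// ltW.
have hq : Num.sqrt q ^+ 2 = q by rewrite sqr_sqrtr// ltW.
rewrite !exprMn hq !subr0.
have -> : (w - Num.sqrt p * u) ^+ 2 = w ^+ 2 - 2 * Num.sqrt p * u * w + p * u ^+ 2.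
  by rewrite -[in p * _]hp; ring.
have -> : (u - Num.sqrt p * w) ^+ 2 = u ^+ 2 - 2 * Num.sqrt p * u * w + p * w ^+ 2.
  by rewrite -[in p * _]hp; ring.
have -> : p = 1 - q by rewrite -pq addrK.
by field; rewrite s0 gt_eqF.
Qed.

Lemma integral_normal_affine (a b : R) s f : 0 < a -> s != 0 -> continuous f ->
  (forall x, 0 <= f x) ->
  (\int[lebesgue_measure]_x ((f (a * x + b))%:E * (normal_pdf 0 s x)%:E) =
   \int[lebesgue_measure]_x ((f x)%:E * (normal_pdf b (a * s) x)%:E))%E.
Proof.
move=> a0 s0 cf f0; pose F x := a * x + b.
have as0 : a * s != 0 by rewrite mulf_neq0// gt_eqF.
have dF x : is_derive (x : R^o) 1 F a.
  have -> : F = (a *: id) + cst b by [].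
  by apply: is_derive_eq; rewrite addr0 /GRing.scale/= mulr1.
have F'E : F^`()%classic = cst a.
  by apply/funext => x; rewrite derive1E; exact: derive_val.
under [RHS]eq_integral do rewrite -EFinM.
rewrite [RHS](@increasing_ge0_integration_by_substitutionT _ F); last first.
- by move=> x; rewrite mulr_ge0// normal_pdf_ge0.
- move=> x; apply: cvgM; [exact: cf|exact: continuous_normal_pdf].
- apply/cvgryPge => A; apply: filterS (nbhs_pinfty_ge (num_real ((A - b) / a))) => x.
  by rewrite /F -lerBlDr mulrC -ler_pdivrMl// mulrC.
- apply/cvgrNyPle => A; apply: filterS (nbhs_ninfty_le (num_real ((A - b) / a))) => x.
  by rewrite /F -lerBrDr -ler_pdivlMl// mulrC.
- by move=> x; have [] := dF x.
- by rewrite F'E; exact: is_cvg_cst.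
- by rewrite F'E; exact: is_cvg_cst.
- by rewrite F'E => x; exact: cvg_cst.
- by move=> x y xy; rewrite /F ltr_leD// ltr_pM2l.
apply: eq_integral => x _; rewrite F'E !fctE /= -mulrA -EFinM; congr (_ * _)%:E.
by rewrite normal_pdf_affine.
Qed.

(** The independent copy is a second integration variable over the same [P]. Writing the inner
    integral with a density in the sum [w], [normal_pdf_swap] and Tonelli let [u] be integrated out
    first. *)
Lemma gaussian_convolution d (T : measurableType d) (P : probability T R)
    (U : T -> R) s (p q : R) f :
  measurable_fun setT U ->
  (forall B, measurable B -> P (U @^-1` B) = gaussian_law 0 s B) ->
  0 < p -> 0 < q -> p + q = 1 -> continuous f -> (forall x, 0 <= f x) ->
  (\int[P]_t \int[P]_t' (f (Num.sqrt p * U t + Num.sqrt q * U t'))%:E =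
   \int[P]_t (f (U t))%:E)%E.
Proof.
move=> mU lawU p0 q0 pq cf f0.
have mf : measurable_fun setT f by exact: continuous_measurable_fun.
have mfE : measurable_fun setT (EFin \o f) by exact/measurable_EFinP.
rewrite (ge0_integral_gaussian_law (f := EFin \o f) mU lawU)//.
have cfpq (a b : R) : continuous (fun v : R => f (a + b * v)).
  move=> v; apply: (@cvg_comp _ _ _ (fun v : R => a + b * v) f); last exact: cf.
  by apply: cvgD; [exact: cvg_cst|apply: cvgM; [exact: cvg_cst|exact: cvg_id]].
under eq_integral => t _.
  rewrite (ge0_integral_gaussian_law (f := fun v => (f (Num.sqrt p * U t + Num.sqrt q * v))%:E)
    mU lawU)//; last 2 first.
  - by apply/measurable_EFinP; exact: continuous_measurable_fun.
  - by move=> x; rewrite lee_fin.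
  over.
rewrite /gaussian_mean; case: ifPn => [/eqP s0|s0].
  under eq_integral => t _ do rewrite mulr0 addr0.
  rewrite (ge0_integral_gaussian_law (f := fun v => (f (Num.sqrt p * v))%:E) mU lawU)//;
    last 2 first.
  - apply/measurable_EFinP; apply: continuous_measurable_fun.
    by under eq_fun do rewrite -[_ * _]add0r; exact: cfpq.
  - by move=> x; rewrite lee_fin.
  by rewrite /gaussian_mean s0 eqxx/= mulr0.
have sq0 : 0 < Num.sqrt q by rewrite sqrtr_gt0.
have qs0 : Num.sqrt q * s != 0 by rewrite mulf_neq0// gt_eqF.
pose g (u w : R) : \bar R := ((f w)%:E * (normal_pdf (Num.sqrt p * u) (Num.sqrt q * s) w)%:E)%E.
have mnf : measurable_fun setT (fun z : measurableTypeR R * measurableTypeR R =>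
  normal_pdf (Num.sqrt p * z.1) (Num.sqrt q * s) z.2).
  rewrite (_ : (fun _ => _) = fun z : measurableTypeR R * measurableTypeR R =>
    normal_peak (Num.sqrt q * s) *
      expR (- (z.2 - Num.sqrt p * z.1) ^+ 2 / ((Num.sqrt q * s) ^+ 2 *+ 2))); last first.
    by apply/funext => z; rewrite normal_pdfE.
  apply: measurable_funM => //; apply: measurableT_comp => //.
  apply: measurable_funM => //; apply: measurableT_comp => //.
  apply: measurable_funX; apply: measurable_funB => //.
  by apply: measurable_funM.
have mg : measurable_fun setT (fun z : measurableTypeR R * measurableTypeR R => g z.1 z.2).
  apply: emeasurable_funM; apply/measurable_EFinP => //.
  by apply: measurableT_comp.
have g0 u w : (0 <= g u w)%E by rewrite mule_ge0 ?lee_fin// normal_pdf_ge0.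
transitivity (\int[P]_t (fun u => \int[lebesgue_measure]_w g u w) (U t))%E.
  apply: eq_integral => t _.
  by under eq_integral => x _ do rewrite addrC; rewrite (integral_normal_affine _ sq0 s0 cf f0).
rewrite (ge0_integral_gaussian_law (f := fun u => \int[lebesgue_measure]_w g u w)%E mU lawU)//;
  last 2 first.
- exact: (measurable_fun_fubini_tonelli_F (m2 := lebesgue_measure) _ mg (fun z => g0 z.1 z.2)).
- by move=> x; exact: integral_ge0.
rewrite /gaussian_mean (negbTE s0).
have n0 := normal_pdf_ge0 0 s.
have mn := measurable_normal_pdf 0 s.
under eq_integral => u _.
  rewrite -ge0_integralZr//; last 2 first.
  - apply: emeasurable_funM; apply/measurable_EFinP => //; exact: measurable_normal_pdf.
  - by rewrite lee_fin.
  over.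
rewrite /= (fubini_tonelli (m1 := lebesgue_measure) (m2 := lebesgue_measure)
  (fun z : measurableTypeR R * measurableTypeR R => g z.1 z.2 * (normal_pdf 0 s z.1)%:E)%E)//=.
- apply: eq_integral => w _.
  transitivity (\int[lebesgue_measure]_u ((f w)%:E * (normal_pdf 0 s w)%:E *
      (normal_pdf (Num.sqrt p * w) (Num.sqrt q * s) u)%:E))%E.
    by apply: eq_integral => u _; rewrite /g -!EFinM -!mulrA normal_pdf_swap.
  rewrite ge0_integralZl//=.
  + by rewrite integral_normal_pdf mule1.
  + by apply/measurable_EFinP; exact: measurable_normal_pdf.
  + by move=> u _; rewrite lee_fin normal_pdf_ge0.
  + by rewrite mule_ge0 ?lee_fin.
- apply: emeasurable_funM => //; apply/measurable_EFinP; exact: measurableT_comp.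
- by move=> z; apply: mule_ge0; [exact: g0|rewrite lee_fin; exact: n0].
Qed.
End gaussian_law_theory.

(** * Real-valued integrable random variables *)

Section real_integrable.
Context d (T : measurableType d) (R : realType) (P : probability T R).
Implicit Types f g : T -> R.

Definition rintegrable f := P.-integrable setT (EFin \o f).

Lemma rintegrable_measurable f : rintegrable f -> measurable_fun setT f.
Proof. by case/integrableP => /measurable_EFinP. Qed.

Lemma rintegrable_cst (c : R) : rintegrable (fun=> c).
Proof. exact: finite_measure_integrable_cst. Qed.

Lemma rintegrableD f g : rintegrable f -> rintegrable g ->
  rintegrable (fun t => f t + g t).
Proof. by move=> hf hg; exact: (integrableD measurableT hf hg). Qed.

Lemma rintegrableZ (c : R) f : rintegrable f -> rintegrable (fun t => c * f t).
Proof. by move=> hf; exact: (integrableZl measurableT c hf). Qed.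

Lemma rintegrable_sum (I : Type) (r : seq I) (f : I -> T -> R) :
  (forall i, rintegrable (f i)) -> rintegrable (fun t => \sum_(i <- r) f i t).
Proof.
move=> hf; elim: r => [|i r IH].
  by under eq_fun do rewrite big_nil; exact: rintegrable_cst.
by under eq_fun do rewrite big_cons; exact: rintegrableD.
Qed.

Lemma rintegrable_le f g : measurable_fun setT f -> rintegrable g ->
  (forall t, `|f t| <= g t) -> rintegrable f.
Proof.
move=> mf hg fg; apply: le_integrable hg => //; first exact/measurable_EFinP.
by move=> t _; rewrite /= lee_fin (le_trans (fg t))// ler_norm.
Qed.

Lemma rintegrable_norm f : rintegrable f -> rintegrable (fun t => `|f t|).
Proof.
move=> hf; apply: (le_integrable measurableT _ _ hf) => //=.
- apply/measurable_EFinP; apply: measurableT_comp => //.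
  exact: rintegrable_measurable.
- by move=> t _; rewrite lee_fin normr_id.
Qed.

Lemma Rintegral_sum (I : Type) (r : seq I) (f : I -> T -> R) :
  (forall i, rintegrable (f i)) ->
  \int[P]_t (\sum_(i <- r) f i t) = \sum_(i <- r) \int[P]_t f i t.
Proof.
move=> hf; elim: r => [|i r IH].
  by under eq_Rintegral do rewrite big_nil; rewrite big_nil Rintegral_cst// mul0r.
under eq_Rintegral do rewrite big_cons; rewrite big_cons RintegralD ?IH//.
- exact: hf.
- exact: (rintegrable_sum r hf).
Qed.

Lemma Rintegral_cst1 (c : R) : \int[P]_t c = c.
Proof.
transitivity (c * fine (P setT)); first exact: Rintegral_cst.
by rewrite probability_setT mulr1.
Qed.

Lemma EFin_Rintegral f : rintegrable f -> (\int[P]_t f t)%:E = (\int[P]_t (f t)%:E)%E.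
Proof. by move=> hf; rewrite /Rintegral fineK//; exact: integrable_fin_num. Qed.

End real_integrable.

(** * Moments of a Gaussian variable *)

Section gaussian_moments.
Context d (T : measurableType d) (R : realType) (P : probability T R).
Variables (U : T -> R) (m s : R).
Hypothesis mU : measurable_fun setT U.
Hypothesis lawU : forall B, measurable B -> P (U @^-1` B) = gaussian_law m s B.

Lemma gaussian_integral_expR (c : R) :
  (\int[P]_t (expR (c * U t))%:E = (expR (c * m + c ^+ 2 * s ^+ 2 / 2))%:E)%E.
Proof.
rewrite (ge0_integral_gaussian_law (f := fun x => (expR (c * x))%:E) mU lawU).
- exact: gaussian_mean_expR.
- by apply/measurable_EFinP; apply: measurableT_comp => //; exact: measurable_funM.
- by move=> x; rewrite lee_fin expR_ge0.
Qed.

Lemma gaussian_integrable_expR (c : R) : rintegrable P (fun t => expR (c * U t)).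
Proof.
apply/integrableP; split.
  by apply/measurable_EFinP; apply: measurableT_comp => //; exact: measurable_funM.
under eq_integral => t _ do rewrite /= ger0_norm ?expR_ge0//.
by rewrite gaussian_integral_expR ltry.
Qed.

Lemma normrX3_le_expR (x : R) : `|x| ^+ 3 <= 27 * (expR x + expR (- x)).
Proof.
have h : `|x| ^+ 3 <= 27 * expR `|x|.
  have -> : expR `|x| = expR (`|x| / 3) ^+ 3.
    by rewrite -expRM_natl; congr expR; field.
  have -> : `|x| ^+ 3 = 27 * (`|x| / 3) ^+ 3 by field.
  rewrite ler_pM2l// lerXn2r ?nnegrE ?expR_ge0 ?divr_ge0//.
  by rewrite (le_trans _ (expR_ge1Dx _))// lerDr.
apply: (le_trans h); rewrite ler_pM2l//.
have [x0|x0] := leP 0 x; first by rewrite ger0_norm// lerDl expR_ge0.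
by rewrite ltr0_norm// lerDr expR_ge0.
Qed.

(** Third absolute moments control the Taylor remainder of the Lindeberg step. *)
Lemma gaussian_integrable_norm3 : rintegrable P (fun t => `|U t| ^+ 3).
Proof.
apply: (@rintegrable_le _ _ _ _ _ (fun t => 27 * (expR (1 * U t) + expR (-1 * U t)))).
- by apply: measurable_funX; exact: measurableT_comp.
- by apply: rintegrableZ; apply: rintegrableD; exact: gaussian_integrable_expR.
- by move=> t; rewrite ger0_norm ?exprn_ge0// mul1r mulN1r; exact: normrX3_le_expR.
Qed.

Lemma gaussian_integrable_sqr : rintegrable P (fun t => U t ^+ 2).
Proof.
apply: (@rintegrable_le _ _ _ _ _ (fun t => 1 + `|U t| ^+ 3)).
- exact: measurable_funX.
- by apply: rintegrableD; [exact: rintegrable_cst|exact: gaussian_integrable_norm3].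
- move=> t; rewrite ger0_norm ?sqr_ge0// -(real_normK (num_real (U t))).
  have := normr_ge0 (U t); move: `|U t| => y y0.
  have : 0 <= (1 - y) ^+ 2 * (1 + y) by rewrite mulr_ge0 ?sqr_ge0 ?addr_ge0.
  nra.
Qed.

Lemma gaussian_integrable : rintegrable P U.
Proof.
apply: (@rintegrable_le _ _ _ _ _ (fun t => 1 + U t ^+ 2)) => //.
- by apply: rintegrableD; [exact: rintegrable_cst|exact: gaussian_integrable_sqr].
- move=> t; rewrite -(real_normK (num_real (U t))).
  have := normr_ge0 (U t); move: `|U t| => y y0; nra.
Qed.

(* Jensen's inequality for [expR (c * U)] with [c] of either sign. *)
Lemma gaussian_centered : \int[P]_t U t = 0 -> m = 0.
Proof.
move=> EU0.
have h c : 0 <= c * m + c ^+ 2 * s ^+ 2 / 2.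
  rewrite -ler_expR expR0 -lee_fin -gaussian_integral_expR.
  rewrite -EFin_Rintegral; last exact: gaussian_integrable_expR.
  have hc : rintegrable P (fun t => c * U t) by apply: rintegrableZ; exact: gaussian_integrable.
  have -> : 1 = \int[P]_t (1 + c * U t).
    rewrite RintegralD//; last exact: rintegrable_cst.
    by rewrite RintegralZl ?Rintegral_cst1 ?EU0 ?mulr0 ?addr0//; exact: gaussian_integrable.
  rewrite lee_fin; apply: le_Rintegral => //.
  - by apply: rintegrableD => //; exact: rintegrable_cst.
  - exact: gaussian_integrable_expR.
  - by move=> t _; rewrite expR_ge1Dx.
have s20 : 0 < s ^+ 2 + 1 by rewrite ltr_wpDl ?sqr_ge0.
(* The minimiser of the quadratic is [- m / s ^+ 2]; adding one to the denominator keeps the value a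
   negative multiple of [m ^+ 2] and allows [s = 0]. *)
have := h (- m / (s ^+ 2 + 1)).
have -> : - m / (s ^+ 2 + 1) * m + (- m / (s ^+ 2 + 1)) ^+ 2 * s ^+ 2 / 2 =
  - (m ^+ 2 * ((s ^+ 2 + 2) / (2 * (s ^+ 2 + 1) ^+ 2))) by field; rewrite gt_eqF.
rewrite oppr_ge0 pmulr_lle0; last first.
  by rewrite divr_gt0 ?mulr_gt0 ?exprn_gt0// ltr_wpDl ?sqr_ge0.
by move=> m2; apply/eqP; rewrite -sqrf_eq0 eq_le m2 sqr_ge0.
Qed.

End gaussian_moments.

(** * Mean value theorem and the sine near zero *)

Section mean_value.
Context (R : realType).

Lemma mean_value (f df : R -> R) (a b : R) : a <= b ->
  (forall x, a <= x <= b -> is_derive x 1 f (df x)) ->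
  exists2 c, a <= c <= b & f b - f a = df c * (b - a).
Proof.
move=> ab fdf.
have [||c] := @MVT_segment R f df a b ab.
- by move=> x; rewrite in_itv/= => /andP[ax xb]; apply: fdf; rewrite !ltW.
- apply: derivable_within_continuous => x; rewrite in_itv/= => axb.
  by have [] := fdf x axb.
by rewrite in_itv/=; exists c.
Qed.

Lemma normr_sub_sin (x : R) : `|x - sin x| <= x ^+ 2.
Proof.
wlog x0 : x / 0 <= x => [h|].
  have [/h//|x0] := leP 0 x.
  rewrite -sqrrN; apply: le_trans (h (- x) _); last by rewrite oppr_ge0 ltW.
  by rewrite sinN -opprD normrN.
have [c /andP[c0 cx]] := @mean_value sin cos 0 x x0 (fun y _ => is_derive_sin y).
rewrite sin0 !subr0 => ->.
have [c' /andP[c'0 c'c]] := @mean_value cos (fun y => - sin y) 0 c c0 (fun y _ => is_derive_cos y).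
rewrite cos0 subr0 => h.
have -> : cos c = 1 - sin c' * c by lra.
have -> : x - (1 - sin c' * c) * x = sin c' * c * x by ring.
rewrite !normrM (ger0_norm x0) (ger0_norm c0) expr2 ler_wpM2r//.
by rewrite -[leRHS]mul1r ler_pM// sin_max.
Qed.

End mean_value.

(** * Trigonometric functions and a Bernstein-type operator *)

Section trigonometric_functions.
Context (R : realType) (I : finType).
Implicit Types (f g : (I -> R) -> R) (x : I -> R).

(** Product-to-sum formulas and phase shifts make this an algebra containing the sines, while the
    integral of each member is fixed by the integrals of cosines of affine forms, the real form of
    the characteristic function. *)
Definition trigf f := exists s : seq (R * (I -> R) * R),
  forall x, f x = \sum_(c <- s) c.1.1 * cos (\sum_i c.1.2 i * x i + c.2).

Lemma trigf_ext f g : f =1 g -> trigf f -> trigf g.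
Proof. by move=> fg [s hs]; exists s => x; rewrite -fg hs. Qed.

Lemma trigf_cos (a : I -> R) b : trigf (fun x => cos (\sum_i a i * x i + b)).
Proof. by exists [:: (1, a, b)] => x; rewrite big_seq1 mul1r. Qed.

Lemma trigf_cst c : trigf (fun=> c).
Proof.
exists [:: (c, (fun=> 0), 0)] => x; rewrite big_seq1/= big1 ?addr0 ?cos0 ?mulr1//.
by move=> i _; rewrite mul0r.
Qed.

Lemma trigfD f g : trigf f -> trigf g -> trigf (fun x => f x + g x).
Proof. by move=> [s hs] [r hr]; exists (s ++ r) => x; rewrite big_cat/= hs hr. Qed.

Lemma trigf_sum (J : Type) (r : seq J) (f : J -> (I -> R) -> R) :
  (forall j, trigf (f j)) -> trigf (fun x => \sum_(j <- r) f j x).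
Proof.
move=> hf; elim: r => [|j r IH].
  by apply: trigf_ext (trigf_cst 0) => x; rewrite big_nil.
by apply: trigf_ext (trigfD (hf j) IH) => x; rewrite big_cons.
Qed.

Lemma trigfZ c f : trigf f -> trigf (fun x => c * f x).
Proof.
move=> [s hs]; exists [seq (c * d.1.1, d.1.2, d.2) | d <- s] => x.
by rewrite hs big_map mulr_sumr; apply: eq_bigr => d _ /=; rewrite mulrA.
Qed.

Lemma trigfM f g : trigf f -> trigf g -> trigf (fun x => f x * g x).
Proof.
move=> [s hs] [r hr].
apply: (@trigf_ext (fun x => \sum_(c <- s) \sum_(d <- r) (c.1.1 * d.1.1 / 2) *
   (cos (\sum_i (c.1.2 i + d.1.2 i) * x i + (c.2 + d.2)) +
    cos (\sum_i (c.1.2 i - d.1.2 i) * x i + (c.2 - d.2))))).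
  move=> x; rewrite hs hr mulr_suml; apply: eq_bigr => c _.
  rewrite mulr_sumr; apply: eq_bigr => d _.
  have -> : \sum_i (c.1.2 i + d.1.2 i) * x i + (c.2 + d.2) =
     (\sum_i c.1.2 i * x i + c.2) + (\sum_i d.1.2 i * x i + d.2).
    rewrite addrACA -big_split/=; congr (_ + _).
    by apply: eq_bigr => i _; rewrite mulrDl.
  have -> : \sum_i (c.1.2 i - d.1.2 i) * x i + (c.2 - d.2) =
     (\sum_i c.1.2 i * x i + c.2) - (\sum_i d.1.2 i * x i + d.2).
    rewrite opprD addrACA -sumrB; congr (_ + _).
    by apply: eq_bigr => i _; rewrite mulrBl.
  rewrite cosD cosB; move: (cos _) (cos _) (sin _) (sin _) => p q u v.
  by field.
apply: trigf_sum => c; apply: trigf_sum => d; apply: trigfZ.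
by apply: trigfD; exact: trigf_cos.
Qed.

Lemma trigf_sin (i : I) (L : R) : trigf (fun x => sin (x i / L)).
Proof.
apply: trigf_ext (trigf_cos (fun j => (i == j)%:R / L) (- (pi / 2))) => x.
rewrite cosBpihalf (bigD1 i)//= eqxx big1 ?addr0; first by rewrite mul1r mulrC.
by move=> j ij; rewrite eq_sym (negbTE ij) !mul0r.
Qed.

(* Value at [v] of the Bernstein-type operator moving coordinate [i] by
   [+-delta] with mean [delta * sin (x i / L)], once for each [i] in [r]. *)
Fixpoint bernstein (L delta : R) (F : (I -> R) -> R) (x : I -> R) (r : seq I) (v : I -> R) : R :=
  if r is i :: r' then
    (1 + sin (x i / L)) / 2 * bernstein L delta F x r' (fun j => v j + (i == j)%:R * delta) +
    (1 - sin (x i / L)) / 2 * bernstein L delta F x r' (fun j => v j - (i == j)%:R * delta)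
  else F v.

Lemma trigf_bernstein L delta F r v : trigf (fun x => bernstein L delta F x r v).
Proof.
elim: r v => [|i r IH] v; first exact: trigf_cst.
rewrite /=; apply: trigfD; apply: trigfM => //.
- apply: (@trigf_ext (fun x => 2^-1 * (1 + sin (x i / L)))); first by move=> x; rewrite mulrC.
  by apply: trigfZ; apply: trigfD; [exact: trigf_cst|exact: trigf_sin].
- apply: (@trigf_ext (fun x => 2^-1 * (1 + -1 * sin (x i / L)))).
    by move=> x; rewrite mulrC mulN1r.
  by apply: trigfZ; apply: trigfD; [exact: trigf_cst|apply: trigfZ; exact: trigf_sin].
Qed.

Lemma bernstein_le L delta F G x r v : (forall v, F v <= G v) ->
  bernstein L delta F x r v <= bernstein L delta G x r v.
Proof.
move=> FG; elim: r v => [|i r IH] v //=.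
by apply: lerD; apply: ler_wpM2l => //;
  rewrite divr_ge0// ?subr_ge0 ?sin_le1// -lerBlDl sub0r sin_geN1.
Qed.

Lemma bernstein_affine L delta F G x r v (a : R) :
  bernstein L delta (fun v => a * F v + G v) x r v =
  a * bernstein L delta F x r v + bernstein L delta G x r v.
Proof. by elim: r v => [|i r IH] v //=; rewrite !IH; ring. Qed.

Lemma bernstein_cst L delta x r v (c : R) : bernstein L delta (fun=> c) x r v = c.
Proof. by elim: r v => [|i r IH] v //=; rewrite !IH; field. Qed.

Lemma bernstein_sum (J : Type) (s : seq J) (F : J -> (I -> R) -> R) L delta x r v :
  bernstein L delta (fun v => \sum_(j <- s) F j v) x r v =
  \sum_(j <- s) bernstein L delta (F j) x r v.
Proof.
elim: s => [|j s IH].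
  by under [in LHS]eq_fun do rewrite big_nil; rewrite big_nil bernstein_cst.
rewrite big_cons -IH -[bernstein L delta (F j) x r v]mul1r -bernstein_affine.
by congr bernstein; apply/funext => w; rewrite big_cons mul1r.
Qed.

(** Bias and variance: each move of coordinate [i] has mean [delta * sin (x i / L)] and variance
    [delta ^+ 2 * (1 - sin (x i / L) ^+ 2)]. *)
Lemma bernstein_sqr L delta x r v (i : I) (w : R) :
  bernstein L delta (fun v => (v i - w) ^+ 2) x r v =
  (v i + (count_mem i r)%:R * delta * sin (x i / L) - w) ^+ 2 +
  (count_mem i r)%:R * delta ^+ 2 * (1 - sin (x i / L) ^+ 2).
Proof.
elim: r v => [|j r IH] v /=; first by rewrite !mul0r !addr0.
rewrite !IH natrD; have [->|ij] := eqVneq j i; last by rewrite !mul0r addr0 subr0 add0r; field.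
by rewrite mulr1n mul1r; move: (count_mem i r)%:R (sin _) => c u; field.
Qed.

End trigonometric_functions.

(** * Equality of integrals from equality on cosines *)

Section law_identification.
Context (R : realType) (I : finType).
Context d (T : measurableType d) (P : probability T R) (X : I -> T -> R).
Context d' (T' : measurableType d') (P' : probability T' R) (X' : I -> T' -> R).
Hypotheses (mX : forall i, measurable_fun setT (X i))
  (mX' : forall i, measurable_fun setT (X' i)).
Hypotheses (iX : forall i, rintegrable P (fun t => X i t ^+ 2))
  (iX' : forall i, rintegrable P' (fun t => X' i t ^+ 2)).
Hypothesis cosXX' : forall (a : I -> R) b,
  \int[P]_t cos (\sum_i a i * X i t + b) = \int[P']_t cos (\sum_i a i * X' i t + b).

Let trig_int d0 (T0 : measurableType d0) (P0 : probability T0 R) (X0 : I -> T0 -> R) f :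
  (forall i, measurable_fun setT (X0 i)) -> trigf f ->
  rintegrable P0 (fun t => f (X0 ^~ t)).
Proof.
move=> mX0 [s hs]; under eq_fun do rewrite hs.
apply: rintegrable_sum => c; apply: rintegrableZ.
apply: (@rintegrable_le _ _ _ _ _ (fun=> 1)); last 2 first.
- exact: rintegrable_cst.
- by move=> t; exact: cos_max.
apply: measurableT_comp; first exact: (continuous_measurable_fun (@continuous_cos R)).
apply: measurable_funD => //; apply: measurable_sum => i.
exact: measurable_funM.
Qed.

Let trig_eq f : trigf f -> \int[P]_t f (X ^~ t) = \int[P']_t f (X' ^~ t).
Proof.
move=> [s hs]; under eq_Rintegral do rewrite hs.
under [RHS]eq_Rintegral do rewrite hs.
have ic d0 (T0 : measurableType d0) (P0 : probability T0 R) (X0 : I -> T0 -> R) c :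
    (forall i, measurable_fun setT (X0 i)) ->
    rintegrable P0 (fun t => cos (\sum_i c.1.2 i * X0 i t + c.2)).
  by move=> mX0; exact: (trig_int P0 mX0 (trigf_cos c.1.2 c.2)).
rewrite !Rintegral_sum; last 2 first.
- by move=> c; apply: rintegrableZ; exact: ic.
- by move=> c; apply: rintegrableZ; exact: ic.
apply: eq_bigr => c _; rewrite !RintegralZl ?cosXX'//; exact: ic.
Qed.

Variable F : (I -> R) -> R.
Hypothesis lipF : forall v w, `|F v - F w| <= \sum_i `|v i - w i|.
Hypotheses (mFX : measurable_fun setT (fun t => F (X ^~ t)))
  (mFX' : measurable_fun setT (fun t => F (X' ^~ t))).

(** With [L = k.+1], each coordinate makes [L ^ 4] moves of size [L ^- 3] from zero: the mean
    [L * sin (x i / L)] is within [x i ^+ 2 / L] of [x i], and the variance is at most [L ^- 2]. *)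
Let approx (k : nat) (x : I -> R) : R :=
  bernstein k.+1%:R (k.+1%:R ^- 3) F x (flatten (nseq (k.+1 ^ 4) (enum I))) (fun=> 0).

Let approx_err k x :
  `|F x - approx k x| <= (\sum_i x i ^+ 2 + 2 * #|I|%:R) / k.+1%:R.
Proof.
set L : R := k.+1%:R; have L0 : 0 < L by rewrite ltr0n.
set w := fun i => L * sin (x i / L).
rewrite (_ : _ / L = \sum_i x i ^+ 2 / L + 2 * #|I|%:R / L); last first.
  by rewrite mulrDl mulr_suml.
rewrite -(subrKA (F w)); apply: (le_trans (ler_normD _ _)); apply: lerD.
  apply: le_trans (lipF _ _) _; apply: ler_sum => i _.
  have -> : x i - w i = L * (x i / L - sin (x i / L)) by rewrite /w; field; rewrite gt_eqF.
  rewrite normrM gtr0_norm//; apply: le_trans (ler_wpM2l (ltW L0) (normr_sub_sin _)) _.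
  by rewrite le_eqVlt; apply/orP; left; apply/eqP; field; rewrite gt_eqF.
pose r := flatten (nseq (k.+1 ^ 4) (enum I)).
have cnt i : (count_mem i r)%:R = L ^+ 4.
  rewrite /r count_flatten map_nseq sumn_nseq count_uniq_mem ?enum_uniq// mem_enum.
  by rewrite mul1n natrX.
(* From [y <= L * y ^+ 2 + 1 / L]: the Lipschitz bound is replaced by a quadratic one, on which the
   operator is computed exactly. *)
pose Q (v : I -> R) : R := L * (\sum_i (v i - w i) ^+ 2) + #|I|%:R / L.
have FQ v : `|F v - F w| <= Q v.
  apply: le_trans (lipF _ _) _; rewrite /Q mulr_sumr.
  have -> : #|I|%:R / L = \sum_(i : I) L^-1.
    by rewrite sumr_const mulr_natl.
  rewrite -big_split/=; apply: ler_sum => i _.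
  rewrite -(real_normK (num_real (v i - w i))); move: `|_| (normr_ge0 (v i - w i)) => y y0.
  have : 0 <= (L * y - 1) ^+ 2 / L + y by rewrite addr_ge0// divr_ge0 ?sqr_ge0// ltW.
  rewrite -subr_ge0; congr (0 <= _); field; by rewrite gt_eqF.
have EQ : bernstein L (L ^- 3) Q x r (fun=> 0) <= 2 * #|I|%:R / L.
  rewrite /Q bernstein_affine bernstein_cst bernstein_sum.
  rewrite (_ : 2 * _ / L = L * (\sum_(i : I) L^-2) + #|I|%:R / L); last first.
    by rewrite sumr_const -mulr_natl; field; rewrite gt_eqF.
  rewrite lerD2r ler_wpM2l ?(ltW L0)//; apply: ler_sum => i _.
  rewrite bernstein_sqr cnt /w add0r.
  have -> : L ^+ 4 / L ^+ 3 * sin (x i / L) - L * sin (x i / L) = 0.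
    by field; rewrite gt_eqF.
  rewrite expr0n add0r (_ : L ^+ 4 * _ = L ^- 2); last by field; rewrite gt_eqF.
  by rewrite ler_piMr ?invr_ge0 ?sqr_ge0// gerBl sqr_ge0.
apply: le_trans EQ.
have h1 : bernstein L (L ^- 3) F x r (fun=> 0) <= bernstein L (L ^- 3) Q x r (fun=> 0) + F w.
  rewrite -[X in X + _]mul1r -[X in _ + X](bernstein_cst L (L ^- 3) x r (fun=> 0))
    -bernstein_affine.
  apply: bernstein_le => v; rewrite mul1r -lerBlDr.
  exact: le_trans (ler_norm _) (FQ v).
have h2 : - bernstein L (L ^- 3) Q x r (fun=> 0) + F w <= bernstein L (L ^- 3) F x r (fun=> 0).
  rewrite -[X in X + _]mulN1r -[X in _ + X](bernstein_cst L (L ^- 3) x r (fun=> 0))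
    -bernstein_affine.
  apply: bernstein_le => v; rewrite mulN1r -lerBrDr -opprB lerN2.
  apply: le_trans (FQ v); rewrite distrC; exact: ler_norm.
rewrite ler_norml /approx -/L -/r; apply/andP; split; lra.
Qed.

Let lip_int d0 (T0 : measurableType d0) (P0 : probability T0 R) (X0 : I -> T0 -> R) :
  (forall i, measurable_fun setT (X0 i)) -> (forall i, rintegrable P0 (fun t => X0 i t ^+ 2)) ->
  measurable_fun setT (fun t => F (X0 ^~ t)) ->
  rintegrable P0 (fun t => F (X0 ^~ t)).
Proof.
move=> mX0 iX0 mF.
apply: (@rintegrable_le _ _ _ _ _ (fun t => `|F (fun=> 0)| + \sum_i (1 + X0 i t ^+ 2))) => //.
  apply: rintegrableD; first exact: rintegrable_cst.
  by apply: rintegrable_sum => i; apply: rintegrableD => //; exact: rintegrable_cst.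
move=> t; rewrite -lerBlDl; apply: le_trans (lerB_dist _ _) _.
apply: le_trans (lipF _ _) _; apply: ler_sum => i _; rewrite subr0.
rewrite -(real_normK (num_real (X0 i t))).
have := normr_ge0 (X0 i t); move: `|X0 i t| => y y0; nra.
Qed.

Let approx_int d0 (T0 : measurableType d0) (P0 : probability T0 R) (X0 : I -> T0 -> R) k :
  (forall i, measurable_fun setT (X0 i)) -> (forall i, rintegrable P0 (fun t => X0 i t ^+ 2)) ->
  measurable_fun setT (fun t => F (X0 ^~ t)) ->
  `|\int[P0]_t F (X0 ^~ t) - \int[P0]_t approx k (X0 ^~ t)| <=
   (\int[P0]_t (\sum_i X0 i t ^+ 2 + 2 * #|I|%:R)) / k.+1%:R.
Proof.
move=> mX0 iX0 mF.
have i1 := lip_int mX0 iX0 mF.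
have i2 : rintegrable P0 (fun t => approx k (X0 ^~ t)).
  exact: (trig_int P0 mX0 (@trigf_bernstein _ _ _ _ _ _ _)).
have i3 : rintegrable P0 (fun t => \sum_i X0 i t ^+ 2 + 2 * #|I|%:R).
  by apply: rintegrableD; [exact: rintegrable_sum|exact: rintegrable_cst].
have i4 : rintegrable P0 (fun t => F (X0 ^~ t) - approx k (X0 ^~ t)).
  under eq_fun do rewrite -mulN1r; apply: rintegrableD => //; exact: rintegrableZ.
rewrite -RintegralB//; apply: le_trans (le_normr_Rintegral _ _) _ => //.
rewrite mulrC -RintegralZl//; apply: le_Rintegral => //.
- exact: (rintegrable_norm i4).
- exact: rintegrableZ.
- by move=> t _; rewrite mulrC; exact: approx_err.
Qed.

(** A quantitative form of the Cramer-Wold principle: the approximation error is at most a constant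
    times one plus the squared norm, divided by [k], on the whole space. Second moments thus
    suffice, without truncation. *)
Lemma eq_Rintegral_cos : \int[P]_t F (X ^~ t) = \int[P']_t F (X' ^~ t).
Proof.
set a := LHS; set b := RHS.
pose c := \int[P]_t (\sum_i X i t ^+ 2 + 2 * #|I|%:R) +
          \int[P']_t (\sum_i X' i t ^+ 2 + 2 * #|I|%:R).
have h k : `|a - b| <= c / k.+1%:R.
  rewrite -(subrKA (\int[P]_t approx k (X ^~ t))); apply: le_trans (ler_normD _ _) _.
  rewrite mulrDl; apply: lerD; first exact: approx_int.
  have -> : \int[P]_t approx k (X ^~ t) = \int[P']_t approx k (X' ^~ t).
    exact: (trig_eq (@trigf_bernstein _ _ _ _ _ _ _)).
  by rewrite distrC; exact: approx_int.
apply/eqP; rewrite -subr_eq0 -normr_le0; apply/ler_addgt0Pr => e e0; rewrite add0r.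
apply: le_trans (h (Num.truncn (c / e))) _.
rewrite ler_pdivrMr ?ltr0n// mulrC -ler_pdivrMr//.
exact/ltW/truncnS_gt.
Qed.

End law_identification.

(** * Splitting a Gaussian field into two independent scaled copies *)

Section product_integrable.
Context d1 d2 (T1 : measurableType d1) (T2 : measurableType d2) (R : realType).
Context (P1 : probability T1 R) (P2 : probability T2 R).

Lemma rintegrable_fst f : rintegrable P1 f -> rintegrable (P1 \x P2)%E (fun z => f z.1).
Proof.
move=> hf; have mf := rintegrable_measurable hf.
apply/integrableP; split.
  by apply/measurable_EFinP; exact: measurableT_comp.
rewrite fubini_tonelli1//=; last first.
  by apply/measurable_EFinP; apply: measurableT_comp => //; exact: measurableT_comp.
case/integrableP: hf => _; congr (_ < _)%E; apply: eq_integral => t _.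
rewrite /fubini_F /= integral_cst// -[LHS]mule1; congr (_ * _)%E.
by rewrite -(probability_setT P2).
Qed.

Lemma rintegrable_snd f : rintegrable P2 f -> rintegrable (P1 \x P2)%E (fun z => f z.2).
Proof.
move=> hf; have mf := rintegrable_measurable hf.
apply/integrableP; split.
  by apply/measurable_EFinP; exact: measurableT_comp.
rewrite fubini_tonelli2//=; last first.
  by apply/measurable_EFinP; apply: measurableT_comp => //; exact: measurableT_comp.
case/integrableP: hf => _; congr (_ < _)%E; apply: eq_integral => t _.
rewrite /fubini_G /= integral_cst// -[LHS]mule1; congr (_ * _)%E.
by rewrite -(probability_setT P1).
Qed.

End product_integrable.

Section gaussian_semigroup.
Context d (T : measurableType d) (R : realType) (P : probability T R) (I : finType).
Variable X : I -> T -> R.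
Hypothesis mX : forall i, measurable_fun setT (X i).
Hypothesis gX : forall a : I -> R, exists m s : R, 0 <= s /\
  forall B : set R, measurable B ->
    P ((fun t => \sum_i a i * X i t) @^-1` B) = gaussian_law m s B.
Hypothesis EX : forall i, \int[P]_t X i t = 0.

Lemma gaussian_field_law1 i : exists m s : R,
  forall B, measurable B -> P (X i @^-1` B) = gaussian_law m s B.
Proof.
have [m [s [_ h]]] := gX (fun j => (i == j)%:R); exists m, s => B mB.
rewrite -h//; suff -> : X i = (fun t => \sum_j (i == j)%:R * X j t) by [].
apply/funext => t; rewrite (bigD1 i)//= eqxx mul1r big1 ?addr0// => j /negbTE ji.
by rewrite eq_sym ji mul0r.
Qed.

Lemma gaussian_field_integrable i : rintegrable P (X i).
Proof. by have [m [s h]] := gaussian_field_law1 i; exact: gaussian_integrable h. Qed.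

Lemma gaussian_field_sqr i : rintegrable P (fun t => X i t ^+ 2).
Proof. by have [m [s h]] := gaussian_field_law1 i; exact: gaussian_integrable_sqr h. Qed.

Lemma gaussian_field_norm3 i : rintegrable P (fun t => `|X i t| ^+ 3).
Proof. by have [m [s h]] := gaussian_field_law1 i; exact: gaussian_integrable_norm3 h. Qed.

Lemma gaussian_field_prod i j : rintegrable P (fun t => X i t * X j t).
Proof.
apply: (@rintegrable_le _ _ _ _ _ (fun t => X i t ^+ 2 + X j t ^+ 2)).
- exact: measurable_funM.
- by apply: rintegrableD; exact: gaussian_field_sqr.
- move=> t; rewrite normrM -[X in _ <= X + _](real_normK (num_real _)) -[X in _ <= _ +
  X](real_normK (num_real _)).
  have := normr_ge0 (X i t); have := normr_ge0 (X j t).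
  move: `|X i t| `|X j t| => x y; nra.
Qed.

Lemma gaussian_field_law (a : I -> R) : exists s : R, forall B, measurable B ->
  P ((fun t => \sum_i a i * X i t) @^-1` B) = gaussian_law 0 s B.
Proof.
have [m [s [_ h]]] := gX a; exists s.
have mU : measurable_fun setT (fun t => \sum_i a i * X i t).
  by apply: measurable_sum => i; exact: measurable_funM.
suff m0 : m = 0 by rewrite m0 in h.
apply: (gaussian_centered mU h).
rewrite Rintegral_sum; last by move=> i; apply: rintegrableZ; exact: gaussian_field_integrable.
rewrite big1// => i _; rewrite RintegralZl ?EX ?mulr0//.
exact: gaussian_field_integrable.
Qed.

Lemma gaussian_field_cos (a : I -> R) b (p q : R) : 0 < p -> 0 < q -> p + q = 1 ->
  \int[P]_t cos (\sum_i a i * X i t + b) =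
  \int[(P \x P)%E]_z cos (\sum_i a i * (Num.sqrt p * X i z.1 + Num.sqrt q * X i z.2) + b).
Proof.
move=> p0 q0 pq; have [s law] := gaussian_field_law a.
pose U t := \sum_i a i * X i t.
have mU : measurable_fun setT U.
  by apply: measurable_sum => i; exact: measurable_funM.
have -> : (fun z : T * T => cos (\sum_i a i * (Num.sqrt p * X i z.1 + Num.sqrt q * X i z.2) + b)) =
    (fun z => cos (Num.sqrt p * U z.1 + Num.sqrt q * U z.2 + b)).
  apply/funext => z; congr (cos (_ + _)); rewrite /U !mulr_sumr -big_split/=.
  by apply: eq_bigr => i _; ring.
(* The shift by one makes the integrand nonnegative, as Tonelli and [gaussian_convolution]
   require. *)
pose f (u : R) : R := 1 + cos (u + b).
have cf : continuous f.
  move=> u; apply: cvgD; first exact: cvg_cst.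
  apply: (@cvg_comp _ _ _ (fun u : R => u + b) cos); last exact: continuous_cos.
  by apply: cvgD; [exact: cvg_id|exact: cvg_cst].
have f0 u : 0 <= f u by rewrite /f -lerBlDl sub0r cos_geN1.
have := gaussian_convolution mU law p0 q0 pq cf f0.
have mc (c : R) : measurable_fun setT (fun u : R => cos (u + c)).
  apply: measurableT_comp; first exact: (continuous_measurable_fun (@continuous_cos R)).
  exact: measurable_funD.
have mV : measurable_fun setT (fun z : T * T => Num.sqrt p * U z.1 + Num.sqrt q * U z.2).
  by apply: measurable_funD; apply: measurable_funM => //; exact: measurableT_comp.
have cint d0 (T0 : measurableType d0) (P0 : probability T0 R) (V : T0 -> R) :
    measurable_fun setT V -> rintegrable P0 (fun t => cos (V t + b)).
  move=> mV0; apply: (@rintegrable_le _ _ _ _ _ (fun=> 1)); last 2 first.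
  - exact: rintegrable_cst.
  - by move=> t; exact: cos_max.
  exact: (measurableT_comp (mc b) mV0).
have fint d0 (T0 : measurableType d0) (P0 : probability T0 R) (V : T0 -> R) :
    measurable_fun setT V -> \int[P0]_t f (V t) = 1 + \int[P0]_t cos (V t + b).
  move=> mV0; rewrite /f RintegralD ?Rintegral_cst1//.
  - exact: rintegrable_cst.
  - exact: cint.
have := @fubini_tonelli1 _ _ _ _ _ P P
  (fun z => (f (Num.sqrt p * U z.1 + Num.sqrt q * U z.2))%:E).
rewrite /fubini_F /= => <-; last 2 first.
- apply/measurable_EFinP; apply: (@measurableT_comp _ _ _ _ _ _ f) => //.
  exact: continuous_measurable_fun.
- by move=> z; rewrite lee_fin.
move=> /(congr1 fine).
rewrite -[LHS]/(\int[(P \x P)%E]_z f (Num.sqrt p * U z.1 + Num.sqrt q * U z.2)).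
rewrite -[RHS]/(\int[P]_z f (U z)).
by rewrite !fint// => /addrI ->.
Qed.

Variable F : (I -> R) -> R.
Hypothesis lipF : forall v w, `|F v - F w| <= \sum_i `|v i - w i|.
Hypothesis mF : forall d (T : measurableType d) (Y : I -> T -> R),
  (forall i, measurable_fun setT (Y i)) -> measurable_fun setT (fun t => F (Y ^~ t)).

Lemma lip_integrable d0 (T0 : measurableType d0) (P0 : probability T0 R) (Y : I -> T0 -> R) :
  (forall i, rintegrable P0 (Y i)) -> rintegrable P0 (fun t => F (Y ^~ t)).
Proof.
move=> iY.
apply: (@rintegrable_le _ _ _ _ _ (fun t => `|F (fun=> 0)| + \sum_i `|Y i t|)).
- by apply: mF => i; exact: rintegrable_measurable (iY i).
- apply: rintegrableD; first exact: rintegrable_cst.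
  by apply: rintegrable_sum => i; exact: rintegrable_norm.
- move=> t; rewrite -lerBlDl; apply: le_trans (lerB_dist _ _) _.
  by apply: le_trans (lipF _ _) _; apply: ler_sum => i _; rewrite subr0.
Qed.

(** For cosines of linear forms this is the one-dimensional stability [gaussian_field_cos];
    [eq_Rintegral_cos] extends it to [F]. It is the device that cuts the field into [K] independent
    pieces of variance [1 / K]. *)
Lemma gaussian_semigroup (x : I -> R) (c p q : R) : 0 < p -> 0 < q -> p + q = 1 ->
  \int[P]_t F (fun i => x i + c * X i t) =
  \int[P]_t \int[P]_t' F (fun i => x i + c * (Num.sqrt p * X i t + Num.sqrt q * X i t')).
Proof.
move=> p0 q0 pq.
pose Y i t := x i + c * X i t.
pose Z i (z : T * T) := x i + c * (Num.sqrt p * X i z.1 + Num.sqrt q * X i z.2).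
have iY i : rintegrable P (Y i).
  apply: rintegrableD; first exact: rintegrable_cst.
  by apply: rintegrableZ; exact: gaussian_field_integrable.
have mY i : measurable_fun setT (Y i) by exact: rintegrable_measurable.
have i1 f := @rintegrable_fst _ _ _ _ R P P f.
have i2 f := @rintegrable_snd _ _ _ _ R P P f.
have iXX i : rintegrable (P \x P)%E (fun z => Num.sqrt p * X i z.1 + Num.sqrt q * X i z.2).
  by apply: rintegrableD; apply: rintegrableZ; [apply: i1|apply: i2];
    exact: gaussian_field_integrable.
have iZ i : rintegrable (P \x P)%E (Z i).
  by apply: rintegrableD; [exact: rintegrable_cst|exact: rintegrableZ].
have mZ i : measurable_fun setT (Z i) by exact: rintegrable_measurable.
have iFZ := lip_integrable iZ.
transitivity (\int[(P \x P)%E]_z F (Z ^~ z)); last first.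
  rewrite {1}/Rintegral -integral12_prod_meas1//; congr fine.
  apply: eq_integral => t _; rewrite /fubini_F EFin_Rintegral//.
  apply: (@lip_integrable _ _ P (fun i t' => Z i (t, t'))) => i.
  apply: rintegrableD; first exact: rintegrable_cst.
  apply: rintegrableZ; apply: rintegrableD => /=; first exact: rintegrable_cst.
  by apply: rintegrableZ; exact: gaussian_field_integrable.
apply: (@eq_Rintegral_cos R I _ T P Y _ _ (P \x P)%E Z) => //.
- move=> i.
  apply: (@rintegrable_le _ _ _ _ _ (fun t => 2 * x i ^+ 2 + 2 * c ^+ 2 * X i t ^+ 2)).
  + by apply: measurable_funX; exact: mY.
  + apply: rintegrableD; first exact: rintegrable_cst.
    by apply: rintegrableZ; exact: gaussian_field_sqr.
  + move=> t; rewrite ger0_norm ?sqr_ge0// /Y; move: (X i t) => y.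
    have := sqr_ge0 (x i - c * y); nra.
- move=> i.
  apply: (@rintegrable_le _ _ _ _ _ (fun z => 4 * x i ^+ 2 + 4 * c ^+ 2 * p * X i z.1 ^+ 2
     + 4 * c ^+ 2 * q * X i z.2 ^+ 2)).
  + by apply: measurable_funX; exact: mZ.
  + apply: rintegrableD; [apply: rintegrableD|].
    * exact: rintegrable_cst.
    * by apply: rintegrableZ; apply: (i1 (fun t => X i t ^+ 2)); exact: gaussian_field_sqr.
    * by apply: rintegrableZ; apply: (i2 (fun t => X i t ^+ 2)); exact: gaussian_field_sqr.
  + move=> z; rewrite ger0_norm ?sqr_ge0// /Z.
    have -> : 4 * c ^+ 2 * p * X i z.1 ^+ 2 = 4 * (c * (Num.sqrt p * X i z.1)) ^+ 2.
      by rewrite -[in LHS](sqr_sqrtr (ltW p0)); ring.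
    have -> : 4 * c ^+ 2 * q * X i z.2 ^+ 2 = 4 * (c * (Num.sqrt q * X i z.2)) ^+ 2.
      by rewrite -[in LHS](sqr_sqrtr (ltW q0)); ring.
    rewrite mulrDr; move: (x i) (c * _) (c * _) => u v w.
    have := sqr_ge0 (u - v); have := sqr_ge0 (v - w); have := sqr_ge0 (u - w); nra.
- move=> a b.
  have E (V : I -> R) : \sum_i a i * (x i + c * V i) + b =
      \sum_i (a i * c) * V i + (b + \sum_i a i * x i).
    rewrite [RHS]addrCA [RHS]addrC; congr (_ + _); rewrite addrC -big_split/=.
    by apply: eq_bigr => i _; ring.
  transitivity (\int[P]_t cos (\sum_i (a i * c) * X i t + (b + \sum_i a i * x i))).
    by apply: eq_Rintegral => t _; rewrite -E.
  rewrite (@gaussian_field_cos _ _ p q)//.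
  by apply: eq_Rintegral => z _; rewrite -E.
- exact: mF.
- exact: mF.
Qed.

End gaussian_semigroup.

(** * Second-order expansion of the logarithm of an exponential mean *)

Section log_sum_exp.
Context (R : realType).

Lemma expR_le4 (x : R) : x <= 1 -> expR x <= 4.
Proof.
move=> x1; have h : expR (1 / 2) <= 2 :> R.
  have := @expRxMexpNx_1 R (1 / 2); have := @expR_ge1Dx R (- (1 / 2)).
  have := expR_ge0 (1 / 2 : R); nra.
apply: (@le_trans _ _ (expR (1 / 2) ^+ 2)).
  by rewrite -expRM_natl ler_expR; lra.
have := expR_ge0 (1 / 2 : R); nra.
Qed.

Lemma expR_taylor2 (y : R) : `|y| <= 1 ->
  `|expR y - 1 - y - y ^+ 2 / 2| <= 4 * `|y| ^+ 3.
Proof.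
wlog: y / True => [h|_]; first exact: h.
have mv (f df : R -> R) (z : R) : f 0 = 0 -> (forall x : R^o, is_derive x 1 f (df x)) ->
    exists2 c, `|c| <= `|z| & f z = df c * z.
  move=> f0 dff; have [z0|z0] := leP 0 z.
    have [c /andP[c0 cz]] := mean_value z0 (fun x _ => dff x).
    by rewrite f0 !subr0 => ->; exists c => //; rewrite !ger0_norm.
  have [c /andP[zc c0]] := mean_value (ltW z0) (fun x _ => dff x).
  rewrite f0 !sub0r mulrN => /oppr_inj ->; exists c => //.
  by rewrite (ltr0_norm z0) ler0_norm// lerN2.
move=> y1.
have [|x|c cy ->] := mv (fun x => expR x - 1 - x - x ^+ 2 / 2) (fun x => expR x - 1 - x) y.
- by rewrite expR0 expr0n/=; lra.
- by apply: is_derive_eq; rewrite /GRing.scale/=; field.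
have [|x|c' cy' ->] := mv (fun x => expR x - 1 - x) (fun x => expR x - 1) c.
- by rewrite expR0; lra.
- by apply: is_derive_eq; rewrite /GRing.scale/=; ring.
have [|x|c'' cy'' ->] := mv (fun x => expR x - 1) expR c'.
- by rewrite expR0 subrr.
- by apply: is_derive_eq; rewrite /GRing.scale/=; ring.
rewrite !normrM !exprS expr0 mulr1 -!mulrA; apply: ler_pM => //.
- by rewrite ger0_norm ?expR_ge0// expR_le4// (le_trans (ler_norm _))// (le_trans cy'')//
  (le_trans cy')// (le_trans cy).
- by apply: ler_pM => //; [exact: le_trans cy|apply: ler_pM].
Qed.

Variable I : finType.

(** The cumulant expansion to second order. Centring [w] at its mean removes the linear term, so
    that the mean of the exponential is [1 + nu / 2] up to a cubic error. *)
Lemma log_mean_expR_taylor (p w : I -> R) (m : R) :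
  (forall i, 0 <= p i) -> \sum_i p i = 1 -> (forall i, `|w i| <= m) ->
  `|ln (\sum_i p i * expR (w i)) -
    (\sum_i p i * w i + (\sum_i p i * w i ^+ 2 - (\sum_i p i * w i) ^+ 2) / 2)|
  <= 200 * m ^+ 3.
Proof.
move=> p0 p1 wm.
set W := \sum_i p i * expR (w i); set mu := \sum_i p i * w i.
set nu := \sum_i p i * w i ^+ 2 - mu ^+ 2.
have [i0 _|I0] := pickP (fun _ : I => true); last first.
  by move: p1; rewrite big_pred0// => /eqP; rewrite eq_sym oner_eq0.
have m0 : 0 <= m := le_trans (normr_ge0 _) (wm i0).
have avg_le (f : I -> R) (c : R) : (forall i, f i <= c) -> \sum_i p i * f i <= c.
  move=> fc; rewrite -[leRHS]mul1r -p1 mulr_suml; apply: ler_sum => i _.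
  exact: ler_wpM2l.
have avg_ge (f : I -> R) (c : R) : (forall i, c <= f i) -> c <= \sum_i p i * f i.
  move=> fc; rewrite -[leLHS]mul1r -p1 mulr_suml; apply: ler_sum => i _.
  exact: ler_wpM2l.
have wm1 i : - m <= w i <= m by rewrite -ler_norml.
have mum : - m <= mu <= m.
  by apply/andP; split; [apply: avg_ge|apply: avg_le] => i; case/andP: (wm1 i).
have nuE : \sum_i p i * (w i - mu) ^+ 2 = nu.
  transitivity (\sum_i (p i * w i ^+ 2 - 2 * mu * (p i * w i) + mu ^+ 2 * p i)).
    by apply: eq_bigr => i _; ring.
  by rewrite big_split sumrB -!mulr_sumr -/mu p1 /nu /=; ring.
have nu0 : 0 <= nu by rewrite -nuE; apply: avg_ge => i; exact: sqr_ge0.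
have nu1 : nu <= m ^+ 2.
  apply: (@le_trans _ _ (\sum_i p i * w i ^+ 2)); first by rewrite gerBl sqr_ge0.
  by apply: avg_le => i; rewrite -(real_normK (num_real (w i))) lerXn2r ?nnegrE.
have W1 : expR (- m) <= W by apply: avg_ge => i; rewrite ler_expR; case/andP: (wm1 i).
have W2 : W <= expR m by apply: avg_le => i; rewrite ler_expR; case/andP: (wm1 i).
have W0 : 0 < W := lt_le_trans (expR_gt0 _) W1.
(* For [m] above [1 / 8] the bound is crude: all terms are at most a multiple of [m] or [m ^+ 2],
   and [m <= 64 * m ^+ 3]. *)
have [m8|m8] := leP m (1 / 8); last first.
  have l1 : - m <= ln W by rewrite -ler_expR lnK.
  have l2 : ln W <= m by rewrite -ler_expR lnK.
  have m2 : m <= 8 * m ^+ 2 by nra.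
  have m3 : m ^+ 2 <= 8 * m ^+ 3 by nra.
  case/andP: mum => mu1 mu2.
  rewrite ler_norml; apply/andP; split; lra.
pose S := \sum_i p i * expR (w i - mu).
have WS : ln W = mu + ln S.
  have S0 : 0 < S.
    apply: (@lt_le_trans _ _ (expR (- m - m))); first exact: expR_gt0.
    apply: avg_ge => i; rewrite ler_expR; apply: lerB; first by case/andP: (wm1 i).
    by case/andP: mum.
  rewrite -[mu]expRK -lnM ?posrE ?expR_gt0// mulr_sumr; congr ln.
  by apply: eq_bigr => i _; rewrite mulrCA -expRD addrC subrK.
have y2m i : `|w i - mu| <= 2 * m.
  case/andP: (wm1 i) => ? ?; case/andP: mum => ? ?.
  by rewrite ler_norml; apply/andP; split; lra.
have ST : `|S - (1 + nu / 2)| <= 32 * m ^+ 3.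
  have -> : S - (1 + nu / 2) = \sum_i p i *
      (expR (w i - mu) - 1 - (w i - mu) - (w i - mu) ^+ 2 / 2).
    transitivity (\sum_i (p i * expR (w i - mu) - p i - (p i * w i - mu * p i) -
        2^-1 * (p i * (w i - mu) ^+ 2))).
      by rewrite !sumrB -!mulr_sumr nuE p1 -/mu -/S; field.
    by apply: eq_bigr => i _; field.
  apply: le_trans (ler_norm_sum _ _ _) _.
  under eq_bigr do rewrite normrM ger0_norm//.
  apply: avg_le => i; apply: le_trans (expR_taylor2 _) _.
    by apply: le_trans (y2m i) _; lra.
  have -> : 32 * m ^+ 3 = 4 * (2 * m) ^+ 3 by ring.
  by rewrite ler_pM2l// lerXn2r ?nnegrE ?mulr_ge0.
move: ST; rewrite ler_norml => /andP[ST1 ST2].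
have m3 : 0 <= m ^+ 3 by rewrite exprn_ge0.
have m31 : m ^+ 3 <= 1 / 512 by nra.
have a2 : (nu / 2) ^+ 2 <= m ^+ 3 / 8 by nra.
have S0 : 0 < S by nra.
have u : ln S <= nu / 2 + 32 * m ^+ 3.
  rewrite -ler_expR lnK ?posrE//; apply: le_trans (expR_ge1Dx _); lra.
(* From [1 + y <= expR y] at [y = 65 * m ^+ 3 - nu / 2]; the excess of 65 over 32 pays for
   [(nu / 2) ^+ 2 <= m ^+ 3 / 8] and the other products. *)
have l : nu / 2 - 65 * m ^+ 3 <= ln S.
  rewrite -ler_expR lnK ?posrE//.
  have h1 := expR_ge1Dx (65 * m ^+ 3 - nu / 2).
  have h2 := expRxMexpNx_1 (65 * m ^+ 3 - nu / 2).
  rewrite opprB in h2.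
  have h3 := expR_ge0 (nu / 2 - 65 * m ^+ 3).
  have nu64 : nu <= 1 / 64 by nra.
  have MM : m ^+ 3 * m ^+ 3 <= m ^+ 3 / 512 by nra.
  have Ma : 0 <= m ^+ 3 * nu by rewrite mulr_ge0.
  move: ST1 h1 h2 h3 a2 m3 m31 nu0 nu64 MM Ma.
  set M := m ^+ 3; set e1 := expR (65 * M - _); set e2 := expR (_ - 65 * M) =>
    ST1 h1 h2 h3 a2 M0 M1 n0 n1 MM Ma.
  have k : 1 <= (1 + nu / 2 - 32 * M) * (1 + 65 * M - nu / 2) by nra.
  have pos : 0 < 1 + 65 * M - nu / 2 by lra.
  have : e2 * (1 + 65 * M - nu / 2) <= (1 + nu / 2 - 32 * M) * (1 + 65 * M - nu / 2).
    apply: le_trans k; have : 0 <= e2 * (e1 - (1 + (65 * M - nu / 2))) by rewrite mulr_ge0//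
      subr_ge0.
    nra.
  rewrite ler_pM2r//; lra.
rewrite WS ler_norml; apply/andP; split; lra.
Qed.

End log_sum_exp.

(** * The smoothed maximum *)

Section smooth_max.
Context (R : realType) (I : finType).
Implicit Types (x v : I -> R) (F : (I -> R) -> R).

Definition lse (b : R) x : R := ln (\sum_i expR (b * x i)) / b.

Hypothesis I0 : (0 < #|I|)%N.

Lemma sum_expR_gt0 (x : I -> R) : 0 < \sum_i expR (x i).
Proof.
have /card_gt0P[i0 _] := I0.
rewrite (bigD1 i0)//= ltr_pwDl ?expR_gt0// sumr_ge0// => i _; exact: expR_ge0.
Qed.

Lemma lse_ge (b : R) x i : 0 < b -> x i <= lse b x.
Proof.
move=> b0; rewrite ler_pdivlMr// -ler_expR lnK ?posrE ?sum_expR_gt0//.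
rewrite (bigD1 i)//= mulrC lerDl sumr_ge0// => j _; exact: expR_ge0.
Qed.

Lemma lse_le (b : R) x (M : R) : 0 < b -> (forall i, x i <= M) -> lse b x <= M + ln #|I|%:R / b.
Proof.
move=> b0 xM; rewrite ler_pdivrMr// mulrDl divfK ?gt_eqF//.
rewrite -ler_expR lnK ?posrE ?sum_expR_gt0// expRD lnK ?posrE ?ltr0n//.
rewrite mulrC mulr_natl -sumr_const; apply: ler_sum => i _.
by rewrite ler_expR mulrC ler_wpM2r// ltW.
Qed.

Lemma lse_lip (b : R) x v : 0 < b -> `|lse b x - lse b v| <= \sum_i `|x i - v i|.
Proof.
move=> b0.
have h (y z : I -> R) : lse b y <= lse b z + \sum_i `|y i - z i|.
  rewrite ler_pdivrMr// mulrDl divfK ?gt_eqF//.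
  rewrite -ler_expR expRD !lnK ?posrE ?sum_expR_gt0// mulr_suml.
  apply: ler_sum => i _; rewrite -expRD ler_expR [X in _ + X]mulrC -mulrDr.
  apply: ler_wpM2l; first exact: ltW.
  rewrite -lerBlDl (le_trans (ler_norm _))// (bigD1 i)//= lerDl.
  by rewrite sumr_ge0.
rewrite ler_norml lerBlDl h andbT lerNl opprB lerBlDl (le_trans (h v x))// lerD2l.
by apply: ler_sum => i _; rewrite distrC.
Qed.

Lemma measurable_lse (b : R) d (T : measurableType d) (Y : I -> T -> R) :
  (forall i, measurable_fun setT (Y i)) -> measurable_fun setT (fun t => lse b (Y ^~ t)).
Proof.
move=> mY; apply: measurable_funM => //.
apply: (@measurableT_comp _ _ _ _ _ _ (@ln R)) => //.
apply: measurable_sum => i; apply: measurableT_comp => //.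
exact: measurable_funM.
Qed.

(** The gradient of [lse b] at [x]. *)
Definition gibbs (b : R) x i : R := expR (b * x i) / \sum_j expR (b * x j).

Lemma gibbs_ge0 b x i : 0 <= gibbs b x i.
Proof. by rewrite divr_ge0 ?expR_ge0// ltW// sum_expR_gt0. Qed.

Lemma gibbs_sum b x : \sum_i gibbs b x i = 1.
Proof. by rewrite -mulr_suml divff// gt_eqF// sum_expR_gt0. Qed.

(** First and second Taylor terms of [lse b] at [x]: the Hessian is [b] times the covariance form of
    the Gibbs weights. *)
Definition lse2 (b : R) x v : R :=
  \sum_i gibbs b x i * v i +
  b / 2 * (\sum_i gibbs b x i * v i ^+ 2 - (\sum_i gibbs b x i * v i) ^+ 2).

(** The increment of [lse b] is [1 / b] times the logarithm of the Gibbs mean of [expR (b * v i)],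
    so the cumulant expansion applies, with [m] equal to [b] times the largest absolute value among
    the [v i]. *)
Lemma lse_taylor (b : R) x v : 0 < b ->
  `|lse b (fun i => x i + v i) - (lse b x + lse2 b x v)| <= 200 * b ^+ 2 * \sum_i `|v i| ^+ 3.
Proof.
move=> b0; have /card_gt0P[i0 _] := I0.
pose j := [arg max_(i > i0) `|v i|]%O.
have vj i : `|v i| <= `|v j|.
  by rewrite /j; case: arg_maxP => // k _; apply.
have bvj i : `|b * v i| <= b * `|v j| by rewrite normrM gtr0_norm// ler_pM2l.
have := @log_mean_expR_taylor R I (gibbs b x) (fun i => b * v i) (b * `|v j|)
  (gibbs_ge0 b x) (gibbs_sum b x) bvj.
have -> : \sum_i gibbs b x i * expR (b * v i) =
   (\sum_i expR (b * (x i + v i))) / (\sum_i expR (b * x i)).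
  rewrite mulr_suml; apply: eq_bigr => i _.
  by rewrite /gibbs mulrDr expRD mulrAC.
rewrite ln_div ?posrE ?sum_expR_gt0//.
set A := ln _; set B := ln _; set Q := _ + _ / 2.
have QE : Q = b * lse2 b x v.
  rewrite /Q /lse2; under eq_bigr do rewrite mulrCA.
  under [X in (X - _) / 2]eq_bigr do rewrite exprMn mulrCA.
  by rewrite -!mulr_sumr; field.
move=> h.
have -> : lse b (fun i => x i + v i) - (lse b x + lse2 b x v) = (A - B - Q) / b.
  by rewrite /lse -/A -/B QE; field; rewrite gt_eqF.
rewrite normrM normfV (gtr0_norm b0) ler_pdivrMr//; apply: le_trans h _.
have -> : 200 * b ^+ 2 * (\sum_i `|v i| ^+ 3) * b = 200 * b ^+ 3 * (\sum_i `|v i| ^+ 3) by ring.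
rewrite exprMn mulrA ler_pM2l ?mulr_gt0 ?exprn_gt0//.
by rewrite (bigD1 j)//= lerDl sumr_ge0// => i _; rewrite exprn_ge0.
Qed.

End smooth_max.

(** * Averages over independent signs *)

Section rademacher_average.
Context (R : realType) (I : finType).
Implicit Types (x v : I -> R) (F G : (I -> R) -> R) (vs : seq (I -> R)).

(** The expectation of [F] at [x] plus the sum of the vectors of [vs], each with an independent fair
    sign. *)
Fixpoint ravg vs F x : R :=
  if vs is v :: vs' then
    (ravg vs' F (fun i => x i + v i) + ravg vs' F (fun i => x i - v i)) / 2
  else F x.

Lemma ravg_affine vs F G (a : R) x :
  ravg vs (fun y => a * F y + G y) x = a * ravg vs F x + ravg vs G x.
Proof. by elim: vs x => //= v vs IH x; rewrite !IH; field. Qed.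

Lemma ravg_cst vs (c : R) x : ravg vs (fun=> c) x = c.
Proof. by elim: vs x => //= v vs IH x; rewrite !IH; field. Qed.

Lemma ravgD vs F G x : ravg vs (fun y => F y + G y) x = ravg vs F x + ravg vs G x.
Proof.
rewrite -[ravg vs F x]mul1r -ravg_affine; congr ravg.
by apply/funext => y; rewrite mul1r.
Qed.

Lemma ravgZ vs F (a : R) x : ravg vs (fun y => a * F y) x = a * ravg vs F x.
Proof.
rewrite -[RHS]addr0 -[X in _ = _ + X](ravg_cst vs 0 x) -ravg_affine; congr ravg.
by apply/funext => y; rewrite addr0.
Qed.

Lemma ravg_sum (J : Type) (r : seq J) (F : J -> (I -> R) -> R) vs x :
  ravg vs (fun y => \sum_(j <- r) F j y) x = \sum_(j <- r) ravg vs (F j) x.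
Proof.
elim: r => [|j r IH].
  by under [in LHS]eq_fun do rewrite big_nil; rewrite big_nil ravg_cst.
rewrite big_cons -IH -[ravg vs (F j) x]mul1r -ravg_affine.
by congr ravg; apply/funext => w; rewrite big_cons mul1r.
Qed.

(** Only points reachable by signed sums are seen; there the Taylor remainder is bounded uniformly
    and a finite layer-cake sum is enough. *)
Lemma ravg_le_reach vs F G x :
  (forall y, (forall i, `|y i - x i| <= \sum_(v <- vs) `|v i|) -> F y <= G y) ->
  ravg vs F x <= ravg vs G x.
Proof.
elim: vs x => [|v vs IH] x FG /=.
  by apply: FG => i; rewrite big_nil subrr normr0.
rewrite ler_pM2r ?invr_gt0//; apply: lerD; apply: IH => y hy; apply: FG => i.
  have -> : y i - x i = v i + (y i - (x i + v i)) by ring.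
  by rewrite big_cons (le_trans (ler_normD _ _))// lerD2l.
have -> : y i - x i = - v i + (y i - (x i - v i)) by ring.
by rewrite big_cons (le_trans (ler_normD _ _))// normrN lerD2l.
Qed.

Lemma ravg_le vs F G x : (forall y, F y <= G y) -> ravg vs F x <= ravg vs G x.
Proof. by move=> FG; apply: ravg_le_reach => y _. Qed.

Lemma ravg_ge0 vs F x : (forall y, 0 <= F y) -> 0 <= ravg vs F x.
Proof. by move=> F0; rewrite -(ravg_cst vs 0 x); exact: ravg_le. Qed.

Lemma ravg_linear vs x z i : ravg vs (fun y => y i - x i) z = z i - x i.
Proof. by elim: vs z => //= v vs IH z; rewrite !IH; field. Qed.

Lemma ravg_quadratic vs x z i j : ravg vs (fun y => (y i - x i) * (y j - x j)) z =
  (z i - x i) * (z j - x j) + \sum_(v <- vs) v i * v j.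
Proof.
elim: vs z => [|v vs IH] z /=; first by rewrite big_nil addr0.
by rewrite !IH big_cons; field.
Qed.

End rademacher_average.

(** * Sudakov-Fernique comparison by Lindeberg replacement *)

Section sudakov_fernique.
Context d (T : measurableType d) (R : realType) (P : probability T R) (I : finType).
Variable X : I -> T -> R.
Hypothesis mX : forall i, measurable_fun setT (X i).
Hypothesis gX : forall a : I -> R, exists m s : R, 0 <= s /\
  forall B : set R, measurable B ->
    P ((fun t => \sum_i a i * X i t) @^-1` B) = gaussian_law m s B.
Hypothesis EX : forall i, \int[P]_t X i t = 0.
Hypothesis I0 : (0 < #|I|)%N.
Variable b : R.
Hypothesis b0 : 0 < b.

Definition increment_var (c : I -> I -> R) i j : R := c i i + c j j - 2 * c i j.

Definition list_cov (vs : seq (I -> R)) i j : R := \sum_(v <- vs) v i * v j.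

Let cX i j := \int[P]_t (X i t * X j t).

(** Since the weights sum to one, the Hessian of [lse] contracted with a covariance sees only its
    increment variances. This is why comparing increments, and not variances, suffices. *)
Lemma gibbs_var (p : I -> R) (c : I -> I -> R) : \sum_i p i = 1 ->
  (forall i j, c i j = c j i) ->
  \sum_i p i * c i i - \sum_i \sum_j p i * p j * c i j =
  (\sum_i \sum_j p i * p j * increment_var c i j) / 2.
Proof.
move=> p1 cC.
have E1 : \sum_i p i * c i i = \sum_i \sum_j p i * p j * c i i.
  apply: eq_bigr => i _; rewrite -[LHS]mulr1 -{1}p1 mulr_sumr.
  by apply: eq_bigr => j _; ring.
have E2 : \sum_i p i * c i i = \sum_i \sum_j p i * p j * c j j.
  rewrite exchange_big/= E1; apply: eq_bigr => i _; apply: eq_bigr => j _; ring.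
have -> : \sum_i \sum_j p i * p j * increment_var c i j =
   \sum_i \sum_j p i * p j * c i i + \sum_i \sum_j p i * p j * c j j -
   2 * \sum_i \sum_j p i * p j * c i j.
  rewrite -big_split mulr_sumr -sumrB/=; apply: eq_bigr => i _.
  rewrite -big_split mulr_sumr -sumrB/=; apply: eq_bigr => j _.
  by rewrite /increment_var; ring.
by rewrite -E1 -E2; field.
Qed.

(** The cubic Taylor remainders of one Gaussian step and one round of signs. With [p = 1 / K] and
    vectors of size [K ^ (-1/2)] it is of order [K ^ (-3/2)], so [K] rounds still cost little. *)
Definition lindeberg_error (p : R) (vs : seq (I -> R)) : R := 200 * b ^+ 2 *
  (Num.sqrt p ^+ 3 * \sum_i \int[P]_t (`|X i t| ^+ 3) +
   \sum_(i : I) (\sum_(v <- vs) `|v i|) ^+ 3).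

Lemma lse_integrable d0 (T0 : measurableType d0) (P0 : probability T0 R) (Y : I -> T0 -> R) :
  (forall i, rintegrable P0 (Y i)) -> rintegrable P0 (fun t => lse b (Y ^~ t)).
Proof.
apply: lip_integrable; first by move=> v w; exact: lse_lip.
by move=> d' T' Z; exact: measurable_lse.
Qed.

(* One Lindeberg step: to second order both sides only see [b / 4] times the
   increment variances averaged against the Gibbs weights. *)
Lemma gaussian_le_ravg (p : R) vs x : 0 <= p ->
  (forall i j, p * increment_var cX i j <= increment_var (list_cov vs) i j) ->
  \int[P]_t lse b (fun i => x i + Num.sqrt p * X i t) <= ravg vs (lse b) x + lindeberg_error p vs.
Proof.
move=> p0 hvar.
set g := gibbs b x; have g0 := gibbs_ge0 I0 b x; have g1 := gibbs_sum I0 b x.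
pose V (c : I -> I -> R) := \sum_i \sum_j g i * g j * increment_var c i j.
have sq2 v : lse2 b x v = \sum_i g i * v i +
    b / 2 * (\sum_i g i * (v i * v i) - \sum_i \sum_j g i * g j * (v i * v j)).
  rewrite /lse2; congr (_ + _ * (_ - _)); rewrite expr2 mulr_suml; apply: eq_bigr => i _.
  by rewrite mulr_sumr; apply: eq_bigr => j _; rewrite -/g; ring.
have lower : lse b x + b / 4 * V (list_cov vs) -
    200 * b ^+ 2 * (\sum_(i : I) (\sum_(v <- vs) `|v i|) ^+ 3) <= ravg vs (lse b) x.
  set e := 200 * _ * _.
  (* The second-order Taylor polynomial lowered by [e], which bounds the remainder at every
     reachable point. The signs have mean zero and covariance [list_cov vs], so its average is
     explicit. *)
  pose G y := lse b x - e + (\sum_i g i * (y i - x i) + b / 2 *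
    (\sum_i g i * ((y i - x i) * (y i - x i)) -
     \sum_i \sum_j g i * g j * ((y i - x i) * (y j - x j)))).
  apply: (@le_trans _ _ (ravg vs G x)); last first.
    apply: ravg_le_reach => y hy; rewrite /G -sq2.
    have := lse_taylor I0 x (fun i => y i - x i) b0.
    under eq_fun do rewrite addrC subrK.
    rewrite ler_norml => /andP[h _].
    have : 200 * b ^+ 2 * (\sum_i `|y i - x i| ^+ 3) <= e.
      rewrite ler_pM2l ?mulr_gt0 ?exprn_gt0//; apply: ler_sum => i _.
      by rewrite lerXn2r ?nnegrE// (le_trans (normr_ge0 _) (hy i)).
    by move: h; rewrite /lse2 -/g; lra.
  rewrite le_eqVlt; apply/orP; left; apply/eqP.
  have -> : G = fun y => lse b x - e + (\sum_i g i * (y i - x i) + b / 2 *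
    (\sum_i g i * ((y i - x i) * (y i - x i)) +
     -1 * \sum_i \sum_j g i * g j * ((y i - x i) * (y j - x j)))).
    by apply/funext => y; rewrite mulN1r.
  rewrite ravgD ravg_cst ravgD ravgZ ravgD ravgZ !ravg_sum.
  under [X in _ + (X + _)]eq_bigr do rewrite ravgZ ravg_linear subrr mulr0.
  under [X in _ + (_ + _ * (X + _))]eq_bigr do rewrite ravgZ ravg_quadratic subrr mul0r add0r.
  under [X in _ + (_ + _ * (_ + _ * X))]eq_bigr => i _.
    rewrite ravg_sum; under eq_bigr do rewrite ravgZ ravg_quadratic subrr mul0r add0r.
    over.
  rewrite big1// add0r mulN1r.
  rewrite (@gibbs_var g (list_cov vs))//; last first.
    by move=> i j; apply: eq_bigr => v _; rewrite mulrC.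
  by rewrite -/(V _); field.
have i1 i := gaussian_field_integrable mX gX i.
have i2 i j := gaussian_field_prod mX gX i j.
have i3 i := gaussian_field_norm3 mX gX i.
have upper : \int[P]_t lse b (fun i => x i + Num.sqrt p * X i t) <=
    lse b x + b / 4 * (p * V cX) + 200 * b ^+ 2 * (Num.sqrt p ^+ 3 * \sum_i \int[P]_t (`|X i t|
      ^+ 3)).
  pose H1 t := \sum_i (g i * Num.sqrt p) * X i t.
  pose H2 t := \sum_i g i * (X i t * X i t).
  pose H3 t := \sum_i \sum_j (g i * g j) * (X i t * X j t).
  pose H4 t := \sum_i `|X i t| ^+ 3.
  have j1 : rintegrable P H1 by apply: rintegrable_sum => i; exact: rintegrableZ.
  have j2 : rintegrable P H2 by apply: rintegrable_sum => i; exact: rintegrableZ.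
  have j3 : rintegrable P H3.
    by apply: rintegrable_sum => i; apply: rintegrable_sum => j; exact: rintegrableZ.
  have j4 : rintegrable P H4 by apply: rintegrable_sum => i.
  have j23 : rintegrable P (fun t => b / 2 * p * (H2 t + -1 * H3 t)).
    by apply: rintegrableZ; apply: rintegrableD => //; exact: rintegrableZ.
  have j5 : rintegrable P (fun t => (200 * b ^+ 2 * Num.sqrt p ^+ 3) * H4 t) by exact: rintegrableZ.
  have j6 : rintegrable P (fun t => H1 t + b / 2 * p * (H2 t + -1 * H3 t)) by exact: rintegrableD.
  have j7 : rintegrable P (fun t => lse b x + (H1 t + b / 2 * p * (H2 t + -1 * H3 t))).
    by apply: rintegrableD => //; exact: rintegrable_cst.
  apply: (@le_trans _ _ (\int[P]_t (lse b x + (H1 t + b / 2 * p * (H2 t + -1 * H3 t)) +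
     (200 * b ^+ 2 * Num.sqrt p ^+ 3) * H4 t))).
    apply: le_Rintegral => //.
    - apply: (@lse_integrable _ _ P (fun i t => x i + Num.sqrt p * X i t)) => i.
      by apply: rintegrableD; [exact: rintegrable_cst|exact: rintegrableZ].
    - exact: rintegrableD.
    move=> t _; have := lse_taylor I0 x (fun i => Num.sqrt p * X i t) b0.
    rewrite sq2 ler_norml => /andP[_ h].
    have -> : H1 t = \sum_i g i * (Num.sqrt p * X i t).
      by apply: eq_bigr => i _; rewrite mulrA.
    have e2 : \sum_i g i * (Num.sqrt p * X i t * (Num.sqrt p * X i t)) = p * H2 t.
      rewrite mulr_sumr; apply: eq_bigr => i _.
      by rewrite -[in RHS](sqr_sqrtr p0); ring.
    have e3 : \sum_i \sum_j g i * g j * (Num.sqrt p * X i t * (Num.sqrt p * X j t)) = p * H3 t.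
      rewrite mulr_sumr; apply: eq_bigr => i _.
      rewrite mulr_sumr; apply: eq_bigr => j _.
      by rewrite -[in RHS](sqr_sqrtr p0); ring.
    have e4 : \sum_i `|Num.sqrt p * X i t| ^+ 3 = Num.sqrt p ^+ 3 * H4 t.
      rewrite mulr_sumr; apply: eq_bigr => i _.
      by rewrite normrM ger0_norm ?sqrtr_ge0// exprMn.
    move: h; rewrite e2 e3 e4; nra.
  have I1 : \int[P]_t H1 t = 0.
    rewrite Rintegral_sum; last by move=> i; exact: rintegrableZ.
    rewrite big1// => i _.
    by rewrite (@RintegralZl _ _ _ P setT (X i) (g i * Num.sqrt p) measurableT (i1 i)) EX mulr0.
  have I2 : \int[P]_t H2 t = \sum_i g i * cX i i.
    rewrite Rintegral_sum; last by move=> i; exact: rintegrableZ.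
    apply: eq_bigr => i _.
    exact: (@RintegralZl _ _ _ P setT (fun t => X i t * X i t) (g i) measurableT (i2 i i)).
  have I3 : \int[P]_t H3 t = \sum_i \sum_j g i * g j * cX i j.
    rewrite Rintegral_sum; last by move=> i; apply: rintegrable_sum => j; exact: rintegrableZ.
    apply: eq_bigr => i _; rewrite Rintegral_sum; last by move=> j; exact: rintegrableZ.
    apply: eq_bigr => j _.
    exact: (@RintegralZl _ _ _ P setT (fun t => X i t * X j t) (g i * g j) measurableT (i2 i j)).
  have I4 : \int[P]_t H4 t = \sum_i \int[P]_t (`|X i t| ^+ 3) by rewrite Rintegral_sum.
  rewrite (RintegralD _ j7 j5)// (RintegralD _ (rintegrable_cst P (lse b x)) j6)//.
  rewrite (RintegralD _ j1 j23)// Rintegral_cst1 (RintegralZl _ _ j4)//.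
  rewrite (RintegralZl _ _ (rintegrableD j2 (rintegrableZ (-1) j3)))//.
  rewrite (RintegralD _ j2 (rintegrableZ (-1) j3))// (RintegralZl _ _ j3)//.
  rewrite I1 I2 I3 I4 add0r mulN1r (@gibbs_var g cX)//; last first.
    by move=> i j; apply: eq_Rintegral => t _; rewrite mulrC.
  by rewrite -/(V _) le_eqVlt; apply/orP; left; apply/eqP; field.
have : p * V cX <= V (list_cov vs).
  rewrite mulr_sumr; apply: ler_sum => i _; rewrite mulr_sumr; apply: ler_sum => j _.
  by rewrite mulrCA ler_wpM2l// mulr_ge0.
by rewrite /lindeberg_error; move: upper lower b0; nra.
Qed.

Lemma Rintegral_ravg vs F (Y : I -> T -> R) x :
  (forall z, rintegrable P (fun t => F (fun i => z i + Y i t))) ->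
  rintegrable P (fun t => ravg vs F (fun i => x i + Y i t)) /\
  \int[P]_t ravg vs F (fun i => x i + Y i t) =
  ravg vs (fun z => \int[P]_t F (fun i => z i + Y i t)) x.
Proof.
move=> iF; elim: vs x => [|v vs IH] x //=.
have [i1 e1] := IH (fun i => x i + v i).
have [i2 e2] := IH (fun i => x i - v i).
have E t : (ravg vs F (fun i => x i + Y i t + v i) + ravg vs F (fun i => x i + Y i t - v i)) / 2 =
    2^-1 * (ravg vs F (fun i => x i + v i + Y i t) + ravg vs F (fun i => x i - v i + Y i t)).
  rewrite mulrC; congr (_ * (_ + _)).
    by congr ravg; apply/funext => i; rewrite addrAC.
  by congr ravg; apply/funext => i; rewrite addrAC.
under eq_fun do rewrite E.
split; first by apply: rintegrableZ; exact: rintegrableD.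
by rewrite RintegralZl ?RintegralD ?e1 ?e2 1?mulrC//; exact: rintegrableD.
Qed.

(** The last piece of variance [1 / K] is split off and replaced by signs, after which [ravg]
    commutes with the remaining Gaussian integral and the induction applies at every shifted
    starting point. *)
Lemma gaussian_le_iter (K : nat) vs : (0 < K)%N ->
  (forall i j, K%:R^-1 * increment_var cX i j <= increment_var (list_cov vs) i j) ->
  \int[P]_t lse b (X ^~ t) <=
  iter K (ravg vs) (lse b) (fun=> 0) + K%:R * lindeberg_error K%:R^-1 vs.
Proof.
move=> K0 hvar.
set e := lindeberg_error _ _.
have Kp : 0 < K%:R^-1 :> R by rewrite invr_gt0 ltr0n.
have i1 i := gaussian_field_integrable mX gX i.
have iL x (c : R) : rintegrable P (fun t => lse b (fun i => x i + c * X i t)).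
  apply: (@lse_integrable _ _ P (fun i t => x i + c * X i t)) => i.
  by apply: rintegrableD; [exact: rintegrable_cst|exact: rintegrableZ].
(* Starting at [k.+1] keeps both weights [k.+1 / k.+2] and [1 / k.+2] positive in the splitting. *)
suff H k x : \int[P]_t lse b (fun i => x i + Num.sqrt (k.+1%:R / K%:R) * X i t) <=
    iter k.+1 (ravg vs) (lse b) x + k.+1%:R * e.
  have KE : K.-1.+1 = K by rewrite prednK.
  have := H K.-1 (fun=> 0); rewrite KE.
  apply: le_trans; rewrite le_eqVlt; apply/orP; left; apply/eqP.
  apply: eq_Rintegral => t _; congr lse; apply/funext => i.
  by rewrite divff ?sqrtr1 ?mul1r ?add0r// pnatr_eq0 -lt0n.
elim: k x => [|k IH] x.
  by rewrite div1r mul1r/=; apply: gaussian_le_ravg => //; exact: ltW.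
have k1 : 0 < k.+1%:R :> R by rewrite ltr0n.
have k2 : 0 < k.+2%:R :> R by rewrite ltr0n.
rewrite (@gaussian_semigroup _ _ _ P I X mX gX EX (lse b) _ _ x _ (k.+1%:R / k.+2%:R)
  k.+2%:R^-1); first last.
- by rewrite -[X in _ + X]div1r -mulrDl natr1 divff// gt_eqF.
- by rewrite invr_gt0.
- by rewrite divr_gt0.
- by move=> d0 T0 Y; exact: measurable_lse.
- by move=> v w; exact: lse_lip.
have E t t' : (fun i => x i + Num.sqrt (k.+2%:R / K%:R) *
      (Num.sqrt (k.+1%:R / k.+2%:R) * X i t + Num.sqrt k.+2%:R^-1 * X i t')) =
    (fun i => (x i + Num.sqrt (k.+1%:R / K%:R) * X i t) + Num.sqrt K%:R^-1 * X i t').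
  apply/funext => i; rewrite mulrDr !mulrA -!sqrtrM ?divr_ge0// addrA.
  by congr (_ + Num.sqrt _ * _ + Num.sqrt _ * _); field; rewrite !gt_eqF ?ltr0n.
under eq_Rintegral => t _.
  under eq_Rintegral do rewrite E.
  over.
pose Y i t := Num.sqrt (k.+1%:R / K%:R) * X i t.
have [j1 j2] := @Rintegral_ravg vs (lse b) Y x (fun z => iL z _).
apply: (@le_trans _ _ (\int[P]_t (ravg vs (lse b) (fun i => x i + Y i t) + e))).
  apply: le_Rintegral => //.
  - pose Z i (z : T * T) := x i + Y i z.1 + Num.sqrt K%:R^-1 * X i z.2.
    have iZ : rintegrable (P \x P)%E (fun z => lse b (Z ^~ z)).
      apply: lse_integrable => i; apply: rintegrableD; last first.
        by apply: rintegrableZ; exact: (rintegrable_snd P (i1 i)).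
      apply: rintegrableD; first exact: rintegrable_cst.
      by apply: rintegrableZ; exact: (rintegrable_fst P (i1 i)).
    have := integrable_fubini_F iZ; congr (integrable _ _ _).
    by apply/funext => t; rewrite /fubini_F /= EFin_Rintegral.
  - by apply: rintegrableD => //; exact: rintegrable_cst.
  - by move=> t _; apply: gaussian_le_ravg => //; exact: ltW.
rewrite RintegralD//; last exact: rintegrable_cst.
rewrite Rintegral_cst1 j2 -[k.+2%:R]natr1 mulrDl mul1r addrA lerD2r.
rewrite -[X in _ + X](ravg_cst vs (k.+1%:R * e) x) -ravgD /=.
by apply: ravg_le => z; exact: IH.
Qed.

End sudakov_fernique.

(** * Hyperbolic and logarithmic inequalities *)

Section elementary_bounds.
Context (R : realType).
Implicit Types x y : R.

Lemma ge0_of_derive (f df : R -> R) : f 0 = 0 -> (forall x : R^o, is_derive x 1 f (df x)) ->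
  (forall x, 0 <= x -> 0 <= df x) -> forall x, 0 <= x -> 0 <= f x.
Proof.
move=> f0 dff df0 x x0; have [c /andP[c0 cx]] := mean_value x0 (fun y _ => dff y).
by rewrite f0 !subr0 => ->; rewrite mulr_ge0// df0.
Qed.

Lemma sinh_ge x : 0 <= x -> x <= (expR x - expR (- x)) / 2.
Proof.
move=> x0; rewrite -subr_ge0; move: x x0.
apply: (@ge0_of_derive (fun x => (expR x - expR (- x)) / 2 - x)
  (fun x => (expR x + expR (- x)) / 2 - 1)).
- by rewrite oppr0 expR0; field.
- by move=> y; apply: is_derive_eq; rewrite /GRing.scale/=; field.
- move=> y _; have := expRxMexpNx_1 y; have := expR_gt0 y; have := expR_gt0 (- y).
  have := sqr_ge0 (expR y - expR (- y)).
  move: (expR y) (expR (- y)) => u v h v0 u0 uv; rewrite subr_ge0.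
  rewrite leNgt; apply/negP => k; nra.
Qed.

(* [cosh x * exp (- x^2/2)] decreases on [x >= 0] because [tanh x <= x]. *)
Lemma cosh_le x : (expR x + expR (- x)) / 2 <= expR (x ^+ 2 / 2).
Proof.
wlog x0 : x / 0 <= x => [h|].
  have [/h//|x0] := leP 0 x.
  have := h (- x); rewrite opprK sqrrN addrC; apply; rewrite oppr_ge0; exact: ltW.
have tanh_le y : 0 <= y -> 0 <= y * ((expR y + expR (- y)) / 2) - (expR y - expR (- y)) / 2.
  move: y; apply: (@ge0_of_derive (fun y => y * ((expR y + expR (- y)) / 2) - (expR y - expR (-
    y)) / 2)
    (fun y => y * ((expR y - expR (- y)) / 2))).
  - by rewrite oppr0 mul0r subrr mul0r subrr.
  - by move=> y; apply: is_derive_eq; rewrite /GRing.scale/=; field.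
  - by move=> y y0; rewrite mulr_ge0// (le_trans y0)// sinh_ge.
have : 0 <= 1 - (expR x + expR (- x)) / 2 * expR (- (x ^+ 2 / 2)).
  move: x x0; apply: (@ge0_of_derive (fun x => 1 - (expR x + expR (- x)) / 2 * expR (- (x ^+ 2 /
    2)))
    (fun x => (x * ((expR x + expR (- x)) / 2) - (expR x - expR (- x)) / 2) * expR (- (x ^+ 2 /
      2)))).
  - by rewrite expr0n mul0r oppr0 expR0; field.
  - by move=> y; apply: is_derive_eq; rewrite /GRing.scale/=; field.
  - by move=> y y0; rewrite mulr_ge0 ?expR_ge0// tanh_le.
by move=> h; rewrite -[leRHS]mul1r -ler_pdivrMr ?expR_gt0// -expRN -subr_ge0.
Qed.

Lemma ln1B_ge x : 0 <= x <= 1 / 5 -> - x - x ^+ 2 <= ln (1 - x).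
Proof.
move=> /andP[x0 x1]; have x2 : 0 < 1 - x by lra.
rewrite -ler_expR lnK ?posrE//.
(* The linear bound [1 + y <= expR y] at [y = x + x ^+ 2] just fails, its product with [1 - x] being
   [1 - x ^+ 3]; its version squared at [y / 2] is sharp enough. *)
have h1 : (1 + (x + x ^+ 2) / 2) ^+ 2 <= expR (x + x ^+ 2).
  have -> : expR (x + x ^+ 2) = expR ((x + x ^+ 2) / 2) ^+ 2.
    by rewrite -expRM_natl; congr expR; field.
  by rewrite lerXn2r ?nnegrE ?expR_ge0 ?expR_ge1Dx// addr_ge0// divr_ge0 ?addr_ge0 ?sqr_ge0.
have h2 := expRxMexpNx_1 (x + x ^+ 2).
have h3 := expR_gt0 (- (x + x ^+ 2)).
rewrite -opprD; move: h1 h2 h3; set u := expR (x + _); set v := expR _ => h1 h2 h3.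
have : v * (1 + (x + x ^+ 2) / 2) ^+ 2 <= 1 by nra.
have k : 1 <= (1 - x) * (1 + (x + x ^+ 2) / 2) ^+ 2.
  have x3 : 0 <= x ^+ 2 * (1 / 5 - x) by rewrite mulr_ge0 ?sqr_ge0// subr_ge0.
  have x4 : 0 <= x ^+ 3 by rewrite exprn_ge0.
  have x5 : 0 <= x ^+ 3 * (1 / 5 - x) by rewrite mulr_ge0// subr_ge0.
  have x6 : 0 <= x ^+ 3 * (1 / 5 - x) * (1 / 5 + x) by rewrite mulr_ge0// addr_ge0.
  nra.
move=> /le_trans/(_ k); rewrite ler_pM2r// exprn_gt0//; have := sqr_ge0 x; lra.
Qed.

End elementary_bounds.

(** * The supersolution inequality in logarithmic form *)

Section supersolution.
Context (R : realType).
Variables (lam kap a : R).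
Hypotheses (lam0 : 0 < lam) (kap0 : 0 < kap) (lam2 : lam ^+ 2 = 2 * a)
  (lamkap : lam * kap = 3 / 2) (a1 : 1 <= a).

Let kap2 : kap ^+ 2 <= 9 / 8.
Proof.
have : (lam * kap) ^+ 2 = 9 / 4 by rewrite lamkap; field.
rewrite exprMn lam2 => h; have : 0 <= (a - 1) * kap ^+ 2 by rewrite mulr_ge0 ?sqr_ge0 ?subr_ge0.
nra.
Qed.

Lemma kap_le_lam : kap <= lam.
Proof.
rewrite leNgt; apply/negP => h; have : lam * lam < lam * kap by rewrite ltr_pM2l.
rewrite -expr2 lam2 lamkap; apply/negP; rewrite -leNgt.
rewrite ler_pdivrMr// mulrAC -natrM; apply: (@le_trans _ _ 4); first by rewrite ler_nat.
by rewrite ler_peMr.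
Qed.

Section root_increment.
Variables (eta r r' : R).
Hypotheses (eta0 : 0 < eta) (eta1 : eta <= 1) (r1 : 1 <= r) (r'0 : 0 < r')
  (r'E : r' ^+ 2 = r ^+ 2 + eta).

Let r0 : 0 < r. Proof. exact: lt_le_trans r1. Qed.

Let rr' : r <= r'.
Proof.
by rewrite -(@ler_pXn2r _ 2) ?nnegrE ?(ltW r0) ?(ltW r'0)// r'E lerDl ltW.
Qed.

Let r'2 : r' <= 2 * r.
Proof.
rewrite -(@ler_pXn2r _ 2) ?nnegrE ?mulr_ge0 ?ltW// exprMn r'E.
have := exprn_ege1 2 r1; move: (r ^+ 2) eta1 => q e1 q1; lra.
Qed.

Let etaE : eta = (r' - r) * (r + r').
Proof. by rewrite -[eta](addKr (r ^+ 2)) -r'E; ring. Qed.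

(** With [r ^+ 2 = t + 1], the time derivative of [- 60 / r] is [30 / r ^+ 3]; half of it survives a
    discrete step because [r' <= 2 * r]. *)
Lemma inv_root_increment : eta * (15 / r ^+ 3) <= 60 * (1 / r - 1 / r').
Proof.
have -> : 60 * (1 / r - 1 / r') = eta * (60 / (r * r' * (r + r'))).
  by rewrite etaE; field; rewrite !gt_eqF ?addr_gt0.
rewrite ler_pM2l// ler_pdivrMr ?exprn_gt0// mulrAC ler_pdivlMr ?mulr_gt0 ?addr_gt0//.
have h1 : r * r' * r <= 2 * r ^+ 3.
  have -> : 2 * r ^+ 3 = r * (2 * r) * r by ring.
  by rewrite ler_pM2r// ler_pM2l.
have h2 : r * r' * r' <= 2 * r ^+ 3.
  apply: (@le_trans _ _ (2 * r ^+ 2 * r)); last by rewrite -mulrA -exprSr.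
  have -> : r * r' * r' = r' ^+ 2 * r by ring.
  rewrite ler_pM2r// r'E.
  have := exprn_ege1 2 r1; move: (r ^+ 2) eta1 => q e1 q1; lra.
rewrite mulrDr; lra.
Qed.

(** The surplus [1 / (4 * r)] over unit speed comes from the square root in the width, and is the
    source of the gain of order [z ^ 2 / t ^ (5/2)]. *)
Lemma tau_increment_ge : eta * (1 + 1 / (4 * r)) <= r' ^+ 2 + r' - (r ^+ 2 + r).
Proof.
have -> : r' ^+ 2 + r' - (r ^+ 2 + r) = eta + (r' - r) by rewrite r'E; ring.
rewrite mulrDr mulr1 lerD2l.
have -> : r' - r = eta / (r + r') by rewrite etaE; field; rewrite gt_eqF ?addr_gt0.
rewrite mul1r ler_pM2l// lef_pV2 ?posrE ?mulr_gt0 ?addr_gt0//.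
move: rr' r'2 r0; lra.
Qed.

Lemma tau_increment_le : r' ^+ 2 + r' - (r ^+ 2 + r) <= 2 * eta.
Proof.
have -> : r' ^+ 2 + r' - (r ^+ 2 + r) = eta + (r' - r) by rewrite r'E; ring.
have -> : r' - r = eta / (r + r') by rewrite etaE; field; rewrite gt_eqF ?addr_gt0.
rewrite mulr2n mulrDl mul1r lerD2l ler_pdivrMr ?addr_gt0// ler_peMr ?ltW//.
move: r1 rr'; lra.
Qed.

(** A first-order expansion in [eta]: the widening and the displacement of the frame each contribute
    a gain, and the rest is collected in [eta ^+ 2 * z ^+ 2]. *)
Lemma inv_tau_increment (z e D C : R) (tau := r ^+ 2 + r) (tau' := r' ^+ 2 + r') :
  0 <= e -> e <= C -> 1 <= z -> eta * e <= D -> D <= C * eta ->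
  z ^+ 2 / 2 * (eta * (1 + 1 / (4 * r)) * (1 / tau) ^+ 2) + z * (eta * e) * (1 / tau)
    - eta ^+ 2 * z ^+ 2 * (1 + C + C ^+ 2) <=
  z ^+ 2 / (2 * tau) - (z - D) ^+ 2 / (2 * tau').
Proof.
move=> e0 eC z1 D1 DC.
have z0 : 0 < z by exact: lt_le_trans z1.
have D0 : 0 <= D by apply: le_trans D1; rewrite mulr_ge0// ltW.
have C0 : 0 <= C by exact: le_trans eC.
have tau2 : 2 <= tau by rewrite /tau -[2]/(1 + 1) lerD// exprn_ege1.
have tau'2 : 2 <= tau'.
  have r'1 : 1 <= r' by exact: le_trans rr'.
  by rewrite /tau' -[2]/(1 + 1) lerD// exprn_ege1.
have tau0 : 0 < tau by exact: lt_le_trans tau2.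
have tau'0 : 0 < tau' by exact: lt_le_trans tau'2.
have dtau1 : eta * (1 + 1 / (4 * r)) <= tau' - tau by exact: tau_increment_ge.
have dtau2 : tau' - tau <= 2 * eta by exact: tau_increment_le.
pose i := 1 / tau; pose i' := 1 / tau'.
have i0 : 0 < i by rewrite divr_gt0.
have i'0 : 0 < i' by rewrite divr_gt0.
have i1 : i <= 1 / 2 by rewrite /i ler_pM2l// lef_pV2 ?posrE.
have i'1 : i' <= 1 / 2 by rewrite /i' ler_pM2l// lef_pV2 ?posrE.
have ii' : i - i' = (tau' - tau) * (i * i') by rewrite /i /i'; field; rewrite !gt_eqF.
have i'i : i * (1 - eta) <= i'.
  have k1 : (tau' - tau) * (i * i') <= 2 * eta * (i * i') by rewrite ler_wpM2r// mulr_ge0 ?ltW.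
  have k2 : eta * i * i' <= eta * i * (1 / 2).
    by rewrite ler_wpM2l// mulr_ge0 ?ltW.
  move: k1 k2 ii'; move: ((tau' - tau) * (i * i')) => u; lra.
have d1 : 0 <= 1 - eta by rewrite subr_ge0.
have r41 : 1 / (4 * r) <= 1.
  rewrite ler_pdivrMr ?mulr_gt0// mul1r; move: r1; lra.
have r40 : 0 < 1 / (4 * r) by rewrite divr_gt0 ?mulr_gt0.
have z20 : 0 < z ^+ 2 by rewrite exprn_gt0.
have z21 : 1 <= z ^+ 2 by rewrite exprn_ege1.
have -> : z ^+ 2 / (2 * tau) - (z - D) ^+ 2 / (2 * tau') =
    z ^+ 2 / 2 * (i - i') + z * D * i' - D ^+ 2 / 2 * i'.
  by rewrite /i /i'; field; rewrite !gt_eqF.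
rewrite -/i.
have q1 : z ^+ 2 / 2 * (eta * (1 + 1 / (4 * r)) * i ^+ 2) - eta ^+ 2 * z ^+ 2 <=
    z ^+ 2 / 2 * (i - i').
  have -> : z ^+ 2 / 2 * (eta * (1 + 1 / (4 * r)) * i ^+ 2) - eta ^+ 2 * z ^+ 2 =
     z ^+ 2 / 2 * (eta * (1 + 1 / (4 * r)) * i ^+ 2 - 2 * eta ^+ 2) by field; rewrite gt_eqF.
  rewrite ler_pM2l ?divr_gt0// ii'.
  apply: (@le_trans _ _ (eta * (1 + 1 / (4 * r)) * (i * i'))); last first.
    by rewrite ler_wpM2r// mulr_ge0 ?ltW.
  apply: (@le_trans _ _ (eta * (1 + 1 / (4 * r)) * (i * (i * (1 - eta))))); last first.
    apply: ler_wpM2l; first by rewrite mulr_ge0 ?addr_ge0 ?ltW.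
    by apply: ler_wpM2l; rewrite // ltW.
  set c := 1 / (4 * r) in r40 r41 *.
  have -> : eta * (1 + c) * (i * (i * (1 - eta))) = eta * (1 + c) * i ^+ 2 - eta ^+ 2 * ((1 + c)
    * i ^+ 2) by ring.
  rewrite lerD2l lerN2 [leRHS]mulrC ler_wpM2l ?sqr_ge0//.
  apply: (@le_trans _ _ (2 * 1)); last by rewrite mulr1.
  apply: ler_pM; rewrite ?sqr_ge0//.
  - by rewrite addr_ge0// ltW.
  - by move: r41; rewrite -(lerD2l 1).
  - by rewrite exprn_ile1 ?(ltW i0)// (le_trans i1)// ler_pdivrMr// mul1r ler1n.
have q2 : z * (eta * e) * i - eta ^+ 2 * z ^+ 2 * C <= z * D * i'.
  apply: (@le_trans _ _ (z * D * (i * (1 - eta)))); last by rewrite ler_wpM2l// mulr_ge0// ltW.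
  apply: (@le_trans _ _ (z * (eta * e) * (i * (1 - eta)))); last first.
    apply: ler_wpM2r; first by rewrite mulr_ge0// ltW.
    by apply: ler_wpM2l; rewrite // ltW.
  have : eta ^+ 2 * (z * e * i) <= eta ^+ 2 * (z ^+ 2 * C).
    rewrite ler_wpM2l ?sqr_ge0//; have : z * e * i <= z * C * 1.
      apply: ler_pM => //; [by rewrite mulr_ge0// ltW|exact: ltW|by rewrite ler_wpM2l// ltW|].
      by move: i1; lra.
    by move=> /le_trans; apply; rewrite mulr1 ler_wpM2r// expr2 ler_peMr// ltW.
  have -> : z * (eta * e) * (i * (1 - eta)) = z * (eta * e) * i - eta ^+ 2 * (z * e * i) by ring.
  have -> : eta ^+ 2 * z ^+ 2 * C = eta ^+ 2 * (z ^+ 2 * C) by ring.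
  by rewrite lerD2l lerN2.
have q3 : D ^+ 2 / 2 * i' <= eta ^+ 2 * z ^+ 2 * C ^+ 2.
  have k1 : D ^+ 2 <= (C * eta) ^+ 2 by rewrite lerXn2r ?nnegrE// (le_trans D0).
  apply: (@le_trans _ _ (D ^+ 2)).
    by rewrite -mulrA ler_piMr ?sqr_ge0//; move: i'1 i'0; lra.
  apply: (le_trans k1).
  have -> : eta ^+ 2 * z ^+ 2 * C ^+ 2 = (C * eta) ^+ 2 * z ^+ 2 by ring.
  by rewrite ler_peMr// sqr_ge0.
move: q1 q2 q3.
have -> : eta ^+ 2 * z ^+ 2 * (1 + C + C ^+ 2) = eta ^+ 2 * z ^+ 2 + eta ^+ 2 * z ^+ 2 * C + eta
  ^+ 2 * z ^+ 2 * C ^+ 2 by ring.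
move: (eta ^+ 2 * z ^+ 2 * C ^+ 2) (D ^+ 2 / 2 * i') (z * (eta * e) * i)
  (eta ^+ 2 * z ^+ 2 * C) (eta ^+ 2 * z ^+ 2) (z * D * i') (z ^+ 2 / 2 * (i - i'))
  (z ^+ 2 / 2 * (eta * (1 + 1 / (4 * r)) * i ^+ 2)) => y1 y2 y3 y4 y5 y6 y7 y8.
lra.
Qed.

End root_increment.

(** Dominates the sum of the coefficients of the second-order errors in [log_drift],
    [inv_tau_increment] and [cubic_drift]. *)
Definition drift_error : R := (lam + 1) ^+ 3 + kap + 2 * (lam + kap) ^+ 2 + lam + kap + 2.

Lemma drift_error_gt0 : 0 < drift_error.
Proof.
by rewrite /drift_error !addr_gt0 ?mulr_gt0 ?exprn_gt0 ?addr_gt0.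
Qed.

Lemma log_drift (eta r z D l : R) : 0 < eta -> 1 <= r -> 1 <= z ->
  eta * (lam - kap / r ^+ 2) <= D -> D <= eta * (lam - kap / r ^+ 2) + kap * eta ^+ 2 ->
  0 <= D -> D <= (lam + kap) * eta ->
  - (D / z) - (D / z) ^+ 2 <= l ->
  - (eta * (lam / z)) + eta * (kap / (r ^+ 2 * z)) - eta ^+ 2 * (kap + (lam + kap) ^+ 2) <= l.
Proof.
move=> eta0 r1 z1 D1 D2 D0 DC hl; apply: le_trans hl.
have r0 : 0 < r by exact: lt_le_trans r1.
have z0 : 0 < z by exact: lt_le_trans z1.
have e1 : D / z <= eta * (lam / z) - eta * (kap / (r ^+ 2 * z)) + kap * eta ^+ 2.
  have -> : eta * (lam / z) - eta * (kap / (r ^+ 2 * z)) = eta * (lam - kap / r ^+ 2) / z.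
    by field; rewrite !gt_eqF.
  apply: (@le_trans _ _ ((eta * (lam - kap / r ^+ 2) + kap * eta ^+ 2) / z)).
    by rewrite ler_pM2r ?invr_gt0.
  by rewrite mulrDl lerD2l ler_pdivrMr// ler_peMr// mulr_ge0 ?sqr_ge0// ltW.
have e2 : (D / z) ^+ 2 <= (lam + kap) ^+ 2 * eta ^+ 2.
  rewrite -exprMn lerXn2r ?nnegrE ?divr_ge0 ?(ltW z0)//.
    by rewrite (le_trans D0).
  by rewrite ler_pdivrMr// (le_trans DC)// ler_peMr// (le_trans D0).
move: e1 e2; rewrite mulrDr.
move: (D / z) ((D / z) ^+ 2) (eta * (lam / z)) (eta * (kap / (r ^+ 2 * z)))
  => y1 y2 y3 y4; rewrite ![eta ^+ 2 * _]mulrC.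
by move: (kap * eta ^+ 2) ((lam + kap) ^+ 2 * eta ^+ 2) => y5 y6; lra.
Qed.

(** [rho] is the decay rate of the profile at [z]. The critical relation [lam ^+ 2 = 2 * a] merges
    [a] and [lam ^+ 2 / 2]. The Gaussian factor gives [- 1 / (2 * tau)] and the linear prefactor
    [- 1 / tau]; their sum is balanced by [lam * kap = 3 / 2], the origin of the logarithmic
    correction. *)
Lemma cubic_drift (eta z tau rho : R) : 0 < eta -> 1 <= z -> 2 <= tau -> rho = lam + z / tau ->
  eta * (a - 1 / (2 * tau) + rho ^+ 2 / 2 - rho / z + rho ^+ 3 * eta / (2 * z)) <=
   eta * (2 * a + lam * z / tau + z ^+ 2 / (2 * tau ^+ 2) - lam / z - 3 / 2 * (1 / tau)) +
   eta ^+ 2 * z ^+ 2 * (lam + 1) ^+ 3.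
Proof.
move=> eta0 z1 tau2 rhoE.
have z0 : 0 < z by exact: lt_le_trans z1.
have tau0 : 0 < tau by exact: lt_le_trans tau2.
have -> : eta * (a - 1 / (2 * tau) + rho ^+ 2 / 2 - rho / z + rho ^+ 3 * eta / (2 * z)) =
   eta * (2 * a + lam * z / tau + z ^+ 2 / (2 * tau ^+ 2) - lam / z - 3 / 2 * (1 / tau)) +
   eta ^+ 2 * (rho ^+ 3 / (2 * z)).
  have -> : a = lam ^+ 2 / 2 by rewrite lam2; field.
  by rewrite rhoE; field; rewrite !gt_eqF.
rewrite lerD2l -mulrA ler_wpM2l ?sqr_ge0// ler_pdivrMr ?mulr_gt0//.
have rho0 : 0 <= rho by rewrite rhoE addr_ge0 ?divr_ge0 ?ltW.
have rhoz : rho <= (lam + 1) * z.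
  rewrite rhoE mulrDl mul1r lerD ?ler_peMr// ?(ltW lam0)//.
  rewrite ler_pdivrMr// ler_peMr ?ltW//; move: tau2; lra.
apply: (@le_trans _ _ (((lam + 1) * z) ^+ 3)).
  by rewrite lerXn2r ?nnegrE// (le_trans rho0).
have -> : z ^+ 2 * (lam + 1) ^+ 3 * (2 * z) = 2 * ((lam + 1) * z) ^+ 3 by ring.
rewrite ler_peMl ?exprn_ge0 ?mulr_ge0 ?addr_ge0 ?ltW//; lra.
Qed.

(** The arithmetic-geometric mean inequality, with [4 * kap ^+ 2 <= 9 / 2], a consequence of
    [lam * kap = 3 / 2] and [lam ^+ 2 >= 2]. *)
Lemma drift_amgm (r z tau : R) : 0 < r -> 0 < tau ->
  kap * z / (r ^+ 2 * tau) <= z ^+ 2 / (16 * r * tau ^+ 2) + 9 / 2 * (1 / r ^+ 3).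
Proof.
move=> r0 tau0; rewrite -subr_ge0.
have : 0 <= ((z / (4 * tau) - 2 * kap / r) ^+ 2 + (9 / 2 - 4 * kap ^+ 2) / r ^+ 2) / r.
  apply: divr_ge0 (ltW r0); rewrite addr_ge0 ?sqr_ge0// divr_ge0 ?sqr_ge0//.
  move: kap2; lra.
by congr (0 <= _); field; rewrite !gt_eqF.
Qed.

(* The supersolution property of [profile] below, in logarithmic form, with
   [r ^+ 2 = t + 1], [D] the displacement of [front] over a time step [eta] and
   [l] standing for [ln (1 - D / z)]. *)
Lemma drift_inequality (eta r r' z D l tau tau' rho : R) :
  tau = r ^+ 2 + r -> tau' = r' ^+ 2 + r' -> rho = lam + z / tau ->
  0 < eta -> eta <= 1 -> 1 <= r -> 0 < r' -> r' ^+ 2 = r ^+ 2 + eta -> 1 <= z ->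
  eta * (lam - kap / r ^+ 2) <= D -> D <= eta * (lam - kap / r ^+ 2) + kap * eta ^+ 2 ->
  - (D / z) - (D / z) ^+ 2 <= l ->
  64 * drift_error * eta * r ^+ 5 <= 1 ->
  eta * (a - 1 / (2 * tau) + rho ^+ 2 / 2 - rho / z + rho ^+ 3 * eta / (2 * z)) <=
  lam * D + l + 60 * (1 / r - 1 / r') + z ^+ 2 / (2 * tau) - (z - D) ^+ 2 / (2 * tau').
Proof.
move=> tauE tau'E rhoE eta0 eta1 r1 r'0 r'E z1 D1 D2 hl small.
have r0 : 0 < r by exact: lt_le_trans r1.
have z0 : 0 < z by exact: lt_le_trans z1.
have tau2 : 2 <= tau by rewrite tauE -[2]/(1 + 1) lerD// exprn_ege1.
have tau0 : 0 < tau by exact: lt_le_trans tau2.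
pose C3 := lam + kap.
have C30 : 0 < C3 by rewrite addr_gt0.
have d0 : 0 <= lam - kap / r ^+ 2.
  rewrite subr_ge0 ler_pdivrMr ?exprn_gt0// (le_trans kap_le_lam)// ler_peMr//;
    [exact: ltW|exact: exprn_ege1].
have kr0 : 0 <= kap / r ^+ 2 by rewrite divr_ge0 ?sqr_ge0// ltW.
have dC : lam - kap / r ^+ 2 <= C3.
  rewrite lerBlDr (le_trans _ (_ : C3 <= _)) ?lerDl// ltW//.
have D0 : 0 <= D by apply: le_trans D1; rewrite mulr_ge0// ltW.
have DC : D <= C3 * eta.
  apply: (le_trans D2); rewrite /C3 mulrDl lerD//.
    by rewrite mulrC ler_pM2r// gerBl.
  by rewrite ler_pM2l// expr2 ler_piMr// ltW.
have t1 : eta * (2 * a - 3 / 2 * (1 / r ^+ 2)) <= lam * D.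
  have -> : eta * (2 * a - 3 / 2 * (1 / r ^+ 2)) = lam * (eta * (lam - kap / r ^+ 2)).
    by rewrite -lam2 -lamkap; field; rewrite gt_eqF.
  by rewrite ler_pM2l.
have t2 := log_drift eta0 r1 z1 D1 D2 D0 DC hl.
have t3 := inv_root_increment eta0 eta1 r1 r'0 r'E.
(* The gain is written as two equal halves: one pays for the cross term through [drift_amgm], the
   other for all errors quadratic in [eta] through [small]. *)
have t4 : eta * (2 * (z ^+ 2 / (16 * r * tau ^+ 2)) + z ^+ 2 / (2 * tau ^+ 2) + lam * z / tau -
    kap * z / (r ^+ 2 * tau)) - eta ^+ 2 * z ^+ 2 * (1 + C3 + C3 ^+ 2) <=
    z ^+ 2 / (2 * tau) - (z - D) ^+ 2 / (2 * tau').
  rewrite tau'E [in leRHS]tauE.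
  apply: le_trans (inv_tau_increment eta0 eta1 r1 r'0 r'E d0 dC z1 D1 DC).
  rewrite -tauE le_eqVlt; apply/orP; left; apply/eqP.
  by field; rewrite !gt_eqF.
have p1 := cubic_drift eta0 z1 tau2 rhoE.
have amgm := drift_amgm z r0 tau0.
have rt : 1 / r ^+ 2 - 1 / tau <= 1 / r ^+ 3.
  have -> : 1 / r ^+ 2 - 1 / tau = 1 / (r * tau).
    by rewrite tauE; field; rewrite !gt_eqF ?addr_gt0 ?exprn_gt0.
  rewrite ler_pM2l// lef_pV2 ?posrE ?mulr_gt0 ?exprn_gt0// tauE exprS ler_pM2l// lerDl ltW//.
have sm : eta * z ^+ 2 * drift_error <= z ^+ 2 / (16 * r * tau ^+ 2).
  rewrite mulrAC mulrC ler_wpM2l ?sqr_ge0// -[leRHS]mul1r ler_pdivlMr ?mulr_gt0 ?exprn_gt0//.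
  apply: le_trans small.
  have tt : tau <= 2 * r ^+ 2 by rewrite tauE mulr2n mulrDl mul1r lerD2l expr2 ler_peMr// ltW.
  have h : tau ^+ 2 <= (2 * r ^+ 2) ^+ 2 by rewrite lerXn2r ?nnegrE ?mulr_ge0 ?sqr_ge0// ltW.
  have -> : 64 * drift_error * eta * r ^+ 5 = eta * drift_error * (16 * r * (2 * r ^+ 2) ^+ 2)
    by ring.
  rewrite ler_pM2l ?mulr_gt0 ?drift_error_gt0// ler_pM2l// mulr_gt0//.
have err : eta ^+ 2 * (kap + C3 ^+ 2) + eta ^+ 2 * z ^+ 2 * (1 + C3 + C3 ^+ 2) +
    eta ^+ 2 * z ^+ 2 * (lam + 1) ^+ 3 <= eta * (z ^+ 2 / (16 * r * tau ^+ 2)).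
  apply: (@le_trans _ _ (eta * (eta * z ^+ 2 * drift_error))); last by rewrite ler_pM2l.
  have -> : eta * (eta * z ^+ 2 * drift_error) = eta ^+ 2 * (z ^+ 2 * drift_error) by ring.
  have -> : eta ^+ 2 * (kap + C3 ^+ 2) + eta ^+ 2 * z ^+ 2 * (1 + C3 + C3 ^+ 2) +
    eta ^+ 2 * z ^+ 2 * (lam + 1) ^+ 3 =
    eta ^+ 2 * (kap + C3 ^+ 2 + z ^+ 2 * (1 + C3 + C3 ^+ 2 + (lam + 1) ^+ 3)) by ring.
  rewrite ler_wpM2l ?sqr_ge0//.
  apply: (@le_trans _ _ (z ^+ 2 * (kap + C3 ^+ 2) + z ^+ 2 * (1 + C3 + C3 ^+ 2 + (lam + 1) ^+ 3))).
    rewrite lerD2r ler_peMl ?exprn_ege1//.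
    by rewrite addr_ge0 ?sqr_ge0// ltW.
  rewrite -!mulrDr ler_wpM2l ?sqr_ge0// /drift_error -/C3 /C3.
  by move: ((lam + 1) ^+ 3) ((lam + kap) ^+ 2) => ? ?; lra.
have k0 : 0 <= kap / (r ^+ 2 * z) by rewrite divr_ge0 ?mulr_ge0 ?sqr_ge0// ltW.
have r30 : 0 <= 1 / r ^+ 3 by rewrite divr_ge0 ?exprn_ge0// ltW.
have e15 : 15 / r ^+ 3 = 15 * (1 / r ^+ 3) by rewrite mulrA mulr1.
rewrite e15 in t3.
have w0 : 0 <= z ^+ 2 / (16 * r * tau ^+ 2).
  by rewrite divr_ge0 ?mulr_ge0 ?sqr_ge0 ?ltW.
move: t1 t2 t3 t4 p1 amgm rt err k0 r30 w0; rewrite -/C3.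
move: (1 / r ^+ 2) (kap / (r ^+ 2 * z)) (1 / r ^+ 3) (z ^+ 2 / (16 * r * tau ^+ 2))
  (kap * z / (r ^+ 2 * tau)) (z ^+ 2 / (2 * tau ^+ 2)) (lam * z / tau) (lam / z) (1 / tau)
  => A1 A2 A3 A4 A5 A6 A7 A8 A9.
move: (lam * D) (60 * (1 / r - 1 / r')) (eta * (a - _ + _ - _ + _)) => x1 x3 x4.
move: (z ^+ 2 / (2 * tau)) ((z - D) ^+ 2 / (2 * tau')) => x5 x6.
move: (eta ^+ 2 * (kap + C3 ^+ 2)) (eta ^+ 2 * z ^+ 2 * (1 + C3 + C3 ^+ 2))
  (eta ^+ 2 * z ^+ 2 * (lam + 1) ^+ 3) => x7 x8 x9.
move=> t1 t2 t3 t4 p1 amgm rt err k0 r30 w0.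
(* Of the 15 units of [1 / r ^+ 3], [3 / 2] pay for exchanging [1 / tau] with [1 / r ^+ 2] and
   [9 / 2] for [drift_amgm]. *)
have key : 0 <= eta * (- (3 / 2) * (A1 - A9) + A2 + 15 * A3 + 2 * A4 - A5 - A4).
  by rewrite mulr_ge0 ?(ltW eta0)//; move: amgm rt k0 r30 w0; clear; move=> *; lra.
move: t1 t2 t3 t4 p1 err key; rewrite !(mulrDr, mulrBr, mulrN).
move=> *; lra.
Qed.

End supersolution.

(** * A moving barrier ahead of the front *)

Section barrier.
Context (R : realType).
Variables (lam kap a : R).
Hypotheses (lam0 : 0 < lam) (kap0 : 0 < kap) (lam2 : lam ^+ 2 = 2 * a)
  (lamkap : lam * kap = 3 / 2) (a1 : 1 <= a).

Definition front (t : R) : R := lam * t - kap * ln (t + 1).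

Definition width (t : R) : R := (t + 1) + Num.sqrt (t + 1).

(** Chosen so that [profile] is at least one for [z] between [1 / 2] and [2]: the exponent loses at
    most [2 * lam + 60 + 1], and the remaining unit compensates the prefactor [1 / 2]. *)
Definition barrier_cst : R := expR (2 * lam + 62).

(* [z * exp (- lam z)] is the travelling wave seen from the front.  The factor
   [exp (- z^2 / (2 width))] with [width t > t + 1] gains [z^2 / t ^ (5/2)] per
   unit time, which with the [t ^ (-3/2)] gained by [exp (- 60 / sqrt (t + 1))]
   absorbs the cross term [z / t ^ 2] coming from the motion of the front. *)
Definition profile (t z : R) : R := barrier_cst * z *
  expR (- lam * z - 60 * (1 / Num.sqrt (t + 1)) - z ^+ 2 / (2 * width t)).

Let kaplam : kap <= lam. Proof. exact: kap_le_lam lam0 lam2 lamkap a1. Qed.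

Lemma sqrt_ge1 (t : R) : 0 <= t -> 1 <= Num.sqrt (t + 1).
Proof.
move=> t0; have t1 : 0 < t + 1 by rewrite ltr_wpDl.
have : Num.sqrt 1 <= Num.sqrt (t + 1) by apply: ler_wsqrtr; rewrite lerDr.
by rewrite sqrtr1.
Qed.

Lemma ln_increment (T e : R) : 1 <= T -> 0 < e ->
  e / T - e ^+ 2 <= ln (T + e) - ln T <= e / T.
Proof.
move=> T1 e0; have T0 : 0 < T by exact: lt_le_trans T1.
have Te : 0 < T + e by rewrite addr_gt0.
apply/andP; split.
  have h : -1 < - (e / (T + e)) by rewrite ltrN2 ltr_pdivrMr// mul1r ltrDr.
  have := le_ln1Dx h.
  have -> : 1 + - (e / (T + e)) = T / (T + e) by field; rewrite gt_eqF.
  rewrite ln_div ?posrE// -opprB lerN2; apply: le_trans.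
  rewrite lerBlDl -subr_ge0.
  have -> : e ^+ 2 + e / (T + e) - e / T = e ^+ 2 * (1 - 1 / (T * (T + e))).
    by field; rewrite !gt_eqF.
  rewrite mulr_ge0 ?sqr_ge0// subr_ge0 ler_pdivrMr ?mulr_gt0// mul1r mulr_ege1//.
  by rewrite (le_trans T1)// lerDl ltW.
have -> : ln (T + e) - ln T = ln (1 + e / T).
  by rewrite -ln_div ?posrE//; congr ln; field; rewrite gt_eqF.
by apply: le_ln1Dx; rewrite (lt_trans (ltrN10 _))// divr_gt0.
Qed.

Lemma front_increment (t e : R) : 0 <= t -> 0 < e ->
  e * (lam - kap / (t + 1)) <= front (t + e) - front t <=
    e * (lam - kap / (t + 1)) + kap * e ^+ 2.
Proof.
move=> t0 e0; have T1 : 1 <= t + 1 by rewrite lerDr.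
have /andP[h1 h2] := ln_increment T1 e0.
have -> : front (t + e) - front t = lam * e - kap * (ln (t + 1 + e) - ln (t + 1)).
  by rewrite /front (addrAC t e); ring.
have -> : e * (lam - kap / (t + 1)) = lam * e - kap * (e / (t + 1)) by ring.
have k1 : kap * (e / (t + 1) - e ^+ 2) <= kap * (ln (t + 1 + e) - ln (t + 1)) by rewrite ler_pM2l.
have k2 : kap * (ln (t + 1 + e) - ln (t + 1)) <= kap * (e / (t + 1)) by rewrite ler_pM2l.
rewrite mulrBr in k1; apply/andP; split; move: k1 k2.
  by move: (kap * _) => ? *; lra.
by move: (kap * (ln _ - _)) (kap * (e / _)) (kap * e ^+ 2) => *; lra.
Qed.

(** Used with [q = h / z] and [y = rho * h]: the linear prefactor turns the average over [z + h] and
    [z - h] into this combination. The last term of the exponent is the price of moving the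
    hyperbolic sine into it. *)
Lemma coshB_sinh_le (z y q : R) : 0 < q -> 0 <= y -> q <= 1 ->
  (expR y + expR (- y)) / 2 - q * ((expR y - expR (- y)) / 2) <=
  expR (y ^+ 2 / 2 - q * y + q * y * (y ^+ 2 / 2)).
Proof.
move=> q0 y0 q1; apply: (@le_trans _ _ (expR (y ^+ 2 / 2) - q * y)).
  by rewrite lerB ?cosh_le// ler_pM2l// sinh_ge.
have -> : y ^+ 2 / 2 - q * y + q * y * (y ^+ 2 / 2) = y ^+ 2 / 2 + (- (q * y) + q * y * (y ^+ 2
  / 2)) by ring.
rewrite expRD; apply: (@le_trans _ _ (expR (y ^+ 2 / 2) * (1 + (- (q * y) + q * y * (y ^+ 2 /
  2))))); last first.
  by rewrite ler_pM2l ?expR_gt0// expR_ge1Dx.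
rewrite mulrDr mulr1 lerD2l.
have -> : - (q * y) + q * y * (y ^+ 2 / 2) = - (q * y * (1 - y ^+ 2 / 2)) by ring.
rewrite mulrN lerN2 mulrCA ler_piMr//; first by rewrite mulr_ge0// ltW.
have e1 : expR (y ^+ 2 / 2) * expR (- (y ^+ 2 / 2)) = 1 by rewrite expRxMexpNx_1.
by rewrite -[leRHS]e1 ler_wpM2l ?expR_ge0// expR_ge1Dx.
Qed.

(** The values at [z + h] and [z - h] share the exponential at [z] up to a tilt by [rho]. After
    [coshB_sinh_le] both sides are exponentials times a common positive factor, and the exponents
    compare by [drift_inequality]. *)
Lemma profile_heat (t z h : R) (eta := h ^+ 2) (r := Num.sqrt (t + 1)) :
  0 <= t -> 0 < h -> h <= 1 -> 1 <= z -> 64 * drift_error lam kap * eta * r ^+ 5 <= 1 ->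
  expR (eta * a) * ((profile t (z + h) + profile t (z - h)) / 2) <=
  profile (t + eta) (z - (front (t + eta) - front t)).
Proof.
move=> t0 h0 h1 z1 small.
have eta0 : 0 < eta by rewrite exprn_gt0.
have eta1 : eta <= 1 by rewrite exprn_ile1// ltW.
have T0 : 0 < t + 1 by rewrite ltr_wpDl.
have r1 : 1 <= r by exact: sqrt_ge1.
have r0 : 0 < r by exact: lt_le_trans r1.
have r2 : r ^+ 2 = t + 1 by rewrite sqr_sqrtr// ltW.
pose r' := Num.sqrt (t + eta + 1).
have T'0 : 0 < t + eta + 1 by rewrite addrAC addr_gt0.
have r'0 : 0 < r' by rewrite sqrtr_gt0.
have r'2 : r' ^+ 2 = r ^+ 2 + eta by rewrite r2 sqr_sqrtr ?ltW// addrAC.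
have z0 : 0 < z by exact: lt_le_trans z1.
pose tau := width t; pose tau' := width (t + eta).
have tauE : tau = r ^+ 2 + r by rewrite r2.
have tau'E : tau' = r' ^+ 2 + r' by rewrite /tau' /width sqr_sqrtr// ltW.
have tau0 : 0 < tau by rewrite tauE addr_gt0// exprn_gt0.
pose rho := lam + z / tau.
have rho0 : 0 < rho by rewrite addr_gt0// divr_gt0.
set D := front _ - front t.
have /andP[D1 D2] := front_increment t0 eta0.
rewrite -/D -r2 in D1 D2.
have e64 : eta * drift_error lam kap <= 1 / 64.
  rewrite ler_pdivlMr//; apply: le_trans small.
  have -> : eta * drift_error lam kap * 64 = 64 * drift_error lam kap * eta * 1 by ring.
  by rewrite ler_pM2l ?exprn_ege1// !mulr_gt0// drift_error_gt0.
have DC : D <= 1 / 64.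
  apply: le_trans e64; apply: (le_trans D2).
  have -> : eta * (lam - kap / r ^+ 2) + kap * eta ^+ 2 = eta * (lam - kap / r ^+ 2 + kap * eta)
    by ring.
  rewrite ler_pM2l//.
  apply: (@le_trans _ _ (lam + kap)).
    by rewrite lerD// ?gerBl ?divr_ge0 ?sqr_ge0 ?(ltW kap0)// ler_piMr// ltW.
  rewrite /drift_error.
  have k1 : 0 <= (lam + 1) ^+ 3 by rewrite exprn_ge0// addr_ge0// ltW.
  have k2 := sqr_ge0 (lam + kap).
  by move: k1 k2 (ltW kap0); move: ((lam + 1) ^+ 3) ((lam + kap) ^+ 2) => ? ? *; lra.
have D0 : 0 <= D.
  apply: le_trans D1; rewrite mulr_ge0 ?(ltW eta0)// subr_ge0 ler_pdivrMr ?exprn_gt0//.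
  by apply: (le_trans kaplam); rewrite ler_peMr ?exprn_ege1// ltW.
have Dz0 : 0 <= D / z by rewrite divr_ge0// ltW.
have Dz1 : D / z <= 1 / 5.
  rewrite ler_pdivrMr//; apply: (le_trans DC); move: z1; move=> *; lra.
have zD : 0 < 1 - D / z by move: Dz1; move: (D / z) => *; lra.
have hl : - (D / z) - (D / z) ^+ 2 <= ln (1 - D / z) by apply: ln1B_ge; rewrite Dz0.
have key := drift_inequality lam0 kap0 lam2 lamkap a1 tauE tau'E erefl eta0 eta1 r1 r'0 r'2 z1
  D1 D2 hl small.
pose E := expR (- lam * z - 60 * (1 / r) - z ^+ 2 / (2 * tau)).
have P s : profile t (z + s * h) = barrier_cst * E * (z + s * h) *
    (expR (- (s * rho * h)) * expR (- (s ^+ 2 * h ^+ 2 / (2 * tau)))).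
  have e : - lam * (z + s * h) - 60 * (1 / r) - (z + s * h) ^+ 2 / (2 * tau) =
    (- lam * z - 60 * (1 / r) - z ^+ 2 / (2 * tau)) +
      (- (s * rho * h) + - (s ^+ 2 * h ^+ 2 / (2 * tau))).
    by rewrite /rho; field; rewrite !gt_eqF.
  by rewrite /profile e expRD [expR (- (s * rho * h) + _)]expRD -/E; ring.
have -> : (profile t (z + h) + profile t (z - h)) / 2 = barrier_cst * E * z *
    expR (- (eta / (2 * tau))) * ((expR (rho * h) + expR (- (rho * h))) / 2 -
     h / z * ((expR (rho * h) - expR (- (rho * h))) / 2)).
  have := P 1; have := P (-1); rewrite !mul1r mulN1r => -> ->.
  rewrite !mulN1r sqrrN expr1n !mul1r mulNr opprK -/eta; field; rewrite gt_eqF//.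
have hz : h / z <= 1 by rewrite ler_pdivrMr// mul1r (le_trans h1).
apply: (@le_trans _ _ (expR (eta * a) * (barrier_cst * E * z * expR (- (eta / (2 * tau))) *
  expR ((rho * h) ^+ 2 / 2 - h / z * (rho * h) + h / z * (rho * h) * ((rho * h) ^+ 2 / 2))))).
  rewrite ler_pM2l ?expR_gt0// ler_pM2l ?mulr_gt0 ?expR_gt0//.
  by apply: coshB_sinh_le; rewrite ?divr_gt0// mulr_ge0 ?ltW.
have -> : profile (t + eta) (z - D) = barrier_cst * (z * (1 - D / z)) *
   expR (- lam * (z - D) - 60 * (1 / r') - (z - D) ^+ 2 / (2 * tau')).
  by rewrite /profile; congr (_ * _ * _); field; rewrite gt_eqF.
rewrite -[1 - D / z]lnK ?posrE// /E.
set E0 := - lam * z - 60 * (1 / r) - _; set E1 := - lam * (z - D) - _ - _.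
set L := ln _; set q := - (eta / _); set Q := _ - _ + _.
have -> : expR (eta * a) * (barrier_cst * expR E0 * z * expR q * expR Q) =
  barrier_cst * z * expR (eta * a + (E0 + (q + Q))) by rewrite !expRD; ring.
have -> : barrier_cst * (z * expR L) * expR E1 = barrier_cst * z * expR (L + E1).
  by rewrite !expRD; ring.
rewrite ler_pM2l ?mulr_gt0 ?expR_gt0// ler_expR /E0 /E1 /L /q /Q.
move: key.
have -> : (rho * h) ^+ 2 / 2 - h / z * (rho * h) + h / z * (rho * h) * ((rho * h) ^+ 2 / 2) =
  eta * (rho ^+ 2 / 2 - rho / z + rho ^+ 3 * eta / (2 * z)) by rewrite /eta; field; rewrite gt_eqF.
have -> : - (eta / (2 * tau)) = eta * (- (1 / (2 * tau))) by field; rewrite gt_eqF.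
rewrite -/rho; move: (z ^+ 2 / (2 * tau)) ((z - D) ^+ 2 / (2 * tau')) (ln (1 - D / z)) => x1 x2 x3.
move: (1 / (2 * tau)) (rho ^+ 2 / 2) (rho / z) (rho ^+ 3 * eta / (2 * z)) (1 / r) (1 / r') =>
  x4 x5 x6 x7 x8 x9.
rewrite !(mulrDr, mulrBr, mulrN, mulNr).
move: (eta * a) (eta * x4) (eta * x5) (eta * x6) (eta * x7) (lam * z) (lam * D) (60 * x8) (60 *
  x9) => *; lra.
Qed.

Lemma profile_ge1 (t z : R) : 0 <= t -> 2^-1 <= z -> z <= 2 -> 1 <= profile t z.
Proof.
move=> t0 z1 z2.
have r1 : 1 <= Num.sqrt (t + 1) by exact: sqrt_ge1.
have z0 : 0 < z by apply: lt_le_trans z1; rewrite invr_gt0.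
have w2 : 2 <= width t by rewrite /width -[2]/(1 + 1) lerD// lerDr.
have w0 : 0 < width t by exact: lt_le_trans w2.
have e1 : z ^+ 2 / (2 * width t) <= 1.
  rewrite ler_pdivrMr ?mulr_gt0// mul1r; apply: (@le_trans _ _ (2 * 2)); last by rewrite ler_pM2l.
  by rewrite expr2 ler_pM// ltW.
have e2 : lam * z <= 2 * lam by rewrite mulrC ler_pM2r.
have e3 : 60 * (1 / Num.sqrt (t + 1)) <= 60.
  by rewrite ler_piMr// ler_pdivrMr ?mul1r// (lt_le_trans _ r1).
rewrite /profile /barrier_cst mulrAC -expRD.
apply: (@le_trans _ _ (expR 1 * 2^-1)); last first.
  rewrite ler_pM ?expR_ge0 ?invr_ge0// ler_expR mulNr.
  by move: e1 e2 e3; move: (z ^+ 2 / _) (lam * z) (60 * _) => *; lra.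
rewrite ler_pdivlMr// mul1r; exact: (expR_ge1Dx 1).
Qed.

(** The tree branches at once, whereas [profile] spreads the growth rate [a] over unit time; [f] is
    the logarithm of the growth taken in advance and not yet spent. *)
Definition barrier (f t x : R) : R :=
  if x - front t <= 1 then 1 else Num.min 1 (expR f * profile t (x - front t)).

Lemma barrier_le1 f t x : barrier f t x <= 1.
Proof. by rewrite /barrier; case: ifP => // _; rewrite ge_min lexx. Qed.

Lemma barrier_le_profile f t x : 0 <= t -> 0 <= f -> 2^-1 <= x - front t ->
  barrier f t x <= expR f * profile t (x - front t).
Proof.
move=> t0 f0 hx; rewrite /barrier; case: ifP => [h|_]; last by rewrite ge_min lexx orbT.
have p1 : 1 <= profile t (x - front t) by rewrite profile_ge1// (le_trans h)// ler1n.
by rewrite mulr_ege1// -expR0 ler_expR.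
Qed.

(** Within distance one of the new front the right side is [1]. Beyond it [z >= 1], because the
    front only advances, and [h <= 1 / 2] keeps [z - h] and [z + h] above [1 / 2], where
    [barrier_le_profile] applies. *)
Lemma barrier_step (f t x h : R) (eta := h ^+ 2) : 0 <= t -> 0 < h -> h <= 1 / 2 ->
  64 * drift_error lam kap * eta * Num.sqrt (t + 1) ^+ 5 <= 1 -> eta * a <= f ->
  (barrier f t (x - h) + barrier f t (x + h)) / 2 <= barrier (f - eta * a) (t + eta) x.
Proof.
move=> t0 h0 h1 small fa.
have eta0 : 0 < eta by rewrite exprn_gt0.
have le1 : (barrier f t (x - h) + barrier f t (x + h)) / 2 <= 1.
  by rewrite ler_pdivrMr// mul1r -[2]/(1 + 1) lerD ?barrier_le1.
rewrite {3}/barrier; case: ifPn => //; rewrite -ltNge => z'1.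
rewrite le_min le1/=.
pose z := x - front t.
pose D := front (t + eta) - front t.
have zE : x - front (t + eta) = z - D by rewrite /z /D; ring.
have D0 : 0 <= D.
  have /andP[D1 _] := front_increment t0 eta0.
  apply: le_trans D1; rewrite mulr_ge0 ?(ltW eta0)// subr_ge0 ler_pdivrMr ?ltr_wpDl//.
  by apply: (le_trans kaplam); rewrite ler_peMr ?lerDr// ltW.
have z1 : 1 <= z by rewrite ltW// (lt_le_trans z'1)// zE gerBl.
have f0 : 0 <= f by apply: le_trans fa; rewrite mulr_ge0 ?(ltW eta0)// (le_trans _ a1).
rewrite zE expRD expRN mulrAC ler_pdivlMr ?expR_gt0//.
have k1 : h <= 1 by apply: (le_trans h1); rewrite ler_pdivrMr// mul1r ler1n.
apply: le_trans (ler_wpM2l (expR_ge0 f) (profile_heat t0 h0 k1 z1 small)).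
rewrite [leLHS]mulrC [leRHS]mulrCA ler_pM2l ?expR_gt0// mulrA ler_pM2r ?invr_gt0// mulrDr addrC.
have e1 : x + h - front t = z + h by rewrite /z; ring.
have e2 : x - h - front t = z - h by rewrite /z; ring.
rewrite lerD// -?e1 -?e2; apply: barrier_le_profile => //; rewrite ?e1 ?e2.
  by move: z1 h0; move=> *; lra.
by move: z1 h1; move=> *; lra.
Qed.

(** From [z ^+ 3 / 6 <= expR z]; the bound is a difference so that it telescopes in the layer-cake
    sum over [k]. *)
Lemma barrier_tail t (k : nat) : 0 <= t ->
  barrier 0 t (front t + k.+2%:R) <= 6 * barrier_cst * (k.+1%:R^-1 - k.+2%:R^-1).
Proof.
move=> t0; set z : R := k.+2%:R.
have z2 : 2 <= z by rewrite ler_nat.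
have z0 : 0 < z by rewrite ltr0n.
have z1 : 0 < k.+1%:R :> R by rewrite ltr0n.
have zE : z = k.+1%:R + 1 by rewrite natr1.
have e1 : front t + z - front t = z by rewrite addrAC subrr add0r.
have : barrier 0 t (front t + z) <= expR 0 * profile t (front t + z - front t).
  by apply: barrier_le_profile; rewrite // e1; move: z2; lra.
rewrite e1 expR0 mul1r => /le_trans; apply.
have t1 : 0 < t + 1 by rewrite ltr_wpDl.
have w0 : 0 < width t by rewrite addr_gt0 ?sqrtr_gt0.
have l1 : 1 <= lam.
  by rewrite -(@ler_pXn2r _ 2) ?nnegrE ?(ltW lam0)// expr1n lam2; move: a1; lra.
rewrite /profile -!mulrA [6 * _]mulrCA ler_pM2l ?expR_gt0//.
apply: (@le_trans _ _ (z * expR (- z))).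
  rewrite ler_pM2l// ler_expR mulNr.
  have h1 : z <= lam * z by rewrite ler_peMl// ltW.
  have h2 : 0 <= z * (z / (2 * width t)).
    by rewrite mulr_ge0 ?divr_ge0 ?(ltW z0)// mulr_ge0// ltW.
  have h3 : 0 <= 60 * (1 / Num.sqrt (t + 1)) by rewrite mulr_ge0 ?divr_ge0 ?sqrtr_ge0.
  by move: h1 h2 h3; move: (lam * z) (z * (z / _)) (60 * _) => *; lra.
have -> : k.+1%:R^-1 - z^-1 = 1 / (k.+1%:R * z).
  have E (p q : R) : 0 < p -> q = p + 1 -> 0 < q -> p^-1 - q^-1 = 1 / (p * q).
    by move=> p0 -> q0; field; rewrite !gt_eqF.
  exact: E.
rewrite expRN -[z * _]/(z / expR z) ler_pdivrMr ?expR_gt0// mulrAC mulrA mulr1.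
rewrite ler_pdivlMr ?mulr_gt0//.
have := @expR_ge1Dxn R z 2 (ltW z0).
rewrite (_ : 3`! = 6)//; move=> h.
apply: (@le_trans _ _ (z ^+ 3)).
  by rewrite mulrA exprSr expr2 ler_pM2r// ler_pM2l// ler_nat.
move: h; move: (z ^+ 3) (expR z) => u v; lra.
Qed.

End barrier.

(** * The branching recursion stays below the barrier *)

Section branching_recursion.
Context (R : realType).
Implicit Types (g : R -> R) (h : R).

Definition heat h g (y : R) : R := (g (y - h) + g (y + h)) / 2.

Definition branch g (y : R) : R := Num.min 1 (4 * g y).

Definition level (K : nat) h g : R -> R := iter K (heat h) (branch g).

Lemma heat_mono h g g' : (forall y, g y <= g' y) -> forall y, heat h g y <= heat h g' y.
Proof. by move=> gg y; rewrite ler_pM2r ?invr_gt0// lerD. Qed.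

Variables (lam kap : R).
Hypotheses (lam0 : 0 < lam) (kap0 : 0 < kap) (lam2 : lam ^+ 2 = 2 * ln 4)
  (lamkap : lam * kap = 3 / 2).

Lemma ln4_ge1 : 1 <= ln 4 :> R.
Proof. by rewrite -ler_expR lnK ?posrE// expR_le4. Qed.

Let eta (K : nat) : R := K%:R^-1.

(** [branch] raises [f] from [0] to [ln 4], and each of the [K] heat steps of variance [1 / K]
    spends [ln 4 / K] of it, so [f] is zero again at time [j.+1]. *)
Lemma level_barrier (K j : nat) g : (4 <= K)%N ->
  64 * drift_error lam kap * eta K * Num.sqrt (j.+1%:R + 1) ^+ 5 <= 1 ->
  (forall y, g y <= barrier lam kap 0 j%:R y) ->
  forall y, level K (Num.sqrt (eta K)) g y <= barrier lam kap 0 j.+1%:R y.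
Proof.
move=> K4 small gb.
have K0 : 0 < K%:R :> R by rewrite ltr0n (leq_trans _ K4).
have e0 : 0 < eta K by rewrite invr_gt0.
set h := Num.sqrt _; have hE : h ^+ 2 = eta K by rewrite sqr_sqrtr// ltW.
have h0 : 0 < h by rewrite sqrtr_gt0.
have h2 : h <= 1 / 2.
  rewrite -(@ler_pXn2r _ 2) ?nnegrE ?(ltW h0)// hE expr_div_n expr1n -natrX.
  by rewrite div1r lef_pV2 ?posrE// ler_nat.
have step (i : nat) : (i <= K)%N -> forall y, iter i (heat h) (branch g) y <=
    barrier lam kap (ln 4 - i%:R * eta K * ln 4) (j%:R + i%:R * eta K) y.
  elim: i => [_ y|i IH iK y] /=.
    rewrite !mul0r subr0 addr0 /branch.
    apply: (@le_trans _ _ (Num.min 1 (4 * barrier lam kap 0 j%:R y))).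
      by rewrite le_min !ge_min lexx/= (ler_pM2l _ _ _)// gb orbT.
    rewrite /barrier; case: ifP => _; first by rewrite ge_min lexx.
    rewrite expR0 mul1r lnK ?posrE// le_min !ge_min lexx/=.
    by rewrite (ler_pM2l _ _ _)// ge_min lexx !orbT.
  apply: le_trans (heat_mono _ (IH (ltnW iK)) y) _.
  have ie : i%:R * eta K + eta K <= 1.
    by rewrite -[X in _ + X]mul1r -mulrDl natr1 ler_pdivrMr// mul1r ler_nat.
  have t0 : 0 <= j%:R + i%:R * eta K by rewrite addr_ge0// mulr_ge0// ltW.
  have := @barrier_step R lam kap (ln 4) lam0 kap0 lam2 lamkap ln4_ge1
    (ln 4 - i%:R * eta K * ln 4) (j%:R + i%:R * eta K) y h t0 h0 h2.
  rewrite hE; move=> bs; apply: (le_trans (bs _ _)).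
  - apply: le_trans small; rewrite ler_pM2l; last by rewrite !mulr_gt0// drift_error_gt0.
    rewrite lerXn2r ?nnegrE ?sqrtr_ge0//; apply: ler_wsqrtr.
    rewrite lerD2r -natr1 lerD2l; apply: le_trans ie; rewrite lerDl ltW//.
  - rewrite lerBrDr -mulrDl addrC ler_piMl// (le_trans _ ln4_ge1)//.
  - by rewrite -natr1 le_eqVlt; apply/orP; left; apply/eqP; congr barrier; ring.
move=> y; have := step K (leqnn K) y.
have -> : K%:R * eta K = 1 by rewrite divff// gt_eqF.
by rewrite mul1r subrr natr1.
Qed.

Lemma iter_level_barrier (K J : nat) : (4 <= K)%N ->
  64 * drift_error lam kap * eta K * Num.sqrt (J%:R + 1) ^+ 5 <= 1 ->
  forall y, iter J (level K (Num.sqrt (eta K))) (fun y : R => (y <= 0)%R%:R) y <=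
    barrier lam kap 0 J%:R y.
Proof.
move=> K4; have K0 : 0 < K%:R :> R by rewrite ltr0n (leq_trans _ K4).
have e0 : 0 < eta K by rewrite invr_gt0.
elim: J => [_ y|J IH small] /=.
  rewrite /barrier; have -> : front lam kap 0 = 0 by rewrite /front mulr0 !add0r ln1 mulr0 oppr0.
  rewrite subr0.
  case: (leP y 0) => [y0|_]; first by rewrite (le_trans y0).
  case: ifP => // y1; rewrite le_min ler01/= mulr_ge0 ?expR_ge0//.
  rewrite /profile !mulr_ge0 ?expR_ge0//; move: y1 => /negbT; rewrite -ltNge => /ltW.
  by apply: le_trans.
apply: level_barrier => //; apply: IH; apply: le_trans small.
rewrite ler_pM2l; last by rewrite !mulr_gt0// drift_error_gt0.
by rewrite lerXn2r ?nnegrE ?sqrtr_ge0//; apply: ler_wsqrtr; rewrite lerD2r ler_nat.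
Qed.

End branching_recursion.

(** * Reordering and locality of sign averages *)

Section ravg_theory.
Context (R : realType) (I : finType).
Implicit Types (x : I -> R) (vs ws : seq (I -> R)) (F G : (I -> R) -> R).

Lemma ravg_cat vs ws F : ravg (vs ++ ws) F = ravg vs (ravg ws F).
Proof. by apply/funext => x; elim: vs x => //= v vs IH x; rewrite !IH. Qed.

Lemma ravg_cons_comm (v : I -> R) ws F x :
  ravg ws (fun y => (F (fun i => y i + v i) + F (fun i => y i - v i)) / 2) x =
  (ravg ws F (fun i => x i + v i) + ravg ws F (fun i => x i - v i)) / 2.
Proof.
elim: ws x => //= w ws IH x; rewrite !IH.
have c1 (f g : I -> R) : (fun i => x i + f i + g i) = (fun i => x i + g i + f i).
  by apply/funext => i; rewrite addrAC.
have c2 (f g : I -> R) : (fun i => x i + f i - g i) = (fun i => x i - g i + f i).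
  by apply/funext => i; rewrite addrAC.
have c3 (f g : I -> R) : (fun i => x i - f i - g i) = (fun i => x i - g i - f i).
  by apply/funext => i; rewrite addrAC.
by rewrite (c1 w v) (c2 w v) -(c2 v w) (c3 w v); ring.
Qed.

Lemma ravg_comm vs ws F x : ravg vs (ravg ws F) x = ravg ws (ravg vs F) x.
Proof.
elim: vs x => //= v vs IH x; by rewrite !IH -ravg_cons_comm.
Qed.

(** The Lindeberg rounds sweep the whole tree [K] times, while the recursion wants the [K] copies of
    an edge together; commuting signs reconcile the two orders. *)
Lemma ravg_perm (T : eqType) (f : T -> I -> R) (s t : seq T) F x : perm_eq s t ->
  ravg (map f s) F x = ravg (map f t) F x.
Proof.
move=> st; suff: ravg (map f s) F = ravg (map f t) F by move=> ->.
move: t st; apply: catCA_perm_subst => s1 s2 s3.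
apply/funext => y; rewrite !map_cat !ravg_cat; exact: ravg_comm.
Qed.

Lemma iter_ravg K vs F : iter K (ravg vs) F = ravg (flatten (nseq K vs)) F.
Proof. by elim: K => //= K ->; rewrite ravg_cat. Qed.

Definition depends_on (B : pred I) F := forall x y, (forall i, B i -> x i = y i) -> F x = F y.

Lemma depends_on_ravg (B : pred I) vs F : depends_on B F -> depends_on B (ravg vs F).
Proof.
move=> FB; elim: vs => //= v vs IH x y xy; congr ((_ + _) / 2); apply: IH => i Bi;
  by rewrite xy.
Qed.

(** Makes the steps inside one subtree invisible to events of its siblings. *)
Lemma ravg_id (T : eqType) (f : T -> I -> R) (s : seq T) (B : pred I) F :
  depends_on B F -> (forall u i, u \in s -> B i -> f u i = 0) -> ravg (map f s) F = F.
Proof.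
move=> FB; elim: s => //= u s IH f0; rewrite IH; last first.
  by move=> v i vs; apply: f0; rewrite inE vs orbT.
apply/funext => x.
have -> : F (fun i => x i + f u i) = F x.
  by apply: FB => i Bi; rewrite f0 ?mem_head// addr0.
have -> : F (fun i => x i - f u i) = F x.
  by apply: FB => i Bi; rewrite f0 ?mem_head// subr0.
by field.
Qed.

End ravg_theory.

(** * The dyadic tree and the union bound along it *)

Section dyadic_tree.
Context (R : realType) (N c : nat).
Implicit Types (u : nat * nat * nat) (z : V N).

(* A node [(l, a, b)] is the dyadic square of side [2 ^ l] with lower left corner
   [2 ^ l * (a, b)], and stands for the tree edge above it.  The [c] additional
   copies of each leaf edge absorb the additive constant in the comparison of
   increments. *)
Definition block l a b z : bool := (z.1 %/ 2 ^ l == a)%N && (z.2 %/ 2 ^ l == b)%N.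

Arguments block (l a b)%_N z.

Fixpoint tree (l a b : nat) : seq (nat * nat * nat) :=
  if l is l'.+1 then
    (l, a, b) :: tree l' a.*2 b.*2 ++ tree l' a.*2 b.*2.+1 ++
      tree l' a.*2.+1 b.*2 ++ tree l' a.*2.+1 b.*2.+1
  else nseq c.+1 (0%N, a, b).

(* [tree] with each edge replaced by [K] consecutive copies, for the [K] small
   Rademacher steps of the Lindeberg argument. *)
Fixpoint fat_tree (K l a b : nat) : seq (nat * nat * nat) :=
  if l is l'.+1 then
    nseq K (l, a, b) ++ fat_tree K l' a.*2 b.*2 ++ fat_tree K l' a.*2 b.*2.+1 ++
      fat_tree K l' a.*2.+1 b.*2 ++ fat_tree K l' a.*2.+1 b.*2.+1
  else flatten (nseq c.+1 (nseq K (0%N, a, b))).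

Arguments fat_tree (K l a b)%_N.

Lemma count_flatten_nseq (T : Type) (p : pred T) K s :
  count p (flatten (nseq K s)) = (K * count p s)%N.
Proof. by elim: K => //= K IH; rewrite count_cat IH mulSn. Qed.

Lemma perm_fat_tree K l a b : perm_eq (flatten (nseq K (tree l a b))) (fat_tree K l a b).
Proof.
apply/permP => p; rewrite count_flatten_nseq.
elim: l a b => [|l IH] a b /=.
  by rewrite -/(nseq c.+1 (0%N, a, b)) -/(nseq c.+1 (nseq K (0%N, a, b))) count_cat
    count_flatten_nseq !count_nseq; lia.
rewrite [in LHS]count_cat [in LHS]count_cat [in LHS]count_cat !count_cat -!IH count_nseq.
by rewrite !mulnDr [(p _ * K)%N]mulnC.
Qed.

Lemma block_child l a b z i j : (i < 2)%N -> (j < 2)%N ->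
  block l (a.*2 + i) (b.*2 + j) z -> block l.+1 a b z.
Proof.
rewrite /block expnSr !divnMA => i2 j2 /andP[/eqP-> /eqP->].
by apply/andP; split; apply/eqP; lia.
Qed.

Lemma block_split l a b z : block l.+1 a b z ->
  [|| block l a.*2 b.*2 z, block l a.*2 b.*2.+1 z, block l a.*2.+1 b.*2 z
    | block l a.*2.+1 b.*2.+1 z].
Proof.
rewrite /block expnSr !divnMA; move: (_ %/ 2 ^ l)%N (_ %/ 2 ^ l)%N => p q.
by move=> /andP[/eqP <- /eqP <-]; lia.
Qed.

Lemma fat_tree_block K l a b u z : u \in fat_tree K l a b ->
  block u.1.1 u.1.2 u.2 z -> block l a b z.
Proof.
elim: l a b => [|l IH] a b /=.
  rewrite mem_cat => /orP[/nseqP[-> _]//|/flattenP[s]].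
  by move=> /nseqP[-> _] /nseqP[-> _].
rewrite !mem_cat => uT uz; case/or4P: uT => [/nseqP[uE _]|h|h|/orP[h|h]].
- by rewrite uE in uz.
- by apply: (@block_child l a b z 0 0) => //; apply: IH uz; rewrite !addn0.
- by apply: (@block_child l a b z 0 1) => //; apply: IH uz; rewrite addn0 addn1.
- by apply: (@block_child l a b z 1 0) => //; apply: IH uz; rewrite addn0 addn1.
- by apply: (@block_child l a b z 1 1) => //; apply: IH uz; rewrite !addn1.
Qed.

Variables (s h : R) (K : nat).
Hypotheses (s0 : 0 < s) (h0 : 0 < h).

Definition node_vec u z : R := s * h * (block u.1.1 u.1.2 u.2 z)%:R.

(** Levels are in units of [s], so that an edge made of [K] steps of size [s * h] has variance one
    when [h ^+ 2 = 1 / K]. *)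
Definition reaches (B : pred (V N)) (t : R) (x : V N -> R) : R :=
  [exists z, B z && (s * t <= x z)]%:R.

Lemma reaches_depends B t : depends_on B (reaches B t).
Proof.
move=> x y xy; rewrite /reaches; congr (_%:R); congr nat_of_bool.
by apply: eq_existsb => z; case: (boolP (B z)) => //= Bz; rewrite xy.
Qed.

Lemma reaches_le1 B t x : reaches B t x <= 1.
Proof. by rewrite /reaches; case: [exists _, _]. Qed.

Lemma reaches_ge0 B t x : 0 <= reaches B t x.
Proof. exact: ler0n. Qed.

(** All points of a block move together along its edge, so each sign is one heat step in the height
    [t - d] still to be climbed. *)
Lemma ravg_nseq_block l a b k t F g :
  (forall x d, (forall z, block l a b z -> x z = s * d) -> F x <= g (t - d)) ->
  forall x d, (forall z, block l a b z -> x z = s * d) ->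
  ravg (map node_vec (nseq k (l, a, b))) F x <= iter k (heat h) g (t - d).
Proof.
move=> Fg; elim: k => [|k IH] x d xd /=; first exact: Fg.
rewrite ler_pM2r ?invr_gt0// lerD//.
  have -> : t - d - h = t - (d + h) by ring.
  by apply: IH => z zB; rewrite /node_vec/= zB xd// mulr1 mulrDr.
have -> : t - d + h = t - (d - h) by ring.
by apply: IH => z zB; rewrite /node_vec/= zB xd// mulr1 mulrBr.
Qed.

Lemma le_branch (g : R -> R) y r : 0 <= g y -> r <= 1 -> r <= 4 * g y -> r <= branch g y.
Proof. by move=> *; rewrite le_min; apply/andP. Qed.

Definition start (y : R) : R := (y <= 0)%R%:R.

(* Union bound over the four subtrees at every branching. *)
Lemma fat_tree_reaches l a b t x d : (forall z, block l a b z -> x z = s * d) ->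
  ravg (map node_vec (fat_tree K l a b)) (reaches (block l a b) t) x <=
  iter (l + c.+1) (level K h) start (t - d).
Proof.
have le1 w B y : ravg w (reaches B t) y <= 1.
  by rewrite -[leRHS](ravg_cst w 1 y); apply: ravg_le => ?; exact: reaches_le1.
elim: l a b x d => [|l IH] a b x d xd.
  (* Each copy of a leaf edge is counted as a full level; the factor 4 in [branch] only enlarges the
     bound there. *)
  rewrite add0n /fat_tree; elim: c.+1 x d xd => [|j IH] x d xd /=.
    rewrite /reaches /start; case: existsP => // -[z /andP[zB]].
    by rewrite xd// ler_pM2l// -subr_le0 => ->.
  rewrite map_cat ravg_cat; apply: ravg_nseq_block => // y e ye.
  have := IH y e ye; set r := ravg _ _ _ => rl.
  have r0 : 0 <= r by apply: ravg_ge0 => ?; exact: reaches_ge0.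
  apply: le_branch; rewrite ?le1 ?(le_trans r0 rl)//; apply: (le_trans rl).
  by rewrite ler_peMl ?(le_trans r0 rl)// ler1n.
rewrite /= map_cat ravg_cat; apply: ravg_nseq_block xd => {x d} y e ye.
set u := iter (l + c.+1) _ _.
pose f i j : (V N -> R) -> R := reaches (block l (a.*2 + i) (b.*2 + j)) t.
pose T i j := map node_vec (fat_tree K l (a.*2 + i) (b.*2 + j)).
have fT i j : (i < 2)%N -> (j < 2)%N -> ravg (T i j) (f i j) y <= u (t - e).
  by move=> i2 j2; apply: IH => z zB; apply: ye; exact: block_child zB.
(* Distinct children are disjoint blocks, so the vectors of one vanish on the other. *)
have skip i j i' j' : (i, j) != (i', j') -> (i < 2)%N -> (j < 2)%N -> (i' < 2)%N -> (j' < 2)%N ->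
    forall G, depends_on (block l (a.*2 + i) (b.*2 + j)) G -> ravg (T i' j') G = G.
  move=> ij i2 j2 i'2 j'2 G GB; apply: ravg_id GB _ => v z vT /andP[/eqP B1 /eqP B2].
  rewrite /node_vec; case: (boolP (block _ _ _ _)) => [|_]; last by rewrite mulr0.
  move=> /(fat_tree_block vT) /andP[/eqP B1' /eqP B2'].
  by case/negP: ij; rewrite xpair_eqE; apply/andP; split; apply/eqP;
    move: B1 B2 B1' B2' => -> -> /addnI + /addnI.
have fd i j : depends_on (block l (a.*2 + i) (b.*2 + j)) (f i j) by exact: reaches_depends.
have fd' i j w : depends_on (block l (a.*2 + i) (b.*2 + j)) (ravg w (f i j)).
  exact: depends_on_ravg.
have E : map node_vec (fat_tree K l a.*2 b.*2 ++ fat_tree K l a.*2 b.*2.+1 ++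
      fat_tree K l a.*2.+1 b.*2 ++ fat_tree K l a.*2.+1 b.*2.+1) =
    T 0 0 ++ T 0 1 ++ T 1 0 ++ T 1 1.
  by rewrite !map_cat /T !addn0 !addn1.
rewrite E; set TT := T 0 0 ++ _.
have e00 : ravg TT (f 0 0)%N = ravg (T 0 0)%N (f 0 0)%N.
  by rewrite /TT !ravg_cat (skip 0 0 1 1)%N ?(skip 0 0 1 0)%N ?(skip 0 0 0 1)%N.
have e01 : ravg TT (f 0 1)%N = ravg (T 0 1)%N (f 0 1)%N.
  by rewrite /TT !ravg_cat (skip 0 1 1 1)%N ?(skip 0 1 1 0)%N ?(skip 0 1 0 0)%N.
have e10 : ravg TT (f 1 0)%N = ravg (T 1 0)%N (f 1 0)%N.
  by rewrite /TT !ravg_cat (skip 1 0 1 1)%N ?(skip 1 0 0 1)%N ?(skip 1 0 0 0)%N.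
have e11 : ravg TT (f 1 1)%N = ravg (T 1 1)%N (f 1 1)%N.
  by rewrite /TT !ravg_cat (skip 1 1 1 0)%N ?(skip 1 1 0 1)%N ?(skip 1 1 0 0)%N.
have u0 : 0 <= u (t - e).
  by apply: le_trans (fT 0 0 isT isT)%N; apply: ravg_ge0 => ?; exact: reaches_ge0.
apply: le_branch => //.
(* The event for a block is the union of those for its four children. *)
apply: (@le_trans _ _ (ravg TT (fun x => f 0%N 0%N x + (f 0%N 1%N x + (f 1%N 0%N x + f 1%N 1%N
  x))) y)).
  apply: ravg_le => x; rewrite {1}/reaches; case: existsP => [[z /andP[zB zx]]|_]; last first.
    by rewrite !addr_ge0 ?reaches_ge0.
  have hit i j : block l (a.*2 + i) (b.*2 + j) z -> f i j x = 1.
    by move=> B; rewrite /f /reaches; case: existsP => // -[]; exists z; rewrite B.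
  have f0 i j : 0 <= f i j x by exact: reaches_ge0.
  move: (f0 0 0)%N (f0 0 1)%N (f0 1 0)%N (f0 1 1)%N.
  have := block_split zB; rewrite -[a.*2.+1]addn1 -[b.*2.+1]addn1 -{1 2}[a.*2]addn0.
  rewrite -{1 3}[b.*2]addn0.
  move: (@hit 0%N 0%N) (@hit 0%N 1%N) (@hit 1%N 0%N) (@hit 1%N 1%N).
  move: (f 0%N 0%N x) (f 0%N 1%N x) (f 1%N 0%N x) (f 1%N 1%N x) => v1 v2 v3 v4 h1 h2 h3 h4.
  have -> : true%:R = 1 :> R by [].
  by case/or4P => [/h1|/h2|/h3|/h4] -> *; lra.
rewrite !ravgD e00 e01 e10 e11.
move: (fT 0 0 isT isT)%N (fT 0 1 isT isT)%N (fT 1 0 isT isT)%N (fT 1 1 isT isT)%N.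
move: (ravg _ _ _) (ravg _ _ _) (ravg _ _ _) (ravg _ _ _) => *; lra.
Qed.

End dyadic_tree.

Arguments block {N} (l a b)%_N z.
Arguments tree (c l a b)%_N.
Arguments fat_tree (c K l a b)%_N.

(** * Increment variances on the dyadic tree *)

Lemma dist_same_quotient (p q M : nat) : (0 < M)%N -> (p %/ M = q %/ M)%N -> (`|p - q| < M)%N.
Proof.
move=> M0 e; have := divn_eq p M; have := divn_eq q M; rewrite e.
have := ltn_pmod p M0; have := ltn_pmod q M0; clear.
by move: (q %/ M * M)%N (p %% M)%N (q %% M)%N => A r1 r2; lia.
Qed.

Section tree_increments.
Context (N c : nat).
Implicit Types (z : V N).

Definition separated l (x y : V N) : bool :=
  (x.1 %/ 2 ^ l != y.1 %/ 2 ^ l)%N || (x.2 %/ 2 ^ l != y.2 %/ 2 ^ l)%N.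

Definition splits (x y : V N) (u : nat * nat * nat) : bool :=
  block u.1.1 u.1.2 u.2 x != block u.1.1 u.1.2 u.2 y.

Lemma splitsC x y : splits x y =1 splits y x.
Proof. by move=> u; rewrite /splits eq_sym. Qed.

Lemma block_notin_child l a b i j z : (i < 2)%N -> (j < 2)%N -> ~~ block l.+1 a b z ->
  ~~ block l (a.*2 + i) (b.*2 + j) z.
Proof. by move=> i2 j2; apply: contra; exact: block_child. Qed.

Lemma block_childP l a b z : block l.+1 a b z -> exists i j, [/\ (i < 2)%N, (j < 2)%N &
  block l (a.*2 + i) (b.*2 + j) z].
Proof.
move=> /block_split; rewrite -[a.*2.+1]addn1 -[b.*2.+1]addn1 -{1 2}[a.*2]addn0 -{1 3}[b.*2]addn0.
by case/or4P; [exists 0%N, 0%N|exists 0%N, 1%N|exists 1%N, 0%N|exists 1%N, 1%N].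
Qed.

Lemma block_unique l a b a' b' z : block l a b z -> block l a' b' z -> (a, b) = (a', b').
Proof. by move=> /andP[/eqP <- /eqP <-] /andP[/eqP <- /eqP <-]. Qed.

(** Every edge on the branch down to [x] contains [x] but not [y]: [l] inner edges and [c.+1] copies
    of the leaf edge. *)
Lemma count_splits_one l a b x y : block l a b x -> ~~ block l a b y ->
  (l + c.+1 <= count (splits x y) (tree c l a b))%N.
Proof.
elim: l a b => [|l IH] a b xB yB.
  rewrite (_ : tree c 0 a b = nseq c.+1 (0%N, a, b))// count_nseq.
  by rewrite /splits xB (negbTE yB) mul1n.
rewrite /= !count_cat {1}/splits /= xB (negbTE yB) addSn add1n ltnS.
have H i j : (i < 2)%N -> (j < 2)%N -> block l (a.*2 + i) (b.*2 + j) x ->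
    (l + c.+1 <= count (splits x y) (tree c l (a.*2 + i) (b.*2 + j)))%N.
  by move=> i2 j2 xc; apply: IH => //; exact: block_notin_child.
have [i [j [i2 j2 xc]]] := block_childP xB.
have := H _ _ i2 j2 xc.
by case: i i2 {xc} => [|[|//]] _; case: j j2 => [|[|//]] _; rewrite ?addn0 ?addn1; lia.
Qed.

(** Below the last square containing both points the branches to [x] and [y] are disjoint, and
    separation at level [L] makes each at least [L + c.+1] long. *)
Lemma count_splits l a b x y L : block l a b x -> block l a b y -> separated L x y ->
  (2 * (L + c.+1) <= count (splits x y) (tree c l a b))%N.
Proof.
elim: l a b => [|l IH] a b xB yB sep.
  exfalso; move: sep xB yB; rewrite /separated /block !divn1.
  by move=> /orP[]/eqP h /andP[/eqP h1 /eqP h2] /andP[/eqP h3 /eqP h4]; apply: h;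
    rewrite ?h1 ?h2 ?h3 ?h4.
have Ll : (L <= l)%N.
  rewrite leqNgt; apply/negP => lL; move: sep xB yB; rewrite /separated /block.
  rewrite -(subnKC lL) expnD !divnMA.
  by move=> /orP[]/eqP h /andP[/eqP h1 /eqP h2] /andP[/eqP h3 /eqP h4]; apply: h;
    rewrite ?h1 ?h2 ?h3 ?h4.
have H i j : block l i j x -> ~~ block l i j y ->
    (l + c.+1 <= count (splits x y) (tree c l i j))%N by exact: count_splits_one.
have H' i j : block l i j y -> ~~ block l i j x ->
    (l + c.+1 <= count (splits x y) (tree c l i j))%N.
  by move=> h1 h2; rewrite (eq_count (splitsC x y)); exact: count_splits_one.
have [i [j [i2 j2 xc]]] := block_childP xB; have [i' [j' [i'2 j'2 yc]]] := block_childP yB.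
rewrite /= !count_cat; apply: leq_trans (leq_addl _ _).
have [[ei ej]|ne] := eqVneq (i, j) (i', j').
  have := IH _ _ xc; rewrite ei ej => /(_ yc sep).
  case: i' i'2 {yc ei} => [|[|//]] _; case: j' j'2 {ej} => [|[|//]] _; rewrite ?addn0 ?addn1; lia.
have ne2 : (a.*2 + i, b.*2 + j)%N <> (a.*2 + i', b.*2 + j')%N.
  by move=> [] /addnI ei /addnI ej; case/eqP: ne; rewrite ei ej.
have yn : ~~ block l (a.*2 + i) (b.*2 + j) y.
  by apply/negP => /block_unique/(_ yc)/ne2.
have xn : ~~ block l (a.*2 + i') (b.*2 + j') x.
  by apply/negP => /(block_unique xc)/ne2.
have h1 := H _ _ xc yn; have h2 := H' _ _ yc xn; move: ne h1 h2; clear ne2.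
case: i i2 {xc yn} => [|[|//]] _; case: j j2 => [|[|//]] _;
case: i' i'2 {yc xn} => [|[|//]] _; case: j' j'2 => [|[|//]] _;
  rewrite ?addn0 ?addn1 ?eqxx//= => _; lia.
Qed.

Definition sup_dist (x y : V N) : nat := maxn `|x.1 - y.1|%N `|x.2 - y.2|%N.

Lemma sup_dist_gt0 x y : x != y -> (0 < sup_dist x y)%N.
Proof.
rewrite lt0n /sup_dist; apply: contra => /eqP h; apply/eqP.
have h1 : `|x.1 - y.1|%N = 0%N by lia.
have h2 : `|x.2 - y.2|%N = 0%N by lia.
case: x y h h1 h2 => [x1 x2] [y1 y2] /= _ h1 h2.
congr pair; apply/val_inj => /=; lia.
Qed.

Lemma separated_dist l x y : (2 ^ l <= sup_dist x y)%N -> separated l x y.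
Proof.
move=> ld; rewrite /separated -negb_and; apply: contraL ld => /andP[/eqP e1 /eqP e2].
have P : (0 < 2 ^ l)%N by rewrite expn_gt0.
by rewrite -ltnNge gtn_max !dist_same_quotient.
Qed.

End tree_increments.

Section tree_variance.
Context (R : realType) (N c : nat) (s h : R).

Lemma tree_increment_var l (x y : V N) :
  increment_var (list_cov (map (node_vec s h) (tree c l 0 0))) x y =
  (s * h) ^+ 2 * (count (splits x y) (tree c l 0 0))%:R.
Proof.
rewrite /increment_var /list_cov !big_map -big_split/= mulr_sumr -sumrB.
rewrite -sum1_count natr_sum mulr_sumr [in RHS]big_mkcond/=; apply: eq_bigr => u _.
by rewrite /node_vec /splits; case: block; case: block => /=; ring.
Qed.

Lemma tree_increment_var_ge n L (x y : V N) : N = (2 ^ n)%N -> (2 ^ L <= sup_dist x y)%N ->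
  (s * h) ^+ 2 * (2 * (L + c.+1))%:R <=
  increment_var (list_cov (map (node_vec s h) (tree c n 0 0))) x y.
Proof.
move=> NE Ld; rewrite tree_increment_var ler_wpM2l ?sqr_ge0// ler_nat.
have root (z : V N) : block n 0 0 z.
  by rewrite /block !divn_small// -[X in (_ < X)%N]NE.
by apply: count_splits => //; exact: separated_dist.
Qed.

End tree_variance.

(** * Expected smoothed maximum of a field dominated by the tree *)

Lemma le_layer_cake (R : realType) (v y0 : R) (m : nat) : v <= y0 + m%:R ->
  v <= y0 + \sum_(k < m) (y0 + k%:R <= v)%R%:R.
Proof.
elim: m => [|m IH] vm; first by rewrite big_ord0 in vm *.
rewrite big_ord_recr /=; have [vm'|vm'] := leP v (y0 + m%:R).
  by rewrite addrA ler_wpDr// IH.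
rewrite (ltW vm') [true%:R]/(1%:R) (le_trans vm)// lerD2l -natr1 lerD2r.
have -> : \sum_(k < m) (y0 + k%:R <= v)%R%:R = \sum_(k < m) 1 :> R.
  apply: eq_bigr => k _; rewrite (le_trans _ (ltW vm'))// lerD2l ler_nat; exact: ltnW.
by rewrite sumr_const card_ord.
Qed.

Section expected_lse.
Context (R : realType) d (T : measurableType d) (P : probability T R) (n c : nat).
Let N := (2 ^ n)%N.
Variable (X : V N -> T -> R).
Hypotheses (mX : forall i, measurable_fun setT (X i))
  (gX : forall a : V N -> R, exists m s : R, 0 <= s /\ forall B : set R, measurable B ->
    P ((fun t => \sum_i a i * X i t) @^-1` B) = gaussian_law m s B)
  (EX : forall i, \int[P]_t X i t = 0).

Let cX i j := \int[P]_t (X i t * X j t).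

Let cardV : (0 < #|V N|)%N.
Proof. by rewrite card_prod card_ord muln_gt0 expn_gt0. Qed.

Let s : R := Num.sqrt (2 / pi * ln 2).
Let lam : R := Num.sqrt (2 * ln 4).
Let kap : R := 3 / 2 / lam.
Let J := (n + c.+1)%N.

Variable C0 : R.
Hypotheses (hC0 : C0 <= 2 * s ^+ 2 * c%:R)
  (hX : forall x y : V N, x != y -> increment_var cX x y <= 4 / pi * ln (sup_dist x y)%:R + C0).

Let ln2 : 0 < ln 2 :> R. Proof. by rewrite ln_gt0// ltr1n. Qed.

Let s0 : 0 < s.
Proof. by rewrite sqrtr_gt0 mulr_gt0// divr_gt0// pi_gt0. Qed.

Let s2 : s ^+ 2 = 2 / pi * ln 2.
Proof. by rewrite sqr_sqrtr// mulr_ge0 ?(ltW ln2)// divr_ge0// pi_ge0. Qed.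

Let lam0 : 0 < lam.
Proof. by rewrite sqrtr_gt0 mulr_gt0// ln_gt0// ltr1n. Qed.

Let kap0 : 0 < kap. Proof. by rewrite !divr_gt0. Qed.

Let lam2 : lam ^+ 2 = 2 * ln 4.
Proof. by rewrite sqr_sqrtr// mulr_ge0// ln_ge0// ler1n. Qed.

Let lamkap : lam * kap = 3 / 2.
Proof. by rewrite /kap; field; rewrite gt_eqF. Qed.

Let vs (K : nat) := map (node_vec s (Num.sqrt K%:R^-1)) (tree c n 0 0) : seq (V N -> R).

(** With [L] the integer part of the binary logarithm of the distance, [ln] of the distance is at
    most [L.+1 * ln 2]. The tree offers [2 * s ^+ 2 * (L + c.+1)]: one leaf copy absorbs the
    rounding of the logarithm, the other [c] absorb [C0]. *)
Lemma tree_dominates (K : nat) : (0 < K)%N -> forall x y,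
  K%:R^-1 * increment_var cX x y <= increment_var (list_cov (vs K)) x y.
Proof.
move=> K0 x y; have K0' : 0 < K%:R^-1 :> R by rewrite invr_gt0 ltr0n.
have [<-|xy] := eqVneq x y.
  have z f : increment_var f x x = 0 :> R by rewrite /increment_var; ring.
  by rewrite !z mulr0.
have d0 := sup_dist_gt0 xy.
pose L := trunc_log 2 (sup_dist x y).
have /andP[L1 L2] : (2 ^ L <= sup_dist x y < 2 ^ L.+1)%N by apply: trunc_log_bounds.
apply: le_trans (tree_increment_var_ge c s (Num.sqrt K%:R^-1) erefl L1).
have hK : Num.sqrt K%:R^-1 ^+ 2 = K%:R^-1 :> R by rewrite sqr_sqrtr// ltW.
rewrite exprMn hK [s ^+ 2 * _]mulrC -mulrA ler_pM2l//.
apply: (le_trans (hX xy)).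
have dl : ln (sup_dist x y)%:R <= L.+1%:R * ln 2 :> R.
  rewrite mulr_natl -lnXn// ler_ln ?posrE ?ltr0n ?exprn_gt0// -natrX ler_nat; exact: ltnW.
apply: (@le_trans _ _ (4 / pi * (L.+1%:R * ln 2) + 2 * s ^+ 2 * c%:R)).
  by rewrite lerD// ler_pM2l// divr_gt0// pi_gt0.
rewrite s2 natrM natrD -[in leRHS]natr1 -natr1.
move: (pi) (pi_gt0 R) (ln 2) => p p0 q.
by rewrite le_eqVlt; apply/orP; left; apply/eqP; field; rewrite gt_eqF.
Qed.

Let y0 : R := front lam kap J%:R + 2.

Lemma expected_reaches (K : nat) (k : nat) : (4 <= K)%N ->
  64 * drift_error lam kap * K%:R^-1 * Num.sqrt (J%:R + 1) ^+ 5 <= 1 ->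
  iter K (ravg (vs K)) (reaches s (block n 0 0) (y0 + k%:R)) (fun=> 0) <=
  6 * barrier_cst lam * (k.+1%:R^-1 - k.+2%:R^-1).
Proof.
move=> K4 small; have K0 : (0 < K)%N by exact: leq_trans K4.
have h0 : 0 < Num.sqrt K%:R^-1 :> R by rewrite sqrtr_gt0 invr_gt0 ltr0n.
rewrite iter_ravg /vs.
have -> : flatten (nseq K (map (node_vec s (Num.sqrt K%:R^-1)) (tree c n 0 0))) =
    map (node_vec s (Num.sqrt K%:R^-1)) (flatten (nseq K (tree c n 0 0))) :> seq (V N -> R).
  by rewrite map_flatten map_nseq.
rewrite (ravg_perm _ _ _ (perm_fat_tree _ _ _ _ _)).
have := @fat_tree_reaches R N c s (Num.sqrt K%:R^-1) K s0 n 0 0 (y0 + k%:R) (fun=> 0) 0.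
rewrite subr0 => /(_ (fun _ _ => esym (mulr0 s))) /le_trans; apply.
apply: le_trans (iter_level_barrier lam0 kap0 lam2 lamkap K4 small _) _.
rewrite /y0 -addrA -natrD add2n.
by apply: (barrier_tail kap lam0 lam2 (ln4_ge1 R)).
Qed.

(** [C] may depend on [n], the field and [b]; only its independence of [K] matters, as [K] is chosen
    last. *)
Lemma lindeberg_error_le (b : R) : exists2 C : R, 0 <= C & forall K : nat, (0 < K)%N ->
  K%:R * lindeberg_error P X b K%:R^-1 (vs K) <= C * Num.sqrt K%:R^-1.
Proof.
pose S := \sum_i \int[P]_t (`|X i t| ^+ 3).
pose z := (size (tree c n 0 0))%:R : R.
have S0 : 0 <= S by apply: sumr_ge0 => i _; apply: Rintegral_ge0 => t _; rewrite exprn_ge0.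
have z0 : 0 <= z by exact: ler0n.
have b0 : 0 <= 200 * b ^+ 2 by rewrite mulr_ge0 ?sqr_ge0.
exists (200 * b ^+ 2 * (S + #|V N|%:R * (s * z) ^+ 3)).
  by rewrite mulr_ge0// addr_ge0// mulr_ge0// exprn_ge0// mulr_ge0// ltW.
move=> K K0; set h := Num.sqrt _.
have h0 : 0 <= h by exact: sqrtr_ge0.
have Kh : K%:R * h ^+ 2 = 1.
  by rewrite sqr_sqrtr ?invr_ge0// divff// gt_eqF// ltr0n.
have -> : 200 * b ^+ 2 * (S + #|V N|%:R * (s * z) ^+ 3) * h =
  K%:R * (200 * b ^+ 2 * (h ^+ 3 * S + #|V N|%:R * (s * h * z) ^+ 3)).
  move: (#|V N|%:R : R) Kh => v Kh.
  transitivity (K%:R * h ^+ 2 * (200 * b ^+ 2 * (S + v * (s * z) ^+ 3) * h)); last by ring.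
  by rewrite Kh mul1r.
rewrite ler_pM2l ?ltr0n// /lindeberg_error -/h -/S ler_wpM2l// lerD2l.
apply: (@le_trans _ _ (\sum_(i : V N) (s * h * z) ^+ 3)); last first.
  by rewrite sumr_const mulr_natl.
apply: ler_sum => i _; rewrite lerXn2r ?nnegrE ?mulr_ge0 ?(ltW s0) ?sumr_ge0//.
rewrite /vs big_map /z; apply: (@le_trans _ _ (\sum_(u <- tree c n 0 0) s * h)).
  apply: ler_sum => u _; rewrite /node_vec -/h ger0_norm ?mulr_ge0 ?(ltW s0)//.
  by rewrite ler_piMr ?mulr_ge0 ?(ltW s0)//; case: block.
by rewrite big_const_seq count_predT iter_addr_0 mulr_natr.
Qed.

(** Integer layers above [y0]: the probabilities of reaching them are bounded by telescoping
    differences, whose sum is at most one before the constant. *)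
Lemma ravg_lse_le (b : R) (K : nat) : 0 < b -> (4 <= K)%N ->
  64 * drift_error lam kap * K%:R^-1 * Num.sqrt (J%:R + 1) ^+ 5 <= 1 ->
  iter K (ravg (vs K)) (lse b) (fun=> 0) <=
  s * (y0 + 6 * barrier_cst lam) + ln #|V N|%:R / b.
Proof.
move=> b0 K4 small.
pose ws := flatten (nseq K (vs K)).
pose tot := \sum_i \sum_(v <- ws) `|v i|.
have tot0 : 0 <= tot by apply: sumr_ge0 => i _; exact: sumr_ge0.
(* Signed sums stay below height [y0 + m], so [m] layers exhaust the maximum. *)
pose m := Num.bound (`|y0| + tot / s).
have hm : `|y0| + tot / s <= m%:R by apply/ltW/archi_boundP; rewrite addr_ge0// divr_ge0// ltW.
rewrite iter_ravg -/ws.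
pose f k := reaches s (block n 0 0) (y0 + k%:R) : (V N -> R) -> R.
apply: (@le_trans _ _ (ravg ws (fun y => (s * y0 + ln #|V N|%:R / b) + s * \sum_(k < m) f k y)
  (fun=> 0))).
  apply: ravg_le_reach => y hy; rewrite addrAC; apply: lse_le => // i.
  rewrite -mulrDr mulrC -ler_pdivrMr//.
  have vm : y i / s <= y0 + m%:R.
    rewrite -lerBlDl; apply: le_trans hm; rewrite addrC lerD//.
      by rewrite -normrN ler_norm.
    rewrite ler_pM2r ?invr_gt0//; have := hy i; rewrite subr0 => h.
    apply: (le_trans (ler_norm _)); apply: (le_trans h).
    rewrite /tot (bigD1 i)//= lerDl sumr_ge0// => j _; exact: sumr_ge0.
  apply: (le_trans (le_layer_cake vm)); rewrite lerD2l; apply: ler_sum => k _.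
  have [h|//] := leP (y0 + k%:R) (y i / s).
  rewrite /f /reaches; case: existsP => // -[]; exists i.
  rewrite ler_pdivlMr// mulrC in h; rewrite h andbT /block !divn_small//; exact: ltn_ord.
rewrite ravgD ravg_cst ravgZ ravg_sum (mulrDr s y0) [leRHS]addrAC lerD2l.
rewrite ler_pM2l//.
apply: (@le_trans _ _ (\sum_(k < m) 6 * barrier_cst lam * (k.+1%:R^-1 - k.+2%:R^-1))).
  by apply: ler_sum => k _; rewrite /ws -iter_ravg; exact: expected_reaches.
rewrite -mulr_sumr ler_piMr ?mulr_ge0 ?expR_ge0//.
have -> : \sum_(k < m) (k.+1%:R^-1 - k.+2%:R^-1) = 1 - m.+1%:R^-1 :> R.
  elim: (m) => [|p IH]; first by rewrite big_ord0 invr1 subrr.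
  by rewrite big_ord_recr/= IH; ring.
by rewrite gerBl.
Qed.

(** This [b] makes the smoothing cost at most one. [K] is then taken large enough for heat steps of
    size at most [1 / 2], for the drift error over [J] levels, and for a total Lindeberg error at
    most one; hence the final [2]. *)
Lemma expected_lse_le : \int[P]_t lse (ln #|V N|%:R + 1) (X ^~ t) <=
  s * (y0 + 6 * barrier_cst lam) + 2.
Proof.
set b := ln _ + 1.
have l0 : 0 <= ln #|V N|%:R :> R by rewrite ln_ge0// ler1n.
have b0 : 0 < b by rewrite ltr_wpDl.
have [C C_ge0 hC] := lindeberg_error_le b.
pose A := 64 * drift_error lam kap * Num.sqrt (J%:R + 1) ^+ 5.
have A0 : 0 <= A by rewrite !mulr_ge0 ?exprn_ge0 ?sqrtr_ge0// ltW// drift_error_gt0.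
pose K := (4 + Num.bound A + Num.bound (C ^+ 2))%N.
have K4 : (4 <= K)%N by rewrite /K -addnA leq_addr.
have K0 : (0 < K)%N by [].
have K0' : 0 < K%:R :> R by rewrite ltr0n.
have KA : A <= K%:R.
  by apply: (le_trans (ltW (archi_boundP A0))); rewrite ler_nat /K addnAC leq_addl.
have KC : C ^+ 2 <= K%:R.
  by apply: (le_trans (ltW (archi_boundP (sqr_ge0 C)))); rewrite ler_nat /K leq_addl.
have small : 64 * drift_error lam kap * K%:R^-1 * Num.sqrt (J%:R + 1) ^+ 5 <= 1.
  by rewrite mulrAC -/A ler_pdivrMr// mul1r.
have := gaussian_le_iter mX gX EX cardV b0 K0 (tree_dominates K0).
move=> /le_trans; apply.
have := ravg_lse_le b0 K4 small.
have e1 : ln #|V N|%:R / b <= 1 by rewrite ler_pdivrMr// mul1r /b lerDl.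
have e2 : C * Num.sqrt K%:R^-1 <= 1.
  rewrite -(@ler_pXn2r _ 2) ?nnegrE ?mulr_ge0 ?sqrtr_ge0// exprMn sqr_sqrtr ?invr_ge0 ?(ltW K0')//.
  by rewrite expr1n ler_pdivrMr// mul1r.
have := hC K K0; move: e1 e2; rewrite -/b.
move: (iter K _ _ _) (K%:R * lindeberg_error _ _ _ _ _) (ln _ / b) (C * _) (s * _) => *; lra.
Qed.

End expected_lse.

(** * The law of the simple random walk *)

Lemma set_iotaP n j : [set` iota 0 n] j <-> (j < n)%N.
Proof. by split; rewrite /= mem_iota. Qed.

Section walk_law.
Context d (W : measurableType d) (R : realType) (P : probability W R).
Variables (x : Z2) (w : nat -> W -> Z2).
Hypothesis srw : simple_random_walk P x w.

Let mw m (A : set Z2) : measurable (w m @^-1` A). Proof. by case: srw. Qed.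

Lemma measurable_increment m (A : set Z2) : measurable (increment w m @^-1` A).
Proof.
have -> : increment w m @^-1` A =
    \bigcup_z (w m @^-1` [set z] `&` w m.+1 @^-1` [set y | A (y - z)]).
  apply/seteqP; split => [t /= At|t [z _ /= [<-]]//].
  by exists (w m t).
apply: countable_bigcupT_measurable; first exact: countableP.
by move=> z; apply: measurableI.
Qed.

Lemma prob1_setI (A B : set W) : measurable A -> measurable B -> P A = 1%E -> P (A `&` B) = P B.
Proof.
move=> mA mB PA; apply/eqP; rewrite eq_le; apply/andP; split.
  by rewrite le_measure ?inE//; exact: measurableI.
have : P B = (P (A `&` B) + P (B `\` A))%E.
  rewrite -measureU//; [|exact: measurableI|exact: measurableD|].
    by rewrite setIC setUIDK.
  by apply/seteqP; split => // t [[? ?] []].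
move=> ->; rewrite [X in (_ + X)%E](_ : _ = 0%E) ?adde0//.
apply/eqP; rewrite eq_le measure_ge0 andbT.
have : P (~` A) = 0%E by rewrite probability_setC// PA subee.
move=> <-; apply: le_measure; rewrite ?inE; [exact: measurableD|exact: measurableC|by move=> t []].
Qed.

Lemma split_increments (C : set W) i (s : seq Z2) : measurable C -> uniq s ->
  P C = (\sum_(e <- s) P (C `&` increment w i @^-1` [set e]) +
    P (C `&` increment w i @^-1` [set e | e \notin s]))%E.
Proof.
move=> mC; elim: s => [_|e s IH /andP[es us]].
  rewrite big_nil add0e; congr (P _); apply/seteqP; split => [t Ct|t []//].
  by split.
rewrite IH// big_cons -addeA [RHS]addeCA; congr (_ + _)%E; rewrite [RHS]addeC -measureU.
- congr (P _); apply/seteqP; split => [t [Ct /= ts]|t [[Ct /= te]|[Ct /= te]]].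
  + have [te|te] := eqVneq (increment w i t) e; first by right.
    by left; split => //=; rewrite inE negb_or te.
  + by split => //=; move: te; rewrite inE negb_or => /andP[].
  + by split => //=; rewrite te.
- by apply: measurableI => //; exact: measurable_increment.
- by apply: measurableI => //; exact: measurable_increment.
- by apply/seteqP; split => // t [[_ /= te] [_ /= te']]; move: te; rewrite te' mem_head.
Qed.

(** The four unit steps already carry total mass one, so any other increment is a null event. *)
Lemma step_increments (C : set W) i : measurable C ->
  P C = (\sum_(e <- unit_steps) P (C `&` increment w i @^-1` [set e]))%E.
Proof.
move=> mC; have [_ _ law _] := srw.
have us : uniq unit_steps by [].
have null : P (increment w i @^-1` [set e | e \notin unit_steps]) = 0%E.
  have := @split_increments setT i _ measurableT us.
  rewrite probability_setT; under eq_bigr do rewrite setTI.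
  rewrite setTI /unit_steps !big_cons big_nil.
  have L e : e \in unit_steps -> P (increment w i @^-1` [set e]) = (4^-1)%:E.
    by move=> eu; have := law i e; rewrite eu.
  rewrite !L// adde0 -!EFinD => h.
  have : (1%E = 1%:E + P (increment w i @^-1` [set e | e \notin unit_steps]))%E.
    by rewrite {1}h; congr (_%:E + _)%E; field.
  case: (P _) (measure_ge0 P (increment w i @^-1` [set e | e \notin unit_steps])) => [r _||]//.
  by rewrite -EFinD => -[]; rewrite -{1}[1]addr0 => /addrI <-.
rewrite {1}(split_increments i mC us) [X in (_ + X)%E](_ : _ = 0%E) ?adde0//.
apply/eqP; rewrite eq_le measure_ge0 andbT -null.
by rewrite le_measure ?inE//; [apply: measurableI => //|..]; try exact: measurable_increment;
  move=> t [].
Qed.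

Definition path_event (es : seq Z2) : set W :=
  [set t | w 0%N t = x] `&` \bigcap_(m in [set` iota 0 (size es)]) (increment w m @^-1` [set nth
    0 es m]).

Lemma measurable_path_event es : measurable (path_event es).
Proof.
apply: measurableI; first exact: (mw 0 [set x]).
by apply: fin_bigcap_measurable => // m _; exact: measurable_increment.
Qed.

Lemma prob_path_event es : all (mem unit_steps) es -> P (path_event es) = (4^-1 ^+ size es)%:E.
Proof.
move=> /allP h; have [_ P0 law ind] := srw.
rewrite prob1_setI//; [|exact: (mw 0 [set x])|].
  rewrite ind ?iota_uniq//.
  have -> : (4^-1 ^+ size es)%:E = (\prod_(m <- iota 0 (size es)) (4^-1 : R)%:E)%E.
    suff H k j : (4^-1 ^+ k)%:E = (\prod_(m <- iota j k) (4^-1 : R)%:E)%E by exact: H.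
    elim: k j => [|k IH] j; first by rewrite big_nil expr0.
    by rewrite big_cons -IH exprS EFinM.
  apply: eq_big_seq => m; rewrite mem_iota => /andP[_ ms].
  by have := law m (nth 0 es m); rewrite ifT//; apply: h; exact: mem_nth.
by apply: fin_bigcap_measurable => // m _; exact: measurable_increment.
Qed.

Lemma path_event_position es t : path_event es t -> w (size es) t = x + \sum_(e <- es) e.
Proof.
move=> [/= t0 tm].
suff H k : (k <= size es)%N -> w k t = x + \sum_(e <- take k es) e.
  by have := H _ (leqnn _); rewrite take_size.
elim: k => [_|k IH kn]; first by rewrite take0 big_nil addr0.
have := tm k; move=> /(_ (iffRL (set_iotaP _ _) kn)) /= e.
rewrite (take_nth 0)// big_rcons/= addrA -IH 1?ltnW// -e /increment.
by rewrite addrC subrK.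
Qed.

Variables (S B : pred Z2).

(** The probability that the walk from [z] stays in [S] up to time [m] and is then in [B], written
    as a first-step recursion. *)
Fixpoint stay_kernel (m : nat) (z : Z2) : R :=
  if m is m'.+1 then (S z)%:R * ((\sum_(e <- unit_steps) stay_kernel m' (z + e)) / 4)
  else (S z && B z)%:R.

Definition stay_event (i m : nat) : set W :=
  [set t | (forall j, (j <= m)%N -> S (w (i + j) t)) /\ B (w (i + m) t)].

Lemma measurable_stay_event i m : measurable (stay_event i m).
Proof.
have -> : stay_event i m = (\bigcap_(j in [set` iota 0 m.+1]) w (i + j) @^-1` [set` S]) `&`
    w (i + m) @^-1` [set` B].
  apply/seteqP; split => [t [h1 h2]|t [h1 h2]]; split => //.
    by move=> j /set_iotaP jm; apply: h1.
  by move=> j jm; apply: h1; apply/set_iotaP.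
apply: measurableI => //.
by apply: fin_bigcap_measurable.
Qed.

(** The Markov property without conditioning: the induction on [m] lengthens the prescribed initial
    path by one step, whose four choices are summed. *)
Lemma prob_path_stay m es : all (mem unit_steps) es ->
  P (path_event es `&` stay_event (size es) m) =
  (4^-1 ^+ size es * stay_kernel m (x + \sum_(e <- es) e))%:E.
Proof.
elim: m es => [|m IH] es h /=.
  set z := x + _.
  case: (boolP (S z && B z)) => [/andP[Sz Bz]|nSB].
    rewrite mulr1 -prob_path_event//; congr (P _); apply/seteqP; split => [t []//|t et].
    split => //; split; rewrite ?addn0 ?path_event_position// => j.
    by rewrite leqn0 => /eqP ->; rewrite addn0 path_event_position.
  rewrite mulr0 (_ : _ `&` _ = set0) ?measure0//.
  apply/seteqP; split => // t [et [h1 h2]]; case/negP: nSB.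
  have := h1 0%N isT; rewrite addn0 in h2 *; rewrite !path_event_position// in h2 *.
  by move=> ->.
set z := x + _.
case: (boolP (S z)) => Sz; last first.
  rewrite mul0r mulr0 (_ : _ `&` _ = set0) ?measure0//.
  apply/seteqP; split => // t [et [h1 h2]]; case/negP: Sz.
  by have := h1 0%N isT; rewrite addn0 path_event_position.
rewrite mul1r (@step_increments _ (size es)); last first.
  by apply: measurableI; [exact: measurable_path_event|exact: measurable_stay_event].
rewrite mulr_suml mulr_sumr -sumEFin.
apply: eq_big_seq => e eu.
have hr : all (mem unit_steps) (rcons es e) by rewrite all_rcons/= eu.
have := IH _ hr; rewrite size_rcons big_rcons/= addrA -/z => IHe.
rewrite (_ : _ `&` _ = path_event (rcons es e) `&` stay_event (size es).+1 m).
  by rewrite IHe; congr _%:E; rewrite exprS; field.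
apply/seteqP; split => [t [[[t0 tm] [h1 h2]] te]|t [[t0 tm] [h1 h2]]].
  split; last first.
    split; last by rewrite addSnnS.
    by move=> j jm; rewrite addSnnS; exact: h1.
  split => // k /set_iotaP; rewrite size_rcons ltnS leq_eqVlt => /orP[/eqP ->|kn].
    by rewrite /= nth_rcons ltnn eqxx.
  by rewrite /= nth_rcons kn; apply: tm; apply/set_iotaP.
have pe : path_event es t.
  split => // k /set_iotaP kn.
  by have := tm k; rewrite /= nth_rcons kn; apply; apply/set_iotaP; rewrite size_rcons ltnW.
split; last first.
  by have := tm (size es); rewrite /= nth_rcons ltnn eqxx; apply; apply/set_iotaP;
    rewrite size_rcons.
split => //; split; last by rewrite -addSnnS.
case=> [|j] jm; first by rewrite addn0 path_event_position.
by rewrite -addSnnS; exact: h1.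
Qed.

Lemma prob_stay m : P (stay_event 0 m) = (stay_kernel m x)%:E.
Proof.
have [_ P0 _ _] := srw.
have := @prob_path_stay m [::] isT; rewrite big_nil addr0 expr0 mul1r => <-.
rewrite prob1_setI//; [exact: measurable_path_event|exact: measurable_stay_event|].
by rewrite prob_path_event.
Qed.

Lemma stay_kernel_ge0 m z : 0 <= stay_kernel m z.
Proof.
elim: m z => [|m IH] z /=; first exact: ler0n.
by rewrite mulr_ge0// divr_ge0// sumr_ge0.
Qed.

End walk_law.

(** * Green functions as series and their first-step equation *)

Section green_series.
Context d (W : measurableType d) (R : realType).

Lemma integral_series_indic (P : probability W R) (E : nat -> set W) :
  (forall m, measurable (E m)) ->
  (\int[P]_t \sum_(m <oo) (\1_(E m) t)%:E = \sum_(m <oo) P (E m))%E.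
Proof.
move=> mE; rewrite integral_nneseries//.
  by apply: eq_eseriesr => m _; rewrite integral_indic// setIT.
by move=> m; apply/measurable_EFinP; exact: measurable_indic.
Qed.

Variables (N : nat) (Px : Z2 -> probability W R) (w : nat -> W -> Z2).
Hypothesis srw : forall x, simple_random_walk (Px x) x w.

Definition off_boundary (z : Z2) : bool := ~~ `[< box_boundary N z >].

Lemma lt_hitting_time (t : W) (m : nat) :
  ((m%:R)%:E < hitting_time R (box_boundary N) w t)%E =
  `[< forall j, (j <= m)%N -> off_boundary (w j t) >].
Proof.
apply/idP/asboolP => [h j jm|h].
  apply/negP => /asboolP jb; move: h; rewrite ltNge => /negP; apply.
  apply: (@le_trans _ _ (j%:R)%:E); last by rewrite lee_fin ler_nat.
  by apply: ereal_inf_lbound; exists j.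
apply: (@lt_le_trans _ _ (m.+1%:R)%:E); first by rewrite lte_fin ltr_nat.
apply: le_ereal_inf_tmp => _ [j /= jb <-]; rewrite lee_fin ler_nat ltnNge.
apply/negP => /h /negP; apply; exact/asboolP.
Qed.

Lemma green_box_series (x y : V N) : green_box Px w x y =
  (\sum_(m <oo) (stay_kernel R off_boundary (fun z => z == site y) m (site x))%:E)%E.
Proof.
pose B : pred Z2 := fun z => z == site y.
have mE m := measurable_stay_event (srw (site x)) off_boundary B 0 m.
transitivity (\int[Px (site x)]_t \sum_(m <oo) (\1_(stay_event w off_boundary B 0 m) t)%:E)%E.
  apply: eq_integral => t _; rewrite eseries_mkcond; apply: eq_eseriesr => m _.
  rewrite lt_hitting_time indicE; case: asboolP => h.
    congr (_%:R%:E); congr nat_of_bool; apply/idP/idP; rewrite inE.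
      by move=> Bt; split.
    by case.
  by rewrite memNset// => -[].
rewrite integral_series_indic//; apply: eq_eseriesr => m _.
exact: (prob_stay (srw (site x))).
Qed.

Variables (rate : R) (tau : {mfun W >-> R}).
Hypotheses (rate0 : 0 < rate)
  (tauE : forall x, independent_exponential_time (P := Px x) w rate tau).

Lemma green_torus_series (x y : V N) : green_torus Px w tau x y =
  (\sum_(m <oo) (expR (- rate) ^+ m *
     stay_kernel R predT (fun z => torus_equiv N z (site y)) m (site x))%:E)%E.
Proof.
pose B : pred Z2 := fun z => torus_equiv N z (site y).
have mB m : measurable (w m @^-1` [set` B]) by have [] := srw (site x).
have mT m : measurable (tau @^-1` `[m%:R, +oo[%classic).
  by rewrite -[X in measurable X]setTI; exact: measurable_funP.
transitivity (\int[Px (site x)]_t \sum_(m <oo)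
    (\1_(w m @^-1` [set` B] `&` tau @^-1` `[m%:R, +oo[%classic) t)%:E)%E.
  apply: eq_integral => t _; rewrite eseries_mkcond; apply: eq_eseriesr => m _.
  rewrite indicE; case: ifPn => h.
    congr (_%:R%:E); congr nat_of_bool; apply/idP/idP; rewrite inE.
      by move=> Bt; split => //=; rewrite in_itv/= h.
    by case.
  by rewrite memNset// => -[_ /=]; rewrite in_itv/= andbT; exact/negP.
rewrite integral_series_indic; last by move=> m; exact: measurableI.
apply: eq_eseriesr => m _.
have [law ind] := tauE (site x).
rewrite ind//; last first.
  by apply: sub_gen_smallest; exists m => //; exists [set` B].
have -> : Px (site x) (tau @^-1` `[m%:R, +oo[%classic) = (expR (- rate) ^+ m)%:E.
  by rewrite -[LHS]/(distribution _ tau _) law// exponential_tail// mulrC expRM_natl.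
rewrite muleC EFinM; congr (_ * _)%E.
rewrite -(prob_stay (srw (site x))); congr (Px _ _).
by apply/seteqP; split => [t Bt|t []].
Qed.

End green_series.

Section first_step.
Context (R : realType) (V : finType) (A : (V -> R) -> V -> R) (s1 s2 s3 s4 : V -> V).
Hypothesis AE : forall f x, A f x = (f (s1 x) + f (s2 x) + f (s3 x) + f (s4 x)) / 4.

(** Time zero and the first step are split off. The box has [q = 1] and [D] the sites off the
    boundary; the torus has [q = expR (- N ^- 2)] and [D] everything. Sums are taken in the extended
    reals, and [gE] supplies their finiteness. *)
Lemma first_step_series (D : pred V) (q : R) (y : V) (k : nat -> V -> R) (g : V -> R) :
  0 <= q -> (forall m x, 0 <= k m x) ->
  (forall x, k 0%N x = (D x)%:R * (x == y)%:R) ->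
  (forall m x, k m.+1 x = (D x)%:R * A (k m) x) ->
  (forall x, (g x)%:E = \sum_(m <oo) (q ^+ m * k m x)%:E)%E ->
  forall x, g x = (D x)%:R * ((x == y)%:R + q * A g x).
Proof.
move=> q0 k0 kz kS gE x.
have p0 m z : (0 <= (q ^+ m * k m z)%:E)%E by rewrite lee_fin mulr_ge0 ?exprn_ge0.
apply: EFin_inj; rewrite gE nneseries_recl// expr0 mul1r kz.
have -> : (\sum_(1 <= m <oo) (q ^+ m * k m x)%:E =
   ((D x)%:R * (q / 4))%:E * ((g (s1 x))%:E + (g (s2 x))%:E + (g (s3 x))%:E + (g (s4 x))%:E))%E.
  rewrite -(@nneseries_addn _ (fun m => (q ^+ m * k m x)%:E) 1%N) ?gE//.
  rewrite -!nneseriesD//; try by move=> *; rewrite ?adde_ge0.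
  rewrite -nneseriesZl; last by move=> *; rewrite ?adde_ge0.
  apply: eq_eseriesr => m _; rewrite addn1 -!EFinD -EFinM kS AE exprS; congr _%:E; by field.
have -> : ((g (s1 x))%:E + (g (s2 x))%:E + (g (s3 x))%:E + (g (s4 x))%:E =
  (g (s1 x) + g (s2 x) + g (s3 x) + g (s4 x))%:E)%E by rewrite !EFinD.
rewrite -EFinM -EFinD; congr _%:E; rewrite AE; by field.
Qed.

End first_step.

(** * The walk operator and its Dirichlet form *)

Section lattice_operator.
Context (R : realType) (V : finType) (a a' b b' : V -> V).
Hypotheses (aK : cancel a a') (a'K : cancel a' a) (bK : cancel b b') (b'K : cancel b' b)
  (ab : forall x, a (b x) = b (a x)).
Implicit Types (f g u v : V -> R).

Definition avg4 f x : R := (f (a x) + f (a' x) + f (b x) + f (b' x)) / 4.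

Definition dot f g : R := \sum_x f x * g x.

Definition delta (y : V) (x : V) : R := (x == y)%:R.

Definition heat_kernel (m : nat) (y x : V) : R := iter m avg4 (delta y) x.

Arguments heat_kernel : simpl never.

Lemma dotC f g : dot f g = dot g f.
Proof. by apply: eq_bigr => x _; rewrite mulrC. Qed.

Lemma dotDl f g u : dot (fun x => f x + g x) u = dot f u + dot g u.
Proof. by rewrite -big_split; apply: eq_bigr => x _; rewrite mulrDl. Qed.

Lemma dotZl (c : R) f u : dot (fun x => c * f x) u = c * dot f u.
Proof. by rewrite mulr_sumr; apply: eq_bigr => x _; rewrite mulrA. Qed.

Lemma dotDr f g u : dot u (fun x => f x + g x) = dot u f + dot u g.
Proof. by rewrite ![dot u _]dotC dotDl. Qed.

Lemma dotZr (c : R) f u : dot u (fun x => c * f x) = c * dot u f.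
Proof. by rewrite ![dot u _]dotC dotZl. Qed.

Lemma dot_deltal f y : dot (delta y) f = f y.
Proof.
rewrite /dot (bigD1 y)//= /delta eqxx mul1r big1 ?addr0// => x /negbTE ->.
by rewrite mul0r.
Qed.

Lemma avg4D f g x : avg4 (fun x => f x + g x) x = avg4 f x + avg4 g x.
Proof. by rewrite /avg4; field. Qed.

Lemma avg4Z (c : R) f x : avg4 (fun x => c * f x) x = c * avg4 f x.
Proof. by rewrite /avg4; field. Qed.

Lemma iter_avg4D m f g : iter m avg4 (fun x => f x + g x) = (fun x =>
  iter m avg4 f x + iter m avg4 g x).
Proof. by elim: m => //= m ->; apply/funext => x; rewrite avg4D. Qed.

Lemma iter_avg4Z m (c : R) f : iter m avg4 (fun x => c * f x) = (fun x => c * iter m avg4 f x).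
Proof. by elim: m => //= m ->; apply/funext => x; rewrite avg4Z. Qed.

Lemma dot_avg4 f g : dot f (avg4 g) = dot (avg4 f) g.
Proof.
have H (s s' : V -> V) : cancel s s' -> cancel s' s -> \sum_x f x * g (s x) = \sum_x f (s' x) * g x.
  move=> sK s'K; rewrite (reindex_inj (can_inj s'K))/=.
  by apply: eq_bigr => x _; rewrite s'K.
transitivity ((\sum_x f x * g (a x) + \sum_x f x * g (a' x) + \sum_x f x * g (b x) +
    \sum_x f x * g (b' x)) / 4).
  by rewrite -!big_split/= mulr_suml; apply: eq_bigr => x _; rewrite /avg4; field.
rewrite (H a a')// (H a' a)// (H b b')// (H b' b)// -!big_split/= mulr_suml.
by apply: eq_bigr => x _; rewrite /avg4; field.
Qed.

Lemma dot_iter_avg4 m f g : dot f (iter m avg4 g) = dot (iter m avg4 f) g.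
Proof. by elim: m f => //= m IH f; rewrite dot_avg4 IH -iterSr. Qed.

(** Both signs come from summing the squares of [f x + e * f (s x)], with [e] equal to [1] or [-1],
    over the four shifts [s], which preserve [dot f f]. *)
Lemma dot_avg4_bound f : `|dot f (avg4 f)| <= dot f f.
Proof.
have H (s s' : V -> V) : cancel s s' -> cancel s' s -> \sum_x f (s x) * f (s x) = dot f f.
  by move=> sK s'K; rewrite [RHS](reindex_inj (can_inj sK)).
have E e : e ^+ 2 = 1 -> 0 <= dot f f + e * dot f (avg4 f).
  move=> e2; have : 0 <= \sum_x ((f x + e * f (a x)) ^+ 2 + (f x + e * f (a' x)) ^+ 2 +
      (f x + e * f (b x)) ^+ 2 + (f x + e * f (b' x)) ^+ 2) / 8.
    by apply: sumr_ge0 => x _; rewrite divr_ge0// !addr_ge0 ?sqr_ge0.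
  congr (0 <= _).
  transitivity (\sum_x (2^-1 * (f x * f x) + 8^-1 * (f (a x) * f (a x)) + 8^-1 * (f (a' x) * f
    (a' x)) +
     8^-1 * (f (b x) * f (b x)) + 8^-1 * (f (b' x) * f (b' x)) + e * (f x * avg4 f x))).
    apply: eq_bigr => x _; rewrite /avg4.
    transitivity (2^-1 * (f x * f x) + 8^-1 * (e ^+ 2 * f (a x) * f (a x)) + 8^-1 * (e ^+ 2 * f
      (a' x) * f (a' x)) +
     8^-1 * (e ^+ 2 * f (b x) * f (b x)) + 8^-1 * (e ^+ 2 * f (b' x) * f (b' x)) + e * (f x *
       avg4 f x)); last by rewrite e2 !mul1r.
    by rewrite /avg4; field.
  rewrite !big_split/= -!mulr_sumr (H a a')// (H a' a)// (H b b')// (H b' b)//.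
  by rewrite /dot; field.
rewrite ler_norml -subr_ge0 opprK addrC; apply/andP; split.
  by have := E 1 (expr1n _ _); rewrite mul1r.
by rewrite -subr_ge0; have := E (-1); rewrite sqrrN expr1n mulN1r; apply.
Qed.

Lemma avg4_sup f (M : R) m : (forall x, `|f x| <= M) -> forall x, `|iter m avg4 f x| <= M.
Proof.
move=> fM; elim: m => //= m IH x; rewrite /avg4 normrM [`|4^-1|]ger0_norm ?invr_ge0//.
rewrite ler_pdivrMr//; move: (iter m avg4 f) IH => g gM.
rewrite (_ : M * 4 = M + M + M + M); last by ring.
by do 3 (apply: (le_trans (ler_normD _ _)); apply: lerD => //).
Qed.

Lemma heat_kernel_ge0 m y x : 0 <= heat_kernel m y x.
Proof.
rewrite /heat_kernel; elim: m x => /= [|m IH] x; first exact: ler0n.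
by rewrite divr_ge0// !addr_ge0.
Qed.

Lemma dot_delta_iter m x y : dot (delta x) (iter m avg4 (delta y)) = heat_kernel m y x.
Proof. by rewrite dot_deltal. Qed.

Lemma heat_kernelC m x y : heat_kernel m x y = heat_kernel m y x.
Proof. by rewrite -!dot_delta_iter dot_iter_avg4 dotC. Qed.

Definition dipole x y (z : V) : R := delta x z - delta y z.

Lemma dot_dipole f x y : dot (dipole x y) f = f x - f y.
Proof.
rewrite /dipole; under eq_fun do rewrite -mulN1r.
by rewrite dotDl dotZl !dot_deltal mulN1r.
Qed.

Definition variogram m x y : R := dot (dipole x y) (iter m avg4 (dipole x y)).

Lemma variogramE m x y :
  variogram m x y = heat_kernel m x x + heat_kernel m y y - 2 * heat_kernel m x y.
Proof.
rewrite /variogram dot_dipole /dipole.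
have -> : (fun z => delta x z - delta y z) = (fun z => delta x z + -1 * delta y z).
  by apply/funext => z; rewrite mulN1r.
rewrite iter_avg4D iter_avg4Z -!/(heat_kernel _ _ _) (heat_kernelC m y x); ring.
Qed.

Lemma avg4_pair_ge0 (q : R) k u : 0 <= q <= 1 ->
  0 <= dot u (iter k.*2 avg4 u) + q * dot u (iter k.*2.+1 avg4 u).
Proof.
move=> /andP[q0 q1]; set v := iter k avg4 u.
have -> : dot u (iter k.*2 avg4 u) = dot v v by rewrite -addnn iterD dot_iter_avg4.
have -> : dot u (iter k.*2.+1 avg4 u) = dot v (avg4 v).
  by rewrite -addnn -addnS iterD dot_iter_avg4.
have := dot_avg4_bound v; rewrite ler_norml => /andP[h _].
have v0 : 0 <= dot v v by apply: sumr_ge0 => x _; rewrite -expr2 sqr_ge0.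
have : q * - dot v v <= q * dot v (avg4 v) by rewrite ler_wpM2l.
have : q * dot v v <= dot v v by rewrite ler_piMl.
by rewrite mulrN; move: (q * dot v (avg4 v)) => *; lra.
Qed.

Lemma sum_pairs (F : nat -> R) k :
  \sum_(m < k.*2) F m = \sum_(j < k) (F j.*2 + F j.*2.+1).
Proof.
elim: k => [|k IH]; first by rewrite !big_ord0.
by rewrite doubleS !big_ord_recr/= IH addrA.
Qed.

Section resolvent.
Variable q : R.
Hypotheses (q0 : 0 <= q) (q1 : q < 1).

Let q01 : 0 <= q <= 1. Proof. by rewrite q0 ltW. Qed.

Definition dirichlet f g : R := dot f g - q * dot f (avg4 g).

Definition partial_green L u x : R := \sum_(m < L) q ^+ m * iter m avg4 u x.

Lemma dot_partial_green L f u : dot f (partial_green L u) = \sum_(m < L) q ^+ m * dot f (iter m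
  avg4 u).
Proof.
rewrite /partial_green /dot; under eq_bigr do rewrite mulr_sumr.
rewrite exchange_big; apply: eq_bigr => m _; rewrite mulr_sumr.
by apply: eq_bigr => x _; ring.
Qed.

(** Telescoping: the truncated potential solves the resolvent equation for [u] up to the single term
    of order [L]. *)
Lemma dirichlet_partial_green L f u :
  dirichlet f (partial_green L u) = dot f u - q ^+ L * dot f (iter L avg4 u).
Proof.
rewrite /dirichlet dot_avg4 !dot_partial_green.
elim: L => [|L IH]; first by rewrite !big_ord0 expr0 mulr0 mul1r !subrr.
rewrite !big_ord_recr/= mulrDr opprD addrACA IH -dot_avg4 -iterS exprS; ring.
Qed.

Lemma iter_partial_green k L u :
  iter k avg4 (partial_green L u) = partial_green L (iter k avg4 u).
Proof.
elim: L => [|L IH].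
  have z w : partial_green 0 w = (fun x => 0 * w x).
    by apply/funext => x; rewrite /partial_green big_ord0 mul0r.
  by rewrite !z iter_avg4Z.
have step w : partial_green L.+1 w = (fun x => partial_green L w x + q ^+ L * iter L avg4 w x).
  by apply/funext => x; rewrite /partial_green big_ord_recr.
by rewrite !step iter_avg4D IH iter_avg4Z -!iterD addnC.
Qed.

Lemma partial_green_ge0 k u : 0 <= dot u (partial_green k.*2 u).
Proof.
rewrite dot_partial_green (sum_pairs (fun m => q ^+ m * dot u (iter m avg4 u)));
  apply: sumr_ge0 => j _.
by rewrite exprS -mulrA mulrCA -mulrDr mulr_ge0 ?exprn_ge0// avg4_pair_ge0.
Qed.

Lemma dirichlet_ge0 f : 0 <= dirichlet f f.
Proof.
have := dot_avg4_bound f; rewrite ler_norml => /andP[_ h].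
have v0 : 0 <= dot f f by apply: sumr_ge0 => x _; rewrite -expr2 sqr_ge0.
rewrite subr_ge0; apply: (@le_trans _ _ (q * dot f f)); first by rewrite ler_wpM2l.
by rewrite ler_piMl// ltW.
Qed.

(* [0 <= dirichlet (f - g) (f - g)], where [g] is the truncated Green potential
   of [u]. *)
Lemma dual_bound k f u : 2 * dot f u <= dirichlet f f + \sum_(m < k.*2) q ^+ m * dot u (iter m
  avg4 u) +
  2 * (q ^+ k.*2 * dot f (iter k.*2 avg4 u)).
Proof.
set g := partial_green k.*2 u.
have := dirichlet_ge0 (fun x => f x + -1 * g x).
have -> : dirichlet (fun x => f x + -1 * g x) (fun x => f x + -1 * g x) =
    dirichlet f f - 2 * dirichlet f g + dirichlet g g.
  rewrite /dirichlet.
  have -> : avg4 (fun x => f x + -1 * g x) = (fun x => avg4 f x + -1 * avg4 g x).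
    by apply/funext => x; rewrite avg4D avg4Z.
  rewrite !(dotDl, dotDr, dotZl, dotZr) (dot_avg4 g f) (dotC (avg4 g)) (dotC g f); ring.
rewrite !dirichlet_partial_green -/g -dot_partial_green -/g.
(* The truncation error paired with [g] itself has a favourable sign: moving half of the even power
   onto [g] reduces it to [partial_green_ge0]. *)
have : 0 <= q ^+ k.*2 * dot g (iter k.*2 avg4 u).
  rewrite mulr_ge0 ?exprn_ge0// -addnn iterD dot_iter_avg4.
  set v := iter k avg4 u.
  have -> : iter k avg4 g = partial_green k.*2 v.
    exact: iter_partial_green.
  by rewrite dotC partial_green_ge0.
rewrite (dotC g u); move: (q ^+ _ * dot g _) (q ^+ _ * dot f _) (dot u g) => *; lra.
Qed.

Lemma variogram_le (D : nat -> R) m x y : (forall z, heat_kernel m z z <= D m) ->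
  variogram m x y <= 2 * D m.
Proof.
move=> hD; rewrite variogramE; have := hD x; have := hD y; have := heat_kernel_ge0 m x y.
by move: (heat_kernel m x x) (heat_kernel m y y) (heat_kernel m x y) => *; lra.
Qed.

(* The times are taken in pairs [2j], [2j + 1] because [avg4] may have negative
   eigenvalues whereas [avg4 ^ 2j (1 + q avg4)] is positive. *)
Definition tail_form (t k : nat) u v : R :=
  \sum_(j < k) q ^+ (t + j).*2 * (dot u (iter (t + j).*2 avg4 v) + q * dot u (iter (t + j).*2.+1
    avg4 v)).

Lemma tail_form_ge0 t k u : 0 <= tail_form t k u u.
Proof. by apply: sumr_ge0 => j _; rewrite mulr_ge0 ?exprn_ge0// avg4_pair_ge0. Qed.

Lemma tail_formC t k u v : tail_form t k u v = tail_form t k v u.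
Proof. by apply: eq_bigr => j _; rewrite !(dot_iter_avg4 _ u) !(dotC _ v). Qed.

Lemma tail_formDr t k u v w : tail_form t k u (fun x =>
  v x + w x) = tail_form t k u v + tail_form t k u w.
Proof.
rewrite /tail_form -big_split/=; apply: eq_bigr => j _.
have D m : dot u (iter m avg4 (fun x => v x + w x)) = dot u (iter m avg4 v) + dot u (iter m avg4 w).
  by rewrite iter_avg4D dotDr.
by rewrite D (D _.+1) /=; ring.
Qed.

Lemma tail_formZr t k u v (c : R) : tail_form t k u (fun x => c * v x) = c * tail_form t k u v.
Proof.
rewrite /tail_form mulr_sumr; apply: eq_bigr => j _.
by rewrite !iter_avg4Z !dotZr; ring.
Qed.

Lemma tail_form_add t k (c : R) u v : 0 < c ->
  tail_form t k (fun x => u x + v x) (fun x => u x + v x) <=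
  (1 + c) * tail_form t k u u + (1 + c^-1) * tail_form t k v v.
Proof.
move=> c0; have := tail_form_ge0 t k (fun x => c * u x + -1 * v x).
rewrite !(tail_formDr, tail_formZr) 4!(tail_formC t k (fun x => _ + _)).
rewrite !(tail_formDr, tail_formZr) (tail_formC t k v u).
move: (tail_form t k u u) (tail_form t k u v) (tail_form t k v v) => A B C h.
have : 0 <= c * A - 2 * B + c^-1 * C.
  have -> : c * A - 2 * B + c^-1 * C = (c * (c * A + -1 * B) + -1 * (c * B + -1 * C)) / c.
    by field; rewrite gt_eqF.
  by rewrite divr_ge0// ltW.
by rewrite !mulrDl !mul1r; move: (c * A) (c^-1 * C) => *; lra.
Qed.

Definition neighbour x y := [|| y == a x, y == a' x, y == b x | y == b' x].

Fixpoint reach (l : nat) (x y : V) : Prop :=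
  if l is l'.+1 then exists2 z, neighbour x z & reach l' z y else x = y.

(** The square root of [tail_form] is a seminorm, hence subadditive along a path. [tail_form_add],
    with [c] the number of remaining steps, gives the square of the length without taking roots. *)
Lemma tail_form_reach t k (kappa : R) l x y :
  (forall z w, neighbour z w -> tail_form t k (dipole z w) (dipole z w) <= kappa) ->
  reach l x y -> tail_form t k (dipole x y) (dipole x y) <= l%:R ^+ 2 * kappa.
Proof.
move=> hk; elim: l x => [|l IH] x /=.
  move=> ->; have -> : dipole y y = (fun x => 0 * delta y x).
    by apply/funext => z; rewrite /dipole subrr mul0r.
  by rewrite tail_formZr !mul0r expr0n mul0r.
move=> [z xz zy].
have -> : dipole x y = (fun o : V => dipole x z o + dipole z y o).
  by apply/funext => o; rewrite /dipole; ring.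
have k0 : 0 <= kappa by apply: le_trans (hk _ _ xz); exact: tail_form_ge0.
case: l IH zy => [_ /= <-|l IH zy].
  have -> : (fun o : V => dipole x z o + dipole z z o) = dipole x z.
    by apply/funext => o; rewrite /dipole subrr addr0.
  by rewrite expr1n mul1r hk.
have l0 : 0 < l.+1%:R :> R by rewrite ltr0n.
apply: (le_trans (tail_form_add t k _ _ l0)).
have -> : l.+2%:R ^+ 2 * kappa = (1 + l.+1%:R) * kappa + (1 + l.+1%:R^-1) * (l.+1%:R ^+ 2 * kappa).
  by rewrite -[l.+2%:R]natr1; field; rewrite gt_eqF.
rewrite lerD// ler_wpM2l ?addr_ge0 ?invr_ge0 ?(ltW l0)//; first exact: hk.
exact: IH.
Qed.

Lemma iter_avg4_shift s m f : (forall x, [/\ s (a x) = a (s x), s (a' x) = a' (s x),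
    s (b x) = b (s x) & s (b' x) = b' (s x)]) ->
  iter m avg4 (fun x => f (s x)) = (fun x => iter m avg4 f (s x)).
Proof.
move=> sc; elim: m => //= m ->; apply/funext => x; rewrite /avg4.
by have [-> -> -> ->] := sc x.
Qed.

Lemma heat_kernel_shift m x y : neighbour x y -> heat_kernel m y y = heat_kernel m x x.
Proof.
have ab' z : a (b' z) = b' (a z) by rewrite -{2}(b'K z) ab bK.
have a'b z : a' (b z) = b (a' z) by rewrite -{1}(a'K z) -ab aK.
have a'b' z : a' (b' z) = b' (a' z) by rewrite -{1}(a'K z) -ab' aK.
have H s s' : cancel s s' -> (forall x, [/\ s (a x) = a (s x), s (a' x) = a' (s x),
    s (b x) = b (s x) & s (b' x) = b' (s x)]) -> heat_kernel m (s x) (s x) = heat_kernel m x x.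
  move=> sK sc; rewrite /heat_kernel.
  have -> : delta x = (fun z => delta (s x) (s z)).
    by apply/funext => z; rewrite /delta (can_eq sK).
  by rewrite (iter_avg4_shift _ _ sc).
case/or4P => /eqP ->; [apply: (H _ a' aK)|apply: (H _ a a'K)|apply: (H _ b' bK)|apply: (H _ b
  b'K)] => z;
  by rewrite ?aK ?a'K ?bK ?b'K ?ab ?ab' ?a'b ?a'b'.
Qed.

(** One neighbour is bounded by the sum over all four, which turns the off-diagonal kernel into the
    diagonal kernel at the next time; the sum over times then telescopes. *)
Lemma tail_form_neighbour t k x y : neighbour x y ->
  tail_form t k (dipole x y) (dipole x y) <= 8 * heat_kernel t.*2 x x.
Proof.
move=> xy.
have F z : neighbour x z -> tail_form t k (dipole x z) (dipole x z) =
    \sum_(j < k) q ^+ (t + j).*2 *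
      ((2 * heat_kernel (t + j).*2 x x - 2 * heat_kernel (t + j).*2 x z) +
       q * (2 * heat_kernel (t + j).*2.+1 x x - 2 * heat_kernel (t + j).*2.+1 x z)).
  move=> xz; apply: eq_bigr => j _.
  by rewrite -!/(variogram _ _ _) !variogramE !(heat_kernel_shift _ xz); ring.
have K m : heat_kernel m.+1 x x = (heat_kernel m x (a x) + heat_kernel m x (a' x) +
   heat_kernel m x (b x) + heat_kernel m x (b' x)) / 4 by [].
have na : neighbour x (a x) by rewrite /neighbour eqxx.
have na' : neighbour x (a' x) by rewrite /neighbour eqxx orbT.
have nb : neighbour x (b x) by rewrite /neighbour eqxx !orbT.
have nb' : neighbour x (b' x) by rewrite /neighbour eqxx !orbT.
have le_all : tail_form t k (dipole x y) (dipole x y) <=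
   tail_form t k (dipole x (a x)) (dipole x (a x)) + tail_form t k (dipole x (a' x)) (dipole x
     (a' x)) +
   tail_form t k (dipole x (b x)) (dipole x (b x)) + tail_form t k (dipole x (b' x)) (dipole x
     (b' x)).
  move: (tail_form_ge0 t k (dipole x (a x))) (tail_form_ge0 t k (dipole x (a' x)))
    (tail_form_ge0 t k (dipole x (b x))) (tail_form_ge0 t k (dipole x (b' x))) => h1 h2 h3 h4.
  by move: xy; case/or4P => /eqP ->; lra.
apply: (le_trans le_all); rewrite !F// -!big_split/=.
pose h j := q ^+ j.*2 * heat_kernel j.*2 x x.
apply: (@le_trans _ _ (\sum_(j < k) 8 * (h (t + j)%N - h (t + j).+1))).
  apply: ler_sum => j _; rewrite /h doubleS.
  have := K (t + j).*2; have := K (t + j).*2.+1.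
  have := heat_kernel_ge0 (t + j).*2.+1 x x; have := heat_kernel_ge0 (t + j).*2.+2 x x.
  have qj : 0 <= q ^+ (t + j).*2 by rewrite exprn_ge0.
  rewrite !exprSr; move: (q ^+ _) qj => Q Q0.
  move: (heat_kernel (t + j).*2.+2 x x) (heat_kernel (t + j).*2.+1 x x) (heat_kernel (t + j).*2
    x x) => h2 h1 h0 h2_ge h1_ge.
  move: (heat_kernel (t + j).*2 x (a x)) (heat_kernel (t + j).*2 x (a' x)) (heat_kernel (t +
    j).*2 x (b x)) (heat_kernel (t + j).*2 x (b' x)) => x1 x2 x3 x4.
  move: (heat_kernel (t + j).*2.+1 x (a x)) (heat_kernel (t + j).*2.+1 x (a' x)) (heat_kernel (t
    + j).*2.+1 x (b x)) (heat_kernel (t + j).*2.+1 x (b' x)) => y1 y2 y3 y4.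
  move=> e2 e1.
  have s1 : x1 + x2 + x3 + x4 = 4 * h1 by rewrite e1; field.
  have s2 : y1 + y2 + y3 + y4 = 4 * h2 by rewrite e2; field.
  have r1 : q * q * h2 <= q * h2 by rewrite ler_wpM2r// ler_piMl// ltW.
  have r2 : q * h1 <= h1 by rewrite ler_piMl// ltW.
  apply: (@le_trans _ _ (Q * (8 * h0 - 2 * (x1 + x2 + x3 + x4) + 8 * (q * h1) -
      2 * (q * (y1 + y2 + y3 + y4))))).
    by rewrite le_eqVlt; apply/orP; left; apply/eqP; ring.
  have -> : 8 * (Q * h0 - Q * q * q * h2) = Q * (8 * h0 - 8 * (q * q * h2)) by ring.
  rewrite s1 s2 [q * (4 * h2)]mulrCA ler_wpM2l//.
  by move: r1 r2; move: (q * q * h2) (q * h2) (q * h1) => *; lra.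
rewrite -mulr_sumr ler_pM2l//.
have -> : \sum_(j < k) (h (t + j)%N - h (t + j).+1) = h t - h (t + k)%N.
  elim: k {F le_all} => [|k IH]; first by rewrite big_ord0 addn0 subrr.
  by rewrite big_ord_recr/= IH addnS; ring.
apply: (@le_trans _ _ (h t)).
  by rewrite gerBl mulr_ge0 ?exprn_ge0// heat_kernel_ge0.
by rewrite /h ler_piMl ?heat_kernel_ge0// exprn_ile1// ltW.
Qed.

(** Times below [t.*2] are bounded by the diagonal kernel and later ones by [tail_form_reach]. The
    boundary term of [dual_bound] tends to zero with the truncation because [q < 1]. *)
Lemma dirichlet_dual_bound (D : nat -> R) f t l x y :
  (forall m z, heat_kernel m z z <= D m) -> reach l x y ->
  2 * (f x - f y) <= dirichlet f f + 2 * (\sum_(m < t.*2) D m) + 8 * l%:R ^+ 2 * D t.*2.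
Proof.
move=> hD xy; set u := dipole x y.
have D0 m : 0 <= D m by apply: le_trans (hD m x); exact: heat_kernel_ge0.
pose M := \sum_z `|f z|.
have fM z : `|f z| <= M by rewrite /M (bigD1 z)//= lerDl sumr_ge0.
have M0 : 0 <= M by exact: sumr_ge0.
have step k : 2 * (f x - f y) <= dirichlet f f + 2 * (\sum_(m < t.*2) D m) + 8 * l%:R ^+ 2 * D
  t.*2 +
    4 * M * q ^+ (t + k).*2.
  have := dual_bound (t + k) f u; rewrite {1}dotC dot_dipole.
  have -> : \sum_(m < (t + k).*2) q ^+ m * dot u (iter m avg4 u) =
      \sum_(m < t.*2) q ^+ m * variogram m x y + tail_form t k u u.
    rewrite doubleD big_split_ord/=; congr (_ + _).
    rewrite (sum_pairs (fun m => q ^+ (t.*2 + m) * dot u (iter (t.*2 + m) avg4 u))).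
    by apply: eq_bigr => j _; rewrite addnS -doubleD exprS; ring.
  have : \sum_(m < t.*2) q ^+ m * variogram m x y <= 2 * (\sum_(m < t.*2) D m).
    rewrite mulr_sumr; apply: ler_sum => m _.
    apply: (@le_trans _ _ (q ^+ m * (2 * D m))).
      by rewrite ler_wpM2l ?exprn_ge0// variogram_le.
    by rewrite ler_piMl ?mulr_ge0// exprn_ile1// ltW.
  have : tail_form t k u u <= l%:R ^+ 2 * (8 * D t.*2).
    apply: tail_form_reach xy => z w zw; apply: (le_trans (tail_form_neighbour _ _ zw)).
    by rewrite ler_pM2l.
  have : 2 * (q ^+ (t + k).*2 * dot f (iter (t + k).*2 avg4 u)) <= 4 * M * q ^+ (t + k).*2.
    have -> : 4 * M * q ^+ (t + k).*2 = 2 * (q ^+ (t + k).*2 * (M + M)) by ring.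
    rewrite ler_pM2l// ler_wpM2l ?exprn_ge0// dot_iter_avg4 dotC dot_dipole.
    have := avg4_sup (t + k).*2 fM; move: (iter _ _ _) => g gM.
    have := gM x; have := gM y; rewrite !ler_norml => /andP[h1 h2] /andP[h3 h4].
    by rewrite lerD// lerNl.
  have -> : l%:R ^+ 2 * (8 * D t.*2) = 8 * l%:R ^+ 2 * D t.*2 by ring.
  move: (8 * l%:R ^+ 2 * D t.*2) (\sum_(m < t.*2) q ^+ m * _) (tail_form _ _ _ _)
    (2 * (\sum_(m < t.*2) D m)) (2 * (q ^+ _ * _)) (4 * M * _) => *; lra.
apply/ler_addgt0Pr => e e0.
have := cvg_expr (z := q); rewrite ger0_norm// => /(_ q1) /cvgrPdist_le.
have M1 : 0 < 4 * M + 1 by rewrite ltr_wpDl// mulr_ge0.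
move=> /(_ (e / (4 * M + 1))); rewrite divr_gt0// => /(_ isT) [k _ hk].
apply: (le_trans (step k)); rewrite lerD2l.
have := hk (t + k).*2; rewrite /= -addnn; rewrite sub0r normrN.
have -> : (k <= t + k + (t + k))%N by lia.
move=> /(_ isT); rewrite ger0_norm ?exprn_ge0// ler_pdivlMr//.
apply: le_trans; rewrite mulrC ler_wpM2l ?exprn_ge0// lerDl//.
Qed.

End resolvent.

End lattice_operator.

(** * Central binomial ratios and Wallis integrals *)

Section central_binomial_ratio.
Context (R : realType).

(** The probability that simple random walk on the line is back at its start at time [2 * j]. *)
Definition cbin (j : nat) : R := 'C(j.*2, j)%:R / (4 ^ j)%:R.

Lemma cbin0 : cbin 0 = 1. Proof. by rewrite /cbin bin0 expn0 divr1. Qed.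

Lemma cbin_gt0 j : 0 < cbin j.
Proof. by rewrite divr_gt0 ?ltr0n ?expn_gt0// bin_gt0 -addnn leq_addr. Qed.

Lemma cbinS j : cbin j.+1 = cbin j * ((j.*2.+1)%:R / (j.*2.+2)%:R).
Proof.
have e : ('C(j.+1.*2, j.+1) * j.*2.+2 = 4 * ('C(j.*2, j) * j.*2.+1))%N.
  have h1 := mul_bin_diag j.*2.+1 j; have h2 := mul_bin_diag j.*2.+2 j.
  have h3 : 'C(j.*2.+1, j) = 'C(j.*2.+1, j.+1).
    by rewrite -(@bin_sub j.*2.+1 j); [congr binomial; lia|lia].
  rewrite doubleS; move: h1 h2; rewrite /= h3; move: 'C(_, _) 'C(_, _) 'C(_, _) => A B C h1 h2.
  have {}h2 : A = (2 * B)%N by apply/eqP; rewrite -(eqn_pmul2l (ltn0Sn j)) -h2; apply/eqP; lia.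
  by rewrite h2; lia.
rewrite /cbin expnS natrM.
have e' : 'C(j.+1.*2, j.+1)%:R = 4 * ('C(j.*2, j)%:R * j.*2.+1%:R) / j.*2.+2%:R :> R.
  by rewrite -!natrM -e natrM mulfK// pnatr_eq0.
rewrite e'; field.
by rewrite -natrD !pnatr_eq0 expn_eq0.
Qed.

(* The primitive of [sin ^ m] vanishing at [0]; its value at [pi / 2] is the
   Wallis integral. *)
Fixpoint sin_primitive (m : nat) (x : R) : R :=
  match m with
  | 0 => x
  | 1 => 1 - cos x
  | m'.+2 => (m'.+1%:R * sin_primitive m' x - sin x ^+ m'.+1 * cos x) / m'.+2%:R
  end.

Lemma is_derive_sin_primitive m (x : R^o) : is_derive x 1 (sin_primitive m) (sin x ^+ m).
Proof.
have [] : is_derive x 1 (sin_primitive m) (sin x ^+ m) /\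
    is_derive x 1 (sin_primitive m.+1) (sin x ^+ m.+1); last by [].
elim: m => [|m [IH1 IH2]]; first split.
- by rewrite expr0; exact: is_derive_id.
- by apply: is_derive_eq; rewrite opprK expr1; ring.
split => //.
have dS : is_derive x 1 (fun y : R^o => sin y ^+ m.+1) (m.+1%:R * sin x ^+ m * cos x).
  by have := is_deriveX m.+1 (is_derive_sin x); rewrite exprfctE.
have -> : sin_primitive m.+2 = (fun y => (m.+1%:R * sin_primitive m y - sin y ^+ m.+1 * cos y) /
  m.+2%:R).
  by apply/funext.
move: (sin_primitive m) IH1 => g dg.
have d1 : is_derive x 1 (fun y : R^o => m.+1%:R * g y) (m.+1%:R * sin x ^+ m).
  by have := is_deriveZ m.+1%:R dg.
have d2 : is_derive x 1 (fun y : R^o => sin y ^+ m.+1 * cos y) (sin x ^+ m.+1 * - sin x + cos x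
  * (m.+1%:R * sin x ^+ m * cos x)).
  by have := is_deriveM dS (is_derive_cos x).
have d3 := is_deriveB d1 d2.
have := is_deriveZ (m.+2%:R^-1) d3.
have -> : m.+2%:R^-1 *: (m.+1%:R * sin x ^+ m - (sin x ^+ m.+1 * - sin x + cos x * (m.+1%:R *
  sin x ^+ m * cos x))) = sin x ^+ m.+2 :> R^o.
  rewrite /GRing.scale/=; have := cos2Dsin2 x; move: (cos x) (sin x) => c s e.
  have c2 : c * c = 1 - s ^+ 2 by rewrite -e; ring.
  transitivity (m.+2%:R^-1 * (m.+1%:R * s ^+ m + s ^+ m.+2 - m.+1%:R * s ^+ m * (c * c))).
    by rewrite !exprS; ring.
  by rewrite c2 !exprS; field; rewrite -natrD pnatr_eq0.
have -> // : (fun y => (m.+1%:R * g y - sin y ^+ m.+1 * cos y) / m.+2%:R) =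
  m.+2%:R^-1 \*: ((fun y : R^o => m.+1%:R * g y) - (fun y : R^o => sin y ^+ m.+1 * cos y)).
by apply/funext => y; rewrite mulrC.
Qed.

Lemma sin_primitive0 m : sin_primitive m 0 = 0.
Proof.
have [] : sin_primitive m 0 = 0 /\ sin_primitive m.+1 0 = 0; last by [].
elim: m => [|m [IH1 IH2]]; first by rewrite /= cos0 subrr.
by split => //=; rewrite IH1 sin0 expr0n mulr0 mul0r subrr mul0r.
Qed.

Lemma sin_primitive_pihalf m :
  sin_primitive m.+2 (pi / 2) = m.+1%:R / m.+2%:R * sin_primitive m (pi / 2).
Proof. by rewrite /= cos_pihalf mulr0 subr0; field; rewrite -natrD pnatr_eq0. Qed.

Lemma sin_primitive_even j : sin_primitive j.*2 (pi / 2) = cbin j * (pi / 2).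
Proof.
elim: j => [|j IH]; first by rewrite cbin0 mul1r.
by rewrite doubleS sin_primitive_pihalf IH cbinS; ring.
Qed.

Lemma sin_primitive_odd j : cbin j * j.*2.+1%:R * sin_primitive j.*2.+1 (pi / 2) = 1.
Proof.
elim: j => [|j IH]; first by rewrite cbin0 /= cos_pihalf subr0 !mulr1.
rewrite doubleS sin_primitive_pihalf cbinS -[RHS]IH.
move: (sin_primitive _ _) => w; field.
by rewrite -!natrD !pnatr_eq0.
Qed.

Lemma sin_primitive_decreasing m : sin_primitive m.+1 (pi / 2) <= sin_primitive m (pi / 2).
Proof.
have p0 : 0 <= pi / 2 :> R by rewrite divr_ge0// pi_ge0.
have D (x : R^o) : is_derive x 1 (fun y : R^o => sin_primitive m y - sin_primitive m.+1 y)
    (sin x ^+ m - sin x ^+ m.+1).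
  by have := is_deriveB (is_derive_sin_primitive m x) (is_derive_sin_primitive m.+1 x).
have [c /andP[c0 c1]] := mean_value p0 (fun x _ => D x).
rewrite !sin_primitive0 subrr !subr0 => e; rewrite -subr_ge0 e mulr_ge0//.
have s0 : 0 <= sin c.
  apply: sin_ge0_pi; rewrite c0 (le_trans c1)// ler_pdivrMr// ler_peMr ?pi_ge0// ler1n//.
by rewrite exprS -[X in X - _]mul1r -mulrBl mulr_ge0 ?exprn_ge0// subr_ge0 sin_le1.
Qed.

(** The Wallis integrals decrease; the even one is [cbin] times [pi / 2] and the odd one a
    reciprocal of [cbin]. The sharp constant [1 / pi] found here decides the leading term of the
    theorem. *)
Lemma cbin_le j : cbin j.+1 ^+ 2 <= (pi * j.+1%:R)^-1.
Proof.
have := sin_primitive_decreasing j.*2.+1; rewrite -doubleS sin_primitive_even => h.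
have o := sin_primitive_odd j.
have c0 := cbin_gt0 j.
have c1 := cbin_gt0 j.+1.
have p0 := pi_gt0 R.
have J0 : 0 < j.+1%:R :> R by rewrite ltr0n.
have e : cbin j.+1 * j.+1.*2%:R = cbin j * j.*2.+1%:R.
  by rewrite cbinS doubleS; field; rewrite -natrD pnatr_eq0.
rewrite -[leRHS]div1r ler_pdivlMr ?mulr_gt0//.
have : cbin j.+1 * j.+1.*2%:R * (cbin j.+1 * (pi / 2)) <= 1.
  have J2 : 0 < j.+1.*2%:R :> R by rewrite ltr0n.
  apply: (@le_trans _ _ (cbin j.+1 * j.+1.*2%:R * sin_primitive j.*2.+1 (pi / 2))).
    exact: ler_wpM2l (ltW (mulr_gt0 c1 J2)) _ _ h.
  by rewrite e o.
apply: le_trans; rewrite -mul2n natrM le_eqVlt; apply/orP; left; apply/eqP; by field.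
Qed.

Lemma cbin_le_inv d : (0 < d)%N -> cbin (d ^ 2) <= d%:R^-1.
Proof.
move=> d0; have D0 : 0 < d%:R :> R by rewrite ltr0n.
rewrite -(@ler_pXn2r _ 2) ?nnegrE ?invr_ge0 ?(ltW D0) ?(ltW (cbin_gt0 _))//.
have E : (d ^ 2 = (d ^ 2).-1.+1)%N by rewrite prednK// expn_gt0 d0.
rewrite {1}E; apply: (le_trans (cbin_le _)); rewrite -E exprVn natrX lef_pV2 ?posrE ?mulr_gt0
  ?exprn_gt0 ?pi_gt0//.
by rewrite ler_peMl ?sqr_ge0// (le_trans _ (pi_ge2 _))// ler1n.
Qed.

Lemma sum_cbin M : \sum_(j < M) cbin j = 2 * M%:R * cbin M.
Proof.
elim: M => [|M IH]; first by rewrite big_ord0 mulr0 mul0r.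
rewrite big_ord_recr/= IH cbinS -mul2n; field.
by rewrite -natrM -natrD pnatr_eq0.
Qed.

Lemma harmonic_le M : \sum_(j < M) (j.+1%:R^-1 : R) <= 1 + ln M.+1%:R.
Proof.
suff : \sum_(j < M.+1) (j.+1%:R^-1 : R) <= 1 + ln M.+1%:R.
  by rewrite big_ord_recr/=; apply: le_trans; rewrite lerDl invr_ge0.
elim: M => [|M IH]; first by rewrite big_ord1 invr1 ln1 addr0.
rewrite big_ord_recr/=; apply: (@le_trans _ _ (1 + ln M.+1%:R + M.+2%:R^-1));
  first by rewrite lerD2r.
rewrite -addrA lerD2l -lerBrDl.
have h : -1 < - (M.+2%:R^-1) :> R by rewrite ltrN2 invf_lt1 ?ltr1n ?ltr0n.
have := le_ln1Dx h; rewrite lerNr => /le_trans; apply.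
rewrite -[leRHS]opprB lerN2.
have -> : 1 - M.+2%:R^-1 = M.+1%:R / M.+2%:R :> R.
  rewrite -[M.+2%:R]natr1; move: (M.+1%:R : R) (ltr0Sn R M) => p p0.
  by field; rewrite gt_eqF// addr_gt0.
by rewrite ln_div ?posrE ?ltr0n.
Qed.

End central_binomial_ratio.

(** * Binomial sums along arithmetic progressions *)

Section binomial_progressions.

(** Each multiple of [h] is charged to the run of [h] indices ending there, on which [u] is at least
    as large. The induction also carries the current incomplete run, counted by [M %% h]. *)
Lemma sum_decreasing_multiples (u : nat -> nat) h M : (0 < h)%N ->
  (forall s, u s.+1 <= u s)%N ->
  (h * (\sum_(s < M) (h %| s.+1) * u s.+1) <= \sum_(s < M) u s.+1)%N.
Proof.
move=> h0 ud.
suff : (h * (\sum_(s < M) (h %| s.+1) * u s.+1) + (M %% h) * u M <= \sum_(s < M) u s.+1)%N.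
  by apply: leq_trans; exact: leq_addr.
elim: M => [|M IH]; first by rewrite !big_ord0 mod0n mul0n muln0.
rewrite !big_ord_recr/=; have uM := ud M.
move: IH; move: (\sum_(s < M) (h %| s.+1) * u s.+1)%N (\sum_(s < M) u s.+1)%N => A B IH.
have mM : (M %% h < h)%N by rewrite ltn_mod.
have [hM|hM] := boolP (h %| M.+1)%N.
  have e1 : (M.+1 %% h = 0)%N by apply/eqP.
  have e2 : (M %% h).+1 = h.
    apply/eqP; rewrite eqn_leq mM dvdn_leq//.
    by move: hM; rewrite {1}(divn_eq M h) -addnS dvdn_addr// dvdn_mull.
  rewrite e1 mul1n mul0n addn0 mulnDr.
  have : (h * u M.+1 = (M %% h) * u M.+1 + u M.+1)%N by rewrite -{1}e2 mulSn addnC.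
  have : ((M %% h) * u M.+1 <= (M %% h) * u M)%N by rewrite leq_mul2l uM orbT.
  by move: IH; move: (M %% h * u M.+1)%N (M %% h * u M)%N (h * u M.+1)%N (h * A)%N => *; lia.
have e1 : (M.+1 %% h = (M %% h).+1)%N by rewrite modnS (negbTE hM).
rewrite e1 mul0n addn0 mulSn.
have : ((M %% h) * u M.+1 <= (M %% h) * u M)%N by rewrite leq_mul2l uM orbT.
by move: IH; move: (M %% h * u M.+1)%N (M %% h * u M)%N (h * A)%N => *; lia.
Qed.

(** The row is symmetric and decreasing away from its centre, so only the central term escapes the
    averaging. Divided by [h * 4 ^ j], it bounds by [cbin j + 1 / h] the return probability on a
    cycle of length [2 * h]. *)
Lemma sum_bin_progression j h : (0 < h)%N ->
  (h * (\sum_(i < j.*2.+1) 'C(j.*2, i) * (h %| `|j - i|)) <= h * 'C(j.*2, j) + 4 ^ j)%N.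
Proof.
move=> h0; pose u s := 'C(j.*2, j + s).
have ud s : (u s.+1 <= u s)%N.
  rewrite /u addnS -(@leq_pmul2l (j + s).+1)// mul_bin_left leq_mul2r; apply/orP; right; lia.
have split (F : nat -> nat) : (\sum_(i < j.*2.+1) F i =
    F j + \sum_(s < j) (F (j - s.+1) + F (j + s.+1)))%N.
  have -> : j.*2.+1 = (j + j.+1)%N by lia.
  rewrite big_split_ord big_ord_recl/= addn0 addnCA; congr (_ + _)%N.
  rewrite big_split/= (reindex_inj rev_ord_inj)/=; congr (_ + _)%N.
have sym s : (s < j)%N -> 'C(j.*2, j - s.+1) = u s.+1.
  move=> sj; rewrite /u -(@bin_sub j.*2 (j + s.+1)); [congr binomial; lia|lia].
have tot : (4 ^ j = 'C(j.*2, j) + 2 * \sum_(s < j) u s.+1)%N.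
  have -> : (4 ^ j = 2 ^ j.*2)%N by rewrite -mul2n expnM.
  have := expnDn 1 1 j.*2; rewrite addn1 => ->.
  under eq_bigr do rewrite !exp1n !muln1.
  rewrite (split (fun i => 'C(j.*2, i))); congr (_ + _)%N.
  by rewrite big_distrr/=; apply: eq_bigr => s _; rewrite sym// -/(u s.+1) addnn mul2n.
rewrite (split (fun i => 'C(j.*2, i) * (h %| `|j - i|)))%N.
have -> : (\sum_(s < j) ('C(j.*2, j - s.+1) * (h %| `|j - (j - s.+1)%N|) +
     'C(j.*2, j + s.+1) * (h %| `|j - (j + s.+1)%N|)) = 2 * \sum_(s < j) (h %| s.+1) * u s.+1)%N.
  rewrite big_distrr/=; apply: eq_bigr => s _; rewrite sym//.
  have -> : `|j - (j - s.+1)%N|%N = s.+1 by have := ltn_ord s; lia.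
  have -> : `|j - (j + s.+1)%N|%N = s.+1 by have := ltn_ord s; lia.
  rewrite -/(u s.+1); lia.
have -> : `|j - j|%N = 0%N by lia.
rewrite dvdn0 muln1 tot; have := sum_decreasing_multiples j h0 ud.
move: (\sum_(s < j) _)%N (\sum_(s < j) _)%N => A B; rewrite mulnDr; lia.
Qed.

End binomial_progressions.

(** * The heat kernel of the torus *)

Section torus_walk.
Context (R : realType).

Definition binsum (phi : int -> R) (m : nat) (k : int) : R :=
  \sum_(i < m.+1) 'C(m, i)%:R * phi (k + m%:Z - 2 * i%:Z).

Lemma binsumS phi m k : binsum phi m.+1 k = binsum phi m (k + 1) + binsum phi m (k - 1).
Proof.
rewrite /binsum big_ord_recl/=.
under eq_bigr do rewrite /bump/= add1n binS natrD mulrDl.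
rewrite big_split/= addrA; congr (_ + _); last first.
  by apply: eq_bigr => i _; congr (_ * phi _); lia.
transitivity (\sum_(i < m.+2) 'C(m, i)%:R * phi (k + 1 + m%:Z - 2 * i%:Z)).
  rewrite [RHS]big_ord_recl/= !bin0; congr (_ * phi _ + _); first by lia.
  by apply: eq_bigr => i _; congr (_ * phi _); rewrite /bump; lia.
by rewrite big_ord_recr/= bin_small// mul0r addr0.
Qed.

Variable N : nat.

(** The probability that simple random walk from [k] is at a multiple of [N] after [m] steps. *)
Definition cycle_kernel (m : nat) (k : int) : R :=
  binsum (fun k => (N%:Z %| k)%Z%:R) m k / 2 ^+ m.

Lemma cycle_kernel0 k : cycle_kernel 0 k = (N%:Z %| k)%Z%:R.
Proof. by rewrite /cycle_kernel /binsum big_ord1 bin0 expr0 divr1 mul1r mulr0 addr0 subr0. Qed.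

Lemma cycle_kernelS m k :
  cycle_kernel m.+1 k = (cycle_kernel m (k + 1) + cycle_kernel m (k - 1)) / 2.
Proof.
rewrite /cycle_kernel binsumS -mulrDl exprS invfM.
by rewrite mulrA [RHS]mulrAC.
Qed.

Lemma cycle_kernel_ge0 m k : 0 <= cycle_kernel m k.
Proof. by rewrite divr_ge0 ?exprn_ge0// sumr_ge0// => i _; rewrite mulr_ge0. Qed.

Lemma cycle_kernel_mod m k k' : (N%:Z %| k - k')%Z -> cycle_kernel m k = cycle_kernel m k'.
Proof.
move=> h; congr (_ / _); apply: eq_bigr => i _; congr (_ * _%:R); congr nat_of_bool.
have -> : k + m%:Z - 2 * i%:Z = (k - k') + (k' + m%:Z - 2 * i%:Z) by ring.
exact: rpredDl.
Qed.

Lemma cycle_kernel_odd j : (2 %| N)%N -> cycle_kernel j.*2.+1 0 = 0.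
Proof.
move=> N2; rewrite /cycle_kernel /binsum big1 ?mul0r// => i _.
case: (boolP (_ %| _)%Z) => h; last by rewrite mulr0.
have /dvdzP[q] : (2 %| 0 + j.*2.+1%:Z - 2 * i%:Z)%Z.
  by apply: dvdz_trans h; rewrite /dvdz /=.
lia.
Qed.

Lemma cycle_kernel_even j h : N = h.*2 -> (0 < h)%N ->
  cycle_kernel j.*2 0 <= cbin R j + 2 / N%:R.
Proof.
move=> Nh h0; have H0 : 0 < h%:R :> R by rewrite ltr0n.
have P0 : 0 < (4 ^ j)%:R :> R by rewrite ltr0n expn_gt0.
have -> : cycle_kernel j.*2 0 =
    (\sum_(i < j.*2.+1) 'C(j.*2, i) * (h %| `|j - i|))%:R%N / (4 ^ j)%:R.
  rewrite /cycle_kernel -natrX -mul2n expnM; congr (_ / _).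
  rewrite natr_sum; apply: eq_bigr => i _; rewrite natrM; congr (_ * _%:R); congr nat_of_bool.
  have -> : 0 + (2 * j)%N%:Z - 2 * i%:Z = 2 * (j%:Z - i%:Z) by lia.
  by rewrite Nh -mul2n dvdzE abszM dvdn_pmul2l.
have := sum_bin_progression j h0.
rewrite -(ler_nat R) natrD !natrM => b.
rewrite /cbin ler_pdivrMr// mulrDl divfK ?gt_eqF// -(ler_pM2l H0) mulrDr.
apply: (le_trans b); rewrite lerD2l Nh -muln2 natrM.
by rewrite le_eqVlt; apply/orP; left; apply/eqP; field; rewrite gt_eqF.
Qed.

Definition east (x : V N) : V N := (ordS x.1, x.2).
Definition west (x : V N) : V N := (ord_pred x.1, x.2).
Definition north (x : V N) : V N := (x.1, ordS x.2).
Definition south (x : V N) : V N := (x.1, ord_pred x.2).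

Lemma eastK : cancel east west. Proof. by move=> [x y]; rewrite /east /west/= ordSK. Qed.
Lemma westK : cancel west east. Proof. by move=> [x y]; rewrite /east /west/= ord_predK. Qed.
Lemma northK : cancel north south. Proof. by move=> [x y]; rewrite /north /south/= ordSK. Qed.
Lemma southK : cancel south north. Proof. by move=> [x y]; rewrite /north /south/= ord_predK. Qed.

Lemma ordS_mod (i : 'I_N) : exists c : int, ordS i = i%:Z + 1 + c * N%:Z :> int.
Proof.
exists (- (i.+1 %/ N)%N%:Z); rewrite /=.
have := divn_eq i.+1 N; move: (i.+1 %% N)%N (i.+1 %/ N)%N => r q; lia.
Qed.

Lemma ord_pred_mod (i : 'I_N) : exists c : int, ord_pred i = i%:Z - 1 + c * N%:Z :> int.
Proof.
exists (1 - ((i + N).-1 %/ N)%N%:Z); rewrite /=.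
have N0 : (0 < N)%N by case: i => i; case: N.
have := divn_eq (i + N).-1 N; move: ((i + N).-1 %% N)%N ((i + N).-1 %/ N)%N => r q; lia.
Qed.

Definition torus_kernel := @heat_kernel R (V N) east west north south.

(* The coordinates [x.1 + x.2] and [x.1 - x.2] of the walk are independent
   simple random walks; the product over-counts since both are read modulo [N]. *)
Lemma torus_kernel_le m (y x : V N) :
  torus_kernel m y x <=
  cycle_kernel m ((x.1%:Z - y.1%:Z) + (x.2%:Z - y.2%:Z)) *
  cycle_kernel m ((x.1%:Z - y.1%:Z) - (x.2%:Z - y.2%:Z)).
Proof.
elim: m x => [|m IH] x.
  rewrite !cycle_kernel0 /torus_kernel /heat_kernel /= /delta.
  case: eqP => [->|_]; last by rewrite mulr_ge0.
  have z1 (u : V N) : u.1%:Z - u.1%:Z + (u.2%:Z - u.2%:Z) = 0 by lia.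
  have z2 (u : V N) : u.1%:Z - u.1%:Z - (u.2%:Z - u.2%:Z) = 0 by lia.
  by rewrite z1 z2 dvdz0 mulr1.
pose s := (x.1%:Z - y.1%:Z) + (x.2%:Z - y.2%:Z); pose t := (x.1%:Z - y.1%:Z) - (x.2%:Z - y.2%:Z).
have per (c u v : int) : u - v = c * N%:Z -> cycle_kernel m u = cycle_kernel m v.
  by move=> e; apply: cycle_kernel_mod; rewrite e dvdz_mull.
have E : torus_kernel m y (east x) <= cycle_kernel m (s + 1) * cycle_kernel m (t + 1).
  have [c e] := ordS_mod x.1; apply: (le_trans (IH _)); rewrite /= e.
  rewrite [X in X * _](per c _ (s + 1)); last by rewrite /s; ring.
  by rewrite [X in _ * X](per c _ (t + 1)) //; rewrite /t; ring.
have Wt : torus_kernel m y (west x) <= cycle_kernel m (s - 1) * cycle_kernel m (t - 1).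
  have [c e] := ord_pred_mod x.1; apply: (le_trans (IH _)); rewrite /= e.
  rewrite [X in X * _](per c _ (s - 1)); last by rewrite /s; ring.
  by rewrite [X in _ * X](per c _ (t - 1)) //; rewrite /t; ring.
have Nt : torus_kernel m y (north x) <= cycle_kernel m (s + 1) * cycle_kernel m (t - 1).
  have [c e] := ordS_mod x.2; apply: (le_trans (IH _)); rewrite /= e.
  rewrite [X in X * _](per c _ (s + 1)); last by rewrite /s; ring.
  by rewrite [X in _ * X](per (- c) _ (t - 1)) //; rewrite /t; ring.
have St : torus_kernel m y (south x) <= cycle_kernel m (s - 1) * cycle_kernel m (t + 1).
  have [c e] := ord_pred_mod x.2; apply: (le_trans (IH _)); rewrite /= e.
  rewrite [X in X * _](per c _ (s - 1)); last by rewrite /s; ring.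
  by rewrite [X in _ * X](per (- c) _ (t + 1)) //; rewrite /t; ring.
rewrite -/s -/t !cycle_kernelS.
have -> : torus_kernel m.+1 y x = (torus_kernel m y (east x) + torus_kernel m y (west x) +
  torus_kernel m y (north x) + torus_kernel m y (south x)) / 4 by [].
move: E Wt Nt St; move: (cycle_kernel m (s + 1)) (cycle_kernel m (t + 1))
  (cycle_kernel m (s - 1)) (cycle_kernel m (t - 1)) => A B C D E Wt Nt St.
rewrite ler_pdivrMr//.
have -> : (A + C) / 2 * ((B + D) / 2) * 4 = A * B + C * D + A * D + C * B by field.
by rewrite !lerD.
Qed.

(** One factor for each diagonal coordinate; odd times vanish by parity, as [N] is even. *)
Definition diagonal_bound (m : nat) : R :=
  if odd m then 0 else (cbin R m./2 + 2 / N%:R) ^+ 2.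

Lemma torus_kernel_diag h m z : N = h.*2 -> (0 < h)%N ->
  torus_kernel m z z <= diagonal_bound m.
Proof.
move=> Nh h0; have z1 (u : V N) : u.1%:Z - u.1%:Z + (u.2%:Z - u.2%:Z) = 0 by lia.
have z2 (u : V N) : u.1%:Z - u.1%:Z - (u.2%:Z - u.2%:Z) = 0 by lia.
have := torus_kernel_le m z z; rewrite z1 z2 => /le_trans; apply.
rewrite /diagonal_bound; case: ifP => o.
  have -> : m = m./2.*2.+1 by rewrite -{1}(odd_double_half m) o.
  by rewrite cycle_kernel_odd ?mulr0// Nh -muln2 dvdn_mull.
have {1 2}-> : m = m./2.*2 by rewrite -{1}(odd_double_half m) o.
rewrite -expr2 lerXn2r ?nnegrE ?cycle_kernel_ge0 ?addr_ge0 ?divr_ge0 ?(ltW (cbin_gt0 _ _))//.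
exact: cycle_kernel_even Nh h0.
Qed.

(** The squares of [cbin] form a harmonic sum up to [d ^ 2], that is [2 / pi * ln d]. The
    corrections in [1 / N] cost at most 8 and 4 because [d <= N]; with [1 + 1 / pi] from the
    harmonic sum they stay below 17. *)
Lemma sum_diagonal_bound d : (2 <= N)%N -> (0 < d)%N -> (d <= N)%N ->
  \sum_(m < (d ^ 2).*2) diagonal_bound m <= 2 / pi * ln d%:R + 17.
Proof.
move=> N2 d0 dN; have D0 : 0 < d%:R :> R by rewrite ltr0n.
have NN : (0 < N)%N by exact: leq_trans N2.
have N0 : 0 < N%:R :> R by rewrite ltr0n.
rewrite sum_pairs.
under eq_bigr do rewrite /diagonal_bound odd_double/= odd_double/= doubleK addr0.
have E j : (cbin R j + 2 / N%:R) ^+ 2 = cbin R j ^+ 2 + (4 / N%:R * cbin R j + 4 / N%:R ^+ 2).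
  by field; rewrite gt_eqF.
under eq_bigr do rewrite E.
rewrite !big_split/= -mulr_sumr sum_cbin sumr_const card_ord.
have t1 : 4 / N%:R * (2 * (d ^ 2)%:R * cbin R (d ^ 2)) <= 8.
  apply: (@le_trans _ _ (4 / N%:R * (2 * (d ^ 2)%:R * d%:R^-1))).
    by rewrite ler_pM2l ?divr_gt0// ler_pM2l ?mulr_gt0 ?ltr0n ?expn_gt0 ?d0// cbin_le_inv.
  have -> : 4 / N%:R * (2 * (d ^ 2)%:R * d%:R^-1) = 8 * (d%:R / N%:R) :> R.
    by rewrite natrX; field; rewrite !gt_eqF.
  by rewrite ler_piMr// ler_pdivrMr// mul1r ler_nat.
have t2 : 4 / N%:R ^+ 2 *+ (d ^ 2) <= 4 :> R.
  rewrite -mulr_natr natrX mulrAC ler_pdivrMr ?exprn_gt0// ler_pM2l// lerXn2r ?nnegrE ?ler_nat//.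
have p2 := pi_ge2 R; have p0 := pi_gt0 R.
have t3 : \sum_(j < d ^ 2) cbin R j ^+ 2 <= 1 + pi^-1 * (1 + 2 * ln d%:R).
  have -> : (d ^ 2 = (d ^ 2).-1.+1)%N by rewrite prednK// expn_gt0 d0.
  rewrite big_ord_recl/= cbin0 expr1n lerD2l.
  apply: (@le_trans _ _ (\sum_(j < (d ^ 2).-1) pi^-1 * j.+1%:R^-1)).
    by apply: ler_sum => j _; rewrite /bump/= add1n; apply: (le_trans (cbin_le _ _)); rewrite invfM.
  rewrite -mulr_sumr ler_pM2l ?invr_gt0//; apply: (le_trans (harmonic_le _ _)).
  by rewrite prednK ?expn_gt0 ?d0// natrX lnXn// mulr_natl.
have t4 : pi^-1 <= 1 :> R by rewrite invf_le1// (le_trans _ p2)// ler1n.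
have e : pi^-1 * (1 + 2 * ln d%:R) = pi^-1 + 2 / pi * ln d%:R :> R by ring.
move: t1 t2 t3 t4; rewrite e.
clear; move: (\sum_(j < d ^ 2) _) (pi^-1) (2 / pi * ln d%:R).
move: (4 / N%:R * (2 * (d ^ 2)%:R * cbin R (d ^ 2))) (4 / N%:R ^+ 2 *+ d ^ 2) => *; lra.
Qed.

Lemma diagonal_bound_diffusive d : (0 < d)%N -> (d <= N)%N ->
  d%:R ^+ 2 * diagonal_bound (d ^ 2).*2 <= 9.
Proof.
move=> d0 dN; have D0 : 0 < d%:R :> R by rewrite ltr0n.
have N0 : 0 < N%:R :> R by rewrite ltr0n (leq_trans d0).
rewrite /diagonal_bound odd_double doubleK -exprMn.
have -> : 9 = 3 ^+ 2 :> R by rewrite -natrX.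
rewrite lerXn2r ?nnegrE ?mulr_ge0 ?addr_ge0 ?divr_ge0 ?(ltW (cbin_gt0 _ _)) ?(ltW D0)//.
rewrite mulrDr; have : d%:R * cbin R (d ^ 2) <= 1.
  by rewrite mulrC -ler_pdivlMr// div1r cbin_le_inv.
have : d%:R * (2 / N%:R) <= 2 :> R.
  by rewrite mulrCA ler_piMr// ler_pdivrMr// mul1r ler_nat.
by move: (d%:R * _) (d%:R * _) => *; lra.
Qed.

End torus_walk.

(** * Increments of the Green functions *)

Section green_increments.
Context (R : realType) (N : nat).

Local Notation torus_avg := (@avg4 R (V N) (@east N) (@west N) (@north N) (@south N)).
Local Notation torus_reach := (@reach (V N) (@east N) (@west N) (@north N) (@south N)).

Lemma torus_reach_dist l (x y : V N) : l = (`|x.1 - y.1| + `|x.2 - y.2|)%N -> torus_reach l x y.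
Proof.
elim: l x => [|l IH] x /= xy.
  have e1 : x.1 = y.1 by apply/val_inj => /=; lia.
  have e2 : x.2 = y.2 by apply/val_inj => /=; lia.
  by rewrite [x]surjective_pairing [y]surjective_pairing e1 e2.
have step (i j : 'I_N) : (i < j)%N -> (ordS i = i.+1 :> nat)%N.
  by move=> ij; rewrite /= modn_small// (leq_ltn_trans ij).
have step' (i j : 'I_N) : (j < i)%N -> (ord_pred i = i.-1 :> nat)%N.
  move=> ij; rewrite /=; have iN := ltn_ord i.
  have -> : ((i + N).-1 = i.-1 + N)%N by lia.
  by rewrite modnDr modn_small//; lia.
have [x1|x1|x1] := ltngtP x.1 y.1.
- exists (east x); first by rewrite /neighbour eqxx.
  have e := step _ _ x1; apply: IH; rewrite /= in e *; rewrite e.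
  move: xy x1; clear; move: (nat_of_ord x.1) (nat_of_ord x.2) (nat_of_ord y.1) (nat_of_ord y.2)
    => p1 p2 r1 r2; lia.
- exists (west x); first by rewrite /neighbour eqxx orbT.
  have e := step' _ _ x1; apply: IH; rewrite /= in e *; rewrite e.
  move: xy x1; clear; move: (nat_of_ord x.1) (nat_of_ord x.2) (nat_of_ord y.1) (nat_of_ord y.2)
    => p1 p2 r1 r2; lia.
have [x2|x2|x2] := ltngtP x.2 y.2.
- exists (north x); first by rewrite /neighbour eqxx !orbT.
  have e := step _ _ x2; apply: IH; rewrite /= in e *; rewrite e.
  move: xy x1 x2; clear; move: (nat_of_ord x.1) (nat_of_ord x.2) (nat_of_ord y.1) (nat_of_ord
    y.2) => p1 p2 r1 r2; lia.
- exists (south x); first by rewrite /neighbour eqxx !orbT.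
  have e := step' _ _ x2; apply: IH; rewrite /= in e *; rewrite e.
  move: xy x1 x2; clear; move: (nat_of_ord x.1) (nat_of_ord x.2) (nat_of_ord y.1) (nat_of_ord
    y.2) => p1 p2 r1 r2; lia.
by exfalso; move: xy; rewrite x1 x2; clear; move: (nat_of_ord y.1) (nat_of_ord y.2) => r1 r2; lia.
Qed.

(** [f] vanishes off [D], so pairing its equation with [f] removes [D] and the Dirichlet form of [f]
    on the whole torus is [f x - f y]. The dual bound then has this quantity on the right once and
    on the left twice. The constant is [2 * 17 + 288], with [288 = 8 * 4 * 9] since the path has
    length at most [2 * d]. *)
Lemma green_increment_le (h : nat) (q : R) (D : pred (V N)) (G : V N -> V N -> R) :
  N = h.*2 -> (0 < h)%N -> 0 < q -> q <= 1 -> (forall x y, G x y = G y x) ->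
  (forall x y, G x y = (D x)%:R * ((x == y)%:R + q * torus_avg (G^~ y) x)) ->
  forall x y, x != y -> increment_var G x y <= 4 / pi * ln (sup_dist x y)%:R + 322.
Proof.
move=> Nh h0 q0 q1 GC GE x y xy.
have N2 : (2 <= N)%N by rewrite Nh; lia.
set d := sup_dist x y.
have d0 : (0 < d)%N by exact: sup_dist_gt0.
have dN : (d <= N)%N.
  have := ltn_ord x.1; have := ltn_ord x.2; have := ltn_ord y.1; have := ltn_ord y.2.
  by rewrite /d /sup_dist; lia.
pose f z := G z x - G z y.
have gE : increment_var G x y = f x - f y.
  by rewrite /increment_var /f (GC y x); ring.
have fE z : f z = (D z)%:R * (dipole R x y z + q * torus_avg f z).
  rewrite /f (GE z x) (GE z y) /dipole /delta -mulrBr; congr (_ * _).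
  by rewrite /avg4; field.
have fP : dot f f - q * dot f (torus_avg f) = f x - f y.
  rewrite -(dot_dipole f x y) /dot mulr_sumr -sumrB; apply: eq_bigr => z _.
  have -> : f z * f z - q * (f z * torus_avg f z) = f z * (f z - q * torus_avg f z) by ring.
  have := fE z; case: (D z) => [|->]; last by rewrite !mul0r mulr0.
  by rewrite mul1r => {2}->; rewrite addrK mulrC.
set K := dot f (torus_avg f) in fP.
set B := 4 / pi * _ + _.
(* The dual bound needs a parameter strictly below one, while the box has [q = 1]; the discrepancy
   is linear in [q - q'] and vanishes in the limit. *)
have step q' : 0 <= q' -> q' < 1 -> f x - f y <= (q - q') * K + B.
  move=> q'0 q'1.
  have hD m z := @torus_kernel_diag R N h m z Nh h0.
  have := @dirichlet_dual_bound R (V N) _ _ _ _ (@eastK N) (@westK N) (@northK N) (@southK N)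
    _ q' q'0 q'1 (diagonal_bound R N) f (d ^ 2)%N _ x y hD (torus_reach_dist erefl).
  have comm (z : V N) : east (north z) = north (east z) by [].
  move=> /(_ comm).
  rewrite /dirichlet -/K.
  have s1 := @sum_diagonal_bound R N d N2 d0 dN.
  have s2 := @diagonal_bound_diffusive R N d d0 dN.
  set l := (_ + _)%N.
  have l2 : (l <= 2 * d)%N by rewrite /l /d /sup_dist; lia.
  have D0 : 0 <= diagonal_bound R N (d ^ 2).*2.
    by rewrite /diagonal_bound; case: ifP => // _; rewrite sqr_ge0.
  have s3 : 8 * l%:R ^+ 2 * diagonal_bound R N (d ^ 2).*2 <= 288.
    apply: (@le_trans _ _ (32 * (d%:R ^+ 2 * diagonal_bound R N (d ^ 2).*2))); last first.
      by apply: (@le_trans _ _ (32 * 9)); [rewrite ler_pM2l|rewrite -natrM ler_nat].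
    rewrite mulrA ler_wpM2r//.
    have : l%:R ^+ 2 <= (2 * d)%:R ^+ 2 :> R by rewrite lerXn2r ?nnegrE// ler_nat.
    by rewrite natrM exprMn; move: (l%:R ^+ 2) (d%:R ^+ 2) => *; lra.
  have BE : B = 2 * (2 / pi * ln d%:R) + 322 by rewrite /B /d; congr (_ + _); ring.
  rewrite BE mulrBl; move: s1 s3 fP; clear.
  move: (\sum_(m < _) _) (2 / pi * _) (8 * l%:R ^+ 2 * _) (dot f f) (f x - f y) => u1 u2 u3 u4 u5.
  move: (q * K) (q' * K) => *; lra.
rewrite gE; apply/ler_addgt0Pr => e e0.
pose t := e / (`|K| + 1 + e).
have k0 : 0 < `|K| + 1 + e by rewrite addr_gt0// ltr_wpDl.
have t0 : 0 < t by rewrite divr_gt0.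
have t1 : t <= 1 by rewrite ler_pdivrMr// mul1r lerDr addr_ge0.
apply: (le_trans (step (q * (1 - t)) _ _)).
- by rewrite mulr_ge0 ?subr_ge0// ltW.
- by rewrite mulrBr mulr1 ltrBlDr (le_lt_trans q1)// ltrDl mulr_gt0.
have -> : q - q * (1 - t) = q * t by ring.
rewrite addrC lerD2l; apply: (le_trans (ler_norm _)).
rewrite normrM ger0_norm; last by rewrite mulr_ge0// ltW.
apply: (@le_trans _ _ (t * `|K|)); first by rewrite ler_wpM2r// ler_piMl// ltW.
rewrite /t mulrAC ler_pdivrMr// ler_pM2l//.
by rewrite -addrA lerDl addr_ge0// ltW.
Qed.

End green_increments.

(** * Walk probabilities as kernels on the index type *)

Section site_kernels.
Context (R : realType) (N : nat).

Local Notation torus_avg := (@avg4 R (V N) (@east N) (@west N) (@north N) (@south N)).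

Lemma sum_unit_steps (f : Z2 -> R) :
  \sum_(e <- unit_steps) f e = f (1, 0) + f (-1, 0) + f (0, 1) + f (0, -1).
Proof. by rewrite /unit_steps !big_cons big_nil addr0 !addrA. Qed.

Lemma stay_kernel_torus m (a z z' : Z2) : torus_equiv N z z' ->
  stay_kernel R predT (fun v => torus_equiv N v a) m z =
  stay_kernel R predT (fun v => torus_equiv N v a) m z'.
Proof.
elim: m z z' => [|m IH] z z' /= zz'.
  congr (_%:R); congr nat_of_bool; move: zz'; rewrite /torus_equiv => /andP[h1 h2].
  have -> : z.1 - a.1 = (z.1 - z'.1) + (z'.1 - a.1) by ring.
  have -> : z.2 - a.2 = (z.2 - z'.2) + (z'.2 - a.2) by ring.
  by congr andb; exact: rpredDl.
congr (_ * (_ / _)); apply: eq_bigr => e _; apply: IH.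
move: zz'; rewrite /torus_equiv /=.
have -> : z.1 + e.1 - (z'.1 + e.1) = z.1 - z'.1 by ring.
by have -> : z.2 + e.2 - (z'.2 + e.2) = z.2 - z'.2 by ring.
Qed.

Lemma torus_equiv_site (x y : V N) : torus_equiv N (site x) (site y) = (x == y).
Proof.
have H (i j : 'I_N) : (N%:Z %| i%:Z - j%:Z)%Z = (i == j).
  apply/idP/eqP => [/dvdzP[q e]|->]; last by rewrite subrr dvdz0.
  apply/val_inj => /=; have := ltn_ord i; have := ltn_ord j.
  move: e; move: (nat_of_ord i) (nat_of_ord j) => a b; clear => e bN aN.
  have q0 : q = 0 by nia.
  by move: e; rewrite q0 mul0r => e; lia.
by rewrite /torus_equiv /site /= !H.
Qed.

Lemma torus_kernelS m (x y : V N) :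
  stay_kernel R predT (fun v => torus_equiv N v (site y)) m.+1 (site x) =
  torus_avg (fun x => stay_kernel R predT (fun v => torus_equiv N v (site y)) m (site x)) x.
Proof.
rewrite /= mul1r sum_unit_steps /avg4.
have E (v : V N) (e : Z2) : torus_equiv N (site x + e) (site v) ->
    stay_kernel R predT (fun v => torus_equiv N v (site y)) m (site x + e) =
    stay_kernel R predT (fun v => torus_equiv N v (site y)) m (site v).
  exact: stay_kernel_torus.
have D (p r c : int) : r = p + c * N%:Z -> (N%:Z %| p - r)%Z.
  by move=> ->; rewrite opprD addrA subrr sub0r -mulNr dvdz_mull.
have Z (p : int) : (N%:Z %| p + 0 - p)%Z by rewrite addr0 subrr dvdz0.
rewrite (E (east x)); last first.
  have [c e] := ordS_mod x.1; rewrite /torus_equiv /site /= Z andbT.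
  by apply: (D _ _ c); rewrite -e.
rewrite (E (west x)); last first.
  have [c e] := ord_pred_mod x.1; rewrite /torus_equiv /site /= Z andbT.
  by apply: (D _ _ c); rewrite -e.
rewrite (E (north x)); last first.
  have [c e] := ordS_mod x.2; rewrite /torus_equiv /site /= Z andTb.
  by apply: (D _ _ c); rewrite -e.
rewrite (E (south x)) //.
have [c e] := ord_pred_mod x.2; rewrite /torus_equiv /site /= Z andTb.
by apply: (D _ _ c); rewrite -e.
Qed.

Lemma off_boundary_site (x : V N) : off_boundary N (site x) ->
  (0 < x.1 /\ x.1.+1 < N /\ 0 < x.2 /\ x.2.+1 < N)%N.
Proof.
move=> h; have : box_interior N (site x).
  apply: contrapT => ni; move: h => /negP; apply; apply/asboolP; split => //.
  have := ltn_ord x.1; have := ltn_ord x.2; rewrite /box /site /= => h1 h2.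
  by split; lia.
rewrite /box_interior /site /= => -[/andP[h1 h2] /andP[h3 h4]].
by repeat split; lia.
Qed.

(** A site off the boundary lies strictly inside the box, so its torus neighbours are its lattice
    neighbours, without wrapping around. *)
Lemma box_kernelS m (x y : V N) :
  stay_kernel R (off_boundary N) (fun v => v == site y) m.+1 (site x) =
  (off_boundary N (site x))%:R *
  torus_avg (fun x => stay_kernel R (off_boundary N) (fun v => v == site y) m (site x)) x.
Proof.
rewrite /=; case: (boolP (off_boundary N (site x))) => [|_]; last by rewrite !mul0r.
move=> /off_boundary_site [h1 [h2 [h3 h4]]].
have S (i : 'I_N) : (i.+1 < N)%N -> (i.+1 %% N = i.+1)%N by move=> iN; rewrite modn_small.
have Q (i : 'I_N) : (0 < i)%N -> ((i + N).-1 %% N = i.-1)%N.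
  move=> i0; have iN := ltn_ord i.
  have -> : ((i + N).-1 = i.-1 + N)%N by lia.
  by rewrite modnDr modn_small//; lia.
have P2 (u v : Z2) : u.1 = v.1 -> u.2 = v.2 -> u = v.
  by case: u v => [u1 u2] [v1 v2] /= -> ->.
rewrite !mul1r sum_unit_steps /avg4; congr ((_ + _ + _ + _) / _); congr stay_kernel;
  apply: P2; rewrite /= ?addr0 ?S ?Q//;
  by move: h1 h3; clear; move: (nat_of_ord x.1) (nat_of_ord x.2) => p r; lia.
Qed.

End site_kernels.

(** * Centred Gaussian fields and their expected maximum *)

Section field_moments.
Context d (T : measurableType d) (R : realType) (P : probability T R) (I : finType).
Variables (X : I -> {RV P >-> R}) (C : I -> I -> \bar R).
Hypothesis hX : centered_gaussian_field X C.

Lemma field_measurable i : measurable_fun setT (X i).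
Proof. exact: measurable_funP. Qed.

Lemma field_law (a : I -> R) : exists m s : R, 0 <= s /\ forall B : set R, measurable B ->
  P ((fun t => \sum_i a i * X i t) @^-1` B) = gaussian_law m s B.
Proof. by case: hX. Qed.

Lemma field_centered i : \int[P]_t X i t = 0.
Proof. by have [_ h _] := hX; have := h i; rewrite unlock /Rintegral => ->. Qed.

(** Also the source of finiteness: an entry of [C], a series in the extended reals in both
    applications, equals the integral of an integrable product. *)
Lemma field_covariance i j : C i j = (\int[P]_t (X i t * X j t))%:E.
Proof.
have [_ h c] := hX; rewrite -c covariance.unlock !h /= unlock.
rewrite EFin_Rintegral; last exact: gaussian_field_prod field_measurable field_law i j.
apply: eq_integral => t _; by rewrite -[X in X%:E]/((X i t - 0) * (X j t - 0)) !subr0.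
Qed.

Variable b : R.
Hypotheses (b0 : 0 < b) (I0 : (0 < #|I|)%N).

(** The maximum lies between one coordinate and [lse], both integrable, which gives its own
    integrability. *)
Lemma expected_max_le : (expected_max P X <= (\int[P]_t lse b (X^~ t))%:E)%E.
Proof.
have iX i : rintegrable P (X i) := gaussian_field_integrable field_measurable field_law i.
have iL : rintegrable P (fun t => lse b (X^~ t)) := lse_integrable I0 b0 iX.
rewrite EFin_Rintegral//.
have /card_gt0P[i0 _] := I0.
have up t : (\big[maxe/-oo]_(i : I) (X i t)%:E <= (lse b (X^~ t))%:E)%E.
  by apply: bigmax_le; [exact: leNye|move=> i _; rewrite lee_fin lse_ge].
have lo t : ((X i0 t)%:E <= \big[maxe/-oo]_(i : I) (X i t)%:E)%E.
  exact: (le_bigmax _ (fun i => (X i t)%:E)).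
apply: le_integral => //.
have iB : rintegrable P (fun t => `|X i0 t| + `|lse b (X^~ t)|).
  by apply: rintegrableD; exact: rintegrable_norm.
apply: (le_integrable measurableT _ _ iB) => [|t _].
  elim: (index_enum I) => [|i s IH]; first by rewrite (_ : (fun _ => _) = cst -oo%E) //;
    apply/funext => t; rewrite big_nil.
  under eq_fun do rewrite big_cons.
  apply: measurable_maxe => //; apply/measurable_EFinP; exact: field_measurable.
move: (up t) (lo t); case: (\big[maxe/-oo]_(i : I) (X i t)%:E)%E => // r.
rewrite /= !lee_fin => h1 h2; rewrite [leRHS]ger0_norm ?addr_ge0//.
rewrite ler_norml; apply/andP; split.
  by apply: (le_trans _ h2); rewrite lerNl (le_trans (ler_norm _))// normrN lerDl.
by apply: (le_trans h1); rewrite (le_trans (ler_norm _))// lerDr.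
Qed.

End field_moments.

(** * Numerical constants and conclusion *)

Section main_bound.
Context (R : realType).

Let s : R := Num.sqrt (2 / pi * ln 2).
Let lam : R := Num.sqrt (2 * ln 4).
Let kap : R := 3 / 2 / lam.

Let ln2 : 0 < ln 2 :> R. Proof. by rewrite ln_gt0// ltr1n. Qed.

Let s0 : 0 < s.
Proof. by rewrite sqrtr_gt0 mulr_gt0// divr_gt0// pi_gt0. Qed.

Let lam0 : 0 < lam.
Proof. by rewrite sqrtr_gt0 mulr_gt0// ln_gt0// ltr1n. Qed.

Let ln4 : ln 4 = 2 * ln 2 :> R.
Proof. by rewrite mulr_natl -lnXn// -natrX. Qed.

Let s_lam : s * lam = 2 * ln 2 * Num.sqrt (2 / pi).
Proof.
have p0 : 0 <= 2 / pi :> R by rewrite divr_ge0// pi_ge0.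
have p1 : 0 <= 2 / pi * ln 2 :> R by rewrite mulr_ge0// ltW.
rewrite /s /lam ln4 -sqrtrM//.
have -> : 2 / pi * ln 2 * (2 * (2 * ln 2)) = (2 * ln 2) ^+ 2 * (2 / pi) :> R by ring.
by rewrite sqrtrM ?sqr_ge0// sqrtr_sqr ger0_norm// mulr_ge0// ltW.
Qed.

Let s_kap : s * kap = 3 / 4 * Num.sqrt (2 / pi).
Proof.
have lam2 : lam ^+ 2 = 4 * ln 2.
  by rewrite sqr_sqrtr ?ln4 ?mulr_ge0 ?(ltW ln2)//; ring.
apply: (mulIf (x := lam ^+ 2)); first by rewrite gt_eqF// exprn_gt0.
have -> : s * kap * lam ^+ 2 = 3 / 2 * (s * lam) by rewrite /kap; field; rewrite gt_eqF.
by rewrite s_lam lam2; field.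
Qed.

Definition extra_levels : nat := Num.bound (322 / (2 * s ^+ 2)).

Definition max_cst : R :=
  s * (lam * extra_levels.+1%:R + 2 + 6 * barrier_cst lam) + 2.

(** The extra leaf levels advance the front by [lam * extra_levels.+1], a constant. They also
    enlarge the argument of the logarithm, which enters negatively, so it may be lowered to [n]. *)
Lemma expected_max_bound (n : nat) d (T : measurableType d) (P : probability T R)
    (X : V (2 ^ n) -> {RV P >-> R}) (C : V (2 ^ n) -> V (2 ^ n) -> \bar R) : (1 <= n)%N ->
  centered_gaussian_field X C ->
  (forall G : V (2 ^ n) -> V (2 ^ n) -> R, (forall x y, C x y = (G x y)%:E) ->
    exists q, exists D : pred (V (2 ^ n)), [/\ 0 < q, q <= 1 &
      forall x y, G x y = (D x)%:R * ((x == y)%:R +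
        q * avg4 (@east _) (@west _) (@north _) (@south _) (G^~ y) x)]) ->
  (expected_max P X <= (2 * ln 2 * Num.sqrt (2 / pi) * n%:R
    - 3 / 4 * Num.sqrt (2 / pi) * ln n%:R + max_cst)%R%:E)%E.
Proof.
move=> n1 hX hG.
have cardV : (0 < #|V (2 ^ n)|)%N by rewrite card_prod card_ord muln_gt0 expn_gt0.
have [q [D [q0 q1 GE]]] := hG _ (field_covariance hX).
set G := fun x y => \int[P]_t (X x t * X y t) in GE.
have GC x y : G x y = G y x by apply: eq_Rintegral => t _; rewrite mulrC.
have nE : n = n.-1.+1 by rewrite prednK.
have Nh : (2 ^ n = (2 ^ n.-1).*2)%N by rewrite {1}nE expnS mul2n.
have inc := green_increment_le Nh (expn_gt0 _ _) q0 q1 GC GE.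
have l0 : 0 <= ln #|V (2 ^ n)|%:R :> R by rewrite ln_ge0// ler1n.
have b0 : 0 < ln #|V (2 ^ n)|%:R + 1 :> R by rewrite ltr_wpDl.
apply: (le_trans (expected_max_le hX b0 cardV)); rewrite lee_fin.
have hC0 : 322 <= 2 * s ^+ 2 * extra_levels%:R.
  have p : 0 < 2 * s ^+ 2 by rewrite mulr_gt0// exprn_gt0.
  rewrite mulrC -ler_pdivrMr//; apply/ltW/archi_boundP.
  exact: divr_ge0 (ler0n _ _) (ltW p).
apply: (le_trans (@expected_lse_le R d T P n extra_levels X (field_measurable X)
  (field_law hX) (field_centered hX) 322 hC0 inc)).
rewrite -/s -/lam -/kap /max_cst -s_lam -s_kap /front.
have n0 : 0 < n%:R :> R by rewrite ltr0n.
have lnn : ln n%:R <= ln ((n + extra_levels.+1)%:R + 1) :> R.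
  by rewrite ler_ln ?posrE ?ltr_wpDl// natr1 ler_nat -addnS leq_addr.
have sk0 : 0 < s * kap by rewrite mulr_gt0// !divr_gt0.
have : s * kap * ln n%:R <= s * kap * ln ((n + extra_levels.+1)%:R + 1) by rewrite ler_pM2l.
move: (ln (_ + 1)) (ln n%:R) (barrier_cst lam) => L1 L2 B h.
rewrite natrD; move: (extra_levels.+1%:R) n%:R => e m; rewrite -subr_ge0.
have -> : s * lam * m - s * kap * L2 + (s * (lam * e + 2 + 6 * B) + 2) -
  (s * (lam * (m + e) - kap * L1 + 2 + 6 * B) + 2) = s * kap * L1 - s * kap * L2 by ring.
by rewrite subr_ge0.
Qed.

End main_bound.

Theorem proposition3p2 (R : realType) :
  exists C2 : R, forall n N : nat, (1 <= n)%N -> N = (2 ^ n)%N ->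
  forall (d : measure_display) (W : measurableType d)
    (Px : Z2 -> probability W R) (w : nat -> W -> Z2) (tau' : {mfun W >-> R}),
  (forall x : Z2, simple_random_walk (Px x) x w) ->
  (forall x : Z2,
     independent_exponential_time (P := Px x) w (N%:R ^- 2) tau') ->
  forall (dX : measure_display) (TX : measurableType dX)
    (PX : probability TX R) (X : V N -> {RV PX >-> R}),
  centered_gaussian_field X (green_box Px w) ->
  forall (dY : measure_display) (TY : measurableType dY)
    (PY : probability TY R) (Y : V N -> {RV PY >-> R}),
  centered_gaussian_field Y (green_torus Px w tau') ->
  (maxe (expected_max PX X) (expected_max PY Y) <=
   (2 * ln 2 * Num.sqrt (2 / pi) * n%:R
    - 3 / 4 * Num.sqrt (2 / pi) * ln n%:R + C2)%R%:E)%E.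
Proof.
exists (max_cst R) => n N n1 NE d W Px w tau' srw hexp dX TX PX X hX dY TY PY Y hY.
subst N; rewrite ge_max; apply/andP; split.
- apply: expected_max_bound n1 hX _ => G GE.
  exists 1, (fun x => off_boundary (2 ^ n) (site x)); split => // x y.
  pose B : pred Z2 := fun v => v == site y.
  apply: (@first_step_series R _ (avg4 (@east _) (@west _) (@north _) (@south _)) (@east _)
    (@west _) (@north _) (@south _) _
    (fun x => off_boundary (2 ^ n) (site x)) 1 y
    (fun m x => stay_kernel R (off_boundary (2 ^ n)) B m (site x)) (G^~ y)) => //.
  + by move=> m z; exact: stay_kernel_ge0.
  + move=> z /=; rewrite /B -mulnb natrM; congr (_ * _%:R); congr nat_of_bool.
  + by move=> m z; exact: box_kernelS.
  + move=> z; rewrite -GE (green_box_series srw); apply: eq_eseriesr => m _.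
    by rewrite expr1n mul1r.
- apply: expected_max_bound n1 hY _ => G GE.
  have N0 : 0 < ((2 ^ n)%:R : R) ^- 2 by rewrite invr_gt0 exprn_gt0// ltr0n expn_gt0.
  exists (expR (- ((2 ^ n)%:R ^- 2))), predT; split.
  + exact: expR_gt0.
  + by rewrite -expR0 ler_expR oppr_le0 ltW.
  move=> x y.
  pose B : pred Z2 := fun v => torus_equiv (2 ^ n) v (site y).
  apply: (@first_step_series R _ (avg4 (@east _) (@west _) (@north _) (@south _)) (@east _)
    (@west _) (@north _) (@south _) _
    predT (expR (- ((2 ^ n)%:R ^- 2))) y
    (fun m x => stay_kernel R predT B m (site x)) (G^~ y)) => //.
  + by move=> m z; exact: stay_kernel_ge0.
  + by move=> z; rewrite /= /B torus_equiv_site mul1r.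
  + by move=> m z; rewrite mul1r; exact: torus_kernelS.
  + by move=> z; rewrite -GE (green_torus_series srw N0 hexp).
Qed.
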